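(* Let $G_{\mathrm{puz}}$ be the ring graph on $V=\mathbb{Z}_n$ (the cycle on $n$ vertices), with parameters $\tau=1$, $\theta=\infty$ and arbitrary $\sigma\ge1$. Assume $p\sim\lambda/\log n$ as $n\to\infty$ for some $\lambda>0$. Let $T_f=\min\{t:\mathcal{P}^{t+1}=\mathcal{P}^t\}$ be the time at which the jigsaw dynamics started from all singletons stops. Then: (a) if $\lambda<\lambda_\sigma$, then $\limsup_{n\to\infty} T_f/\log n<\infty$ in probability, i.e., there is a constant $C<\infty$ such that $\mathbb{P}_p(T_f\le C\log n)\to1$; (b) if $\lambda>\lambda_\sigma$, then $$\frac{\log T_f}{\log n}\to\frac{\lambda_\sigma}{\lambda}\quad\text{in probability as } n\to\infty.$$
   Context: Setting. $G_{\mathrm{puz}}=(V,E_{\mathrm{puz}})$ (the puzzle graph) is a finite connected deterministic graph. $G_{\mathrm{ppl}}=(V,E_{\mathrm{ppl}})$ (the people graph) is the Erdős–Rényi random graph on the same vertex set: each unordered pair of distinct vertices is an edge independently with probability $p$ (which may depend on $n$); $\mathbb{P}_p$ denotes its law. Two vertices $v_1,v_2$ are doubly connected if $\{v_1,v_2\}\in E_{\mathrm{ppl}}\cap E_{\mathrm{puz}}$. For $v\in V$, $S\subset V$, let $\mathrm{coll}(v,S)$ (resp. $\mathrm{link}(v,S)$) be the number of $G_{\mathrm{ppl}}$-neighbors (resp. $G_{\mathrm{puz}}$-neighbors) of $v$ in $S$, not including $v$. Jigsaw percolation with integer parameters $\sigma\ge1$, $\tau\ge1$, $\theta\ge\tau$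 ($\theta=\infty$ allowed) is the following discrete-time dynamics on partitions $\mathcal{P}^t=\{W_i^t\}$ of $V$, $t=0,1,2,\dots$. Given $\mathcal{P}^t$, let $\mathcal{G}_t$ be the graph with vertex set $\mathcal{P}^t$ and unoriented edges between distinct $W_i^t$ and $W_j^t$ such that, for some ordering of the two, at least one of the following holds: (J1) there are doubly connected $v_1\in W_i^t$, $v_2\in W_j^t$; (J2) there is $v_1\in W_i^t$ with $\mathrm{link}(v_1,W_j^t)\ge\theta$; (J3) there is $v_1\in W_i^t$ with $\mathrm{coll}(v_1,W_j^t)\ge\sigma$ and $\mathrm{link}(v_1,W_j^t)\ge\tau$. Then $\mathcal{P}^{t+1}$ is obtained by merging all sets of $\mathcal{P}^t$ that lie in the same connected component of $\mathcal{G}_t$. The initial partition $\mathcal{P}^0$ consists of all singletons. For $\sigma\ge1$, $g_\sigma(x)=-\log\mathbb{P}(\mathrm{Poisson}(x)\ge\sigma)$ and $\lambda_\sigma=\int_0^\infty g_\sigma(x)\,dx$. *)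

(* Defs.v *)
(* MathComp / MathComp-Analysis development. *)
From HB Require Import structures.
From mathcomp Require Import all_boot all_order all_algebra.
From mathcomp Require Import all_classical all_reals all_analysis.

Set Implicit Arguments.
Unset Strict Implicit.
Unset Printing Implicit Defensive.

Import Order.TTheory GRing.Theory Num.Theory.
Import numFieldNormedType.Exports.

Section Jigsaw.
Variables (V : finType) (puz ppl : rel V).
(* [theta = None] encodes theta = oo. *)
Variables (sigma tau : nat) (theta : option nat).

Definition nbr_count (e : rel V) (v : V) (S : {set V}) : nat :=
  #|[pred u in S | (u != v) && e v u]|.

Definition coll := nbr_count ppl.
Definition link := nbr_count puz.

Definition doubly_connected (v1 v2 : V) : bool := ppl v1 v2 && puz v1 v2.

Definition merges_double (A B : {set V}) : bool :=
  [exists v1 in A, exists v2 in B, doubly_connected v1 v2].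
Definition merges_link (A B : {set V}) : bool :=
  if theta is Some th then [exists v1 in A, th <= link v1 B] else false.
Definition merges_coll (A B : {set V}) : bool :=
  [exists v1 in A, (sigma <= coll v1 B) && (tau <= link v1 B)].
(* Not symmetric: the vertex with many neighbours lies in A. *)
Definition merges (A B : {set V}) : bool :=
  [|| merges_double A B, merges_link A B | merges_coll A B].

Definition cluster_graph (P : {set {set V}}) : rel {set V} :=
  fun A B => [&& A \in P, B \in P, A != B & merges A B || merges B A].

Definition jigsaw_step (P : {set {set V}}) : {set {set V}} :=
  [set finset.cover [set B in P | connect (cluster_graph P) A B] | A in P]%SET.

Definition jigsaw (t : nat) : {set {set V}} :=
  iter t jigsaw_step [set [set v] | v in V]%SET.

Lemma cluster_graph_sym P : connect_sym (cluster_graph P).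
Proof.
apply: sym_connect_sym => A B; rewrite /cluster_graph eq_sym orbC.
by case: (A \in P); case: (B \in P).
Qed.

Lemma jigsaw_step_card P : jigsaw_step P != P -> #|jigsaw_step P| < #|P|.
Proof.
move=> neP; rewrite ltn_neqAle leq_imset_card andbT.
apply: contra neP => /imset_injP injP.
suff fixP A : A \in P ->
    finset.cover [set B in P | connect (cluster_graph P) A B]%SET = A.
  by apply/eqP; rewrite /jigsaw_step (eq_in_imset fixP) imset_id.
move=> PA; rewrite -[RHS]finset.cover1; congr finset.cover; apply/setP => B.
rewrite !inE; apply/andP/eqP => [[PB cAB]|->]; last by rewrite connect0.
apply: injP => //; congr finset.cover; apply/setP => D; rewrite !inE.
by rewrite (same_connect (@cluster_graph_sym P) cAB).
Qed.

Lemma jigsaw_stops : exists t, jigsaw t.+1 == jigsaw t.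
Proof.
suff H m t : #|jigsaw t| <= m -> exists t', jigsaw t'.+1 == jigsaw t'.
  exact: (H _ 0 (leqnn _)).
elim: m t => [|m IHm] t le_m; have [fixt|net] := boolP (jigsaw t.+1 == jigsaw t);
    try by exists t.
  by have := leq_trans (jigsaw_step_card net) le_m.
by apply: (IHm t.+1); rewrite -ltnS (leq_trans (jigsaw_step_card net)).
Qed.

Definition jigsaw_time : nat := ex_minn jigsaw_stops.

End Jigsaw.

(* The cycle on Z_n = {0, ..., n-1}; [ordS] is i |-> i + 1 mod n.  The condition
   i != j only matters for n = 1. *)
Definition ring_graph (n : nat) : rel 'I_n :=
  fun i j => (i != j) && ((j == ordS i) || (i == ordS j)).

Section ErdosRenyi.
Variable V : finType.

(* A simple graph on V is a set of two-element subsets of V. *)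
Definition vertex_pairs : {set {set V}} := [set e : {set V} | #|e| == 2]%SET.

Definition adj (E : {set {set V}}) : rel V :=
  fun u v => ([set u; v]%SET \in E).

Local Open Scope ring_scope.

(* Probability of the event A for the Erdos-Renyi graph on V with parameter p,
   whose law is the product over vertex pairs of Bernoulli(p). *)
Definition er_prob (R : realType) (p : R) (A : pred {set {set V}}) : R :=
  \sum_(E : {set {set V}} | (E \subset vertex_pairs) && A E)
    \prod_(e in vertex_pairs) (if e \in E then p else 1 - p).

End ErdosRenyi.

(* T_f on the ring with tau = 1 and theta = oo, as a function of the edge set E
   of the people graph. *)
Definition ring_time (sigma n : nat) (E : {set {set 'I_n}}) : nat :=
  jigsaw_time (@ring_graph n) (adj E) sigma 1 None.

Local Open Scope classical_set_scope.
Local Open Scope ring_scope.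

(* X n converges to c in probability, where X n is a function of the
   Erdos-Renyi graph on 'I_n with parameter p n. *)
Definition er_cvg_in_prob (R : realType) (p : nat -> R)
    (X : forall n, {set {set 'I_n}} -> R) (c : R) : Prop :=
  forall eps : R, 0 < eps ->
    (fun n => er_prob (p n) [pred E | eps < `|X n E - c|]) @ \oo --> (0 : R).

(* Extended-real valued: g_sigma 0 = +oo for sigma >= 1.  The second argument of
   [poisson_prob] is a dummy: the measure does not depend on it. *)
Definition g_ (R : realType) (sigma : nat) (x : R) : \bar R :=
  (- lne (poisson_prob x 0%N [set k | (sigma <= k)%N]))%E.

Definition lambda_ (R : realType) (sigma : nat) : \bar R :=
  (\int[@lebesgue_measure R]_(x in `[0%R, +oo[) g_ sigma x)%E.

(* Main.v *)
(* On the ring every cluster is an arc, and an arc of length k is spanned by its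
   own edges with probability about prod_(m < k) P(Bin(m, p) >= sigma): it grows
   one vertex at a time. For p small and k of order 1/p this product is a Riemann
   sum, exp(- lambda_sigma / p + o(1/p)), that is n^(- lambda_sigma / lambda + o(1)).

   Upper bound. An arc may grow at either end, which naively costs a factor 2^k.
   It disappears by giving priority to the right end: growth at the left end only,
   followed by growth at the right end, forces the edge between the two extreme
   vertices to be open, which has probability p. Merging of two long arcs is
   negligible by a crude bound of the form (2 k p)^(k - 1). Any cluster of length
   at least K comes from a spanned arc of length in [K, 2K). A cluster born at time
   t has more than t vertices, so T_f is less than the largest cluster size; this
   gives (a), by a union bound over the arcs with K of order log n. In (b), a region
   of length n^(lambda_sigma / lambda - eps) contains no such arc and can be invaded
   from outside only by 2K vertices per step, so the puzzle is not solved before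
   that time up to logarithmic factors; it does get solved eventually.

   Lower bound. Growing to the right only, one vertex per step, an arc reaches length
   C log n with the probability above, and from then on it never stops, since every
   vertex has sigma people-neighbours among the C log n preceding ones. Disjoint
   blocks being independent, each interval of length
   n^(lambda_sigma / lambda + eps) contains such a nucleus, and the puzzle is solved
   in a time comparable with that length. *)

Require Import Defs.
From HB Require Import structures.
From mathcomp Require Import all_boot all_order all_algebra.
From mathcomp Require Import all_classical all_reals all_analysis.
From mathcomp Require Import measurable_realfun.
From mathcomp Require Import zify ring lra.

Set Implicit Arguments.
Unset Strict Implicit.
Unset Printing Implicit Defensive.

Import Order.TTheory GRing.Theory Num.Theory.
Import numFieldNormedType.Exports.
Import mathcomp.boot.bigop mathcomp.boot.fintype mathcomp.boot.finset.
Local Open Scope ring_scope.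

(** * Product Bernoulli measure *)

(** Two bounds on the spanning probability have complementary ranges. Counting edges gives (e k
    p)^(k-1), which is worthless once k p is large, hence on the scale that decides the answer. The
    recursion over the last merge is sharp there, but it sums over all splits into two arcs and
    needs geometric decay for short pieces as an input. The two are glued by comparison with a
    product whose factors are the constant h/2 up to a length K0 of order 1/p, and from there on 1 +
    eps times the attachment bound floored at h. Up to K0 the edge count beats this product by
    2^-(k-1), so that all splits together cost only O(p). Since h is the Poisson tail at the first
    mesh point d, the floor is absorbed by the Riemann sum of mesh d. All estimates are made as p
    tends to 0 from the right, uniformly in the size of the ring and in the position of the arc;
    only afterwards is p ~ lambda / log n inserted. *)

Section BernoulliProduct.
Variables (R : realType) (T : finType) (a : T -> R).
Implicit Types (A B : {set T} -> Prop) (E X Y J : {set T}).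

(** The parameter varies with the element so that vertex sets which are not pairs can get
    probability 0: the random graph then lives on all sets of vertex sets. *)
Definition bwt E : R := \prod_e (if e \in E then a e else 1 - a e).

Definition pr A : R := \sum_(E : {set T}) bwt E * (`[< A E >])%:R.

(** One implication is enough, because [E] and [E'] can be exchanged. *)
Definition depends_on X A :=
  forall E E', (E :&: X = E' :&: X)%SET -> A E -> A E'.

Lemma depends_on_eq X A E E' : depends_on X A ->
  (E :&: X = E' :&: X)%SET -> `[< A E >] = `[< A E' >].
Proof. by move=> dA eE; apply/asboolP/asboolP; apply: dA. Qed.

Lemma depends_onS X Y A : X \subset Y -> depends_on X A -> depends_on Y A.
Proof.
move=> sXY dA E E' eE; apply: dA.
by rewrite -(setIidPr sXY) !setIA eE.
Qed.

Lemma depends_onI X A B :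
  depends_on X A -> depends_on X B -> depends_on X (fun E => A E /\ B E).
Proof. by move=> dA dB E E' eE [AE BE]; split; [exact: dA eE _|exact: dB eE _]. Qed.

Lemma depends_onU X A B :
  depends_on X A -> depends_on X B -> depends_on X (fun E => A E \/ B E).
Proof.
by move=> dA dB E E' eE [AE|BE]; [left; exact: dA eE _|right; exact: dB eE _].
Qed.

Lemma depends_onN X A : depends_on X A -> depends_on X (fun E => ~ A E).
Proof. by move=> dA E E' eE nA A'; apply: nA; apply: dA A'. Qed.

Lemma bwt_prod (F G : T -> R) :
  \sum_(E : {set T}) \prod_e (if e \in E then F e else G e) = \prod_e (F e + G e).
Proof. by rewrite bigA_distr. Qed.

Lemma sum_bwt : \sum_(E : {set T}) bwt E = 1.
Proof.
by rewrite /bwt bwt_prod big1 // => e _; rewrite addrC subrK.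
Qed.

(** Draw two independent copies and exchange their parts inside [X]. The product weight is
    preserved, while [A] on one copy and [B] on the other become [A] and [B] on the same copy. *)
Lemma pr_and X Y A B : [disjoint X & Y] -> depends_on X A -> depends_on Y B ->
  pr (fun E => A E /\ B E) = pr A * pr B.
Proof.
move=> dXY dA dB.
pose swap (EE : {set T} * {set T}) : {set T} * {set T} :=
  ((EE.1 :&: X) :|: (EE.2 :\: X), (EE.2 :&: X) :|: (EE.1 :\: X))%SET.
have swapK : involutive swap.
  move=> [E F]; rewrite /swap /=; congr pair; apply/setP => e; rewrite !inE;
  by case: (e \in X); case: (e \in E); case: (e \in F).
rewrite -[LHS]mulr1 -[X in _ * X]sum_bwt /pr !big_distrlr /= !pair_big /=.
rewrite [RHS](reindex_inj (inv_inj swapK)) /=; apply: eq_bigr => -[E F] _ /=.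
have -> : `[< A ((E :&: X) :|: (F :\: X))%SET >] = `[< A E >].
  apply: (@depends_on_eq X) => //; apply/setP => e; rewrite !inE.
  by case: (e \in X); rewrite ?andbF ?orbF ?andbT.
have -> : `[< B ((F :&: X) :|: (E :\: X))%SET >] = `[< B E >].
  apply: (@depends_on_eq Y) => //; apply/setP => e; rewrite !inE.
  have [eY|] := boolP (e \in Y); last by rewrite !andbF.
  by rewrite (disjointFl dXY eY) /= !andbT andbF.
rewrite asbool_and [RHS]mulrACA [LHS]mulrAC.
have -> : bwt E * bwt F =
    bwt ((E :&: X) :|: (F :\: X))%SET * bwt ((F :&: X) :|: (E :\: X))%SET.
  rewrite /bwt -!big_split; apply: eq_bigr => e _ /=; rewrite !inE.
  by case: (e \in X); rewrite ?andbT ?andbF ?orbF ?orFb //= mulrC.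
by rewrite -mulnb natrM.
Qed.

Lemma pr_forall (m : nat) (X : nat -> {set T}) (A : nat -> {set T} -> Prop) :
  (forall i j, (i < j < m)%N -> [disjoint X i & X j]) ->
  (forall i, (i < m)%N -> depends_on (X i) (A i)) ->
  pr (fun E => forall i, (i < m)%N -> A i E) = \prod_(i < m) pr (A i).
Proof.
elim: m => [|m IHm] dX dA.
  rewrite big_ord0 -[RHS]sum_bwt; apply: eq_bigr => E _.
  by rewrite asboolT ?mulr1.
rewrite big_ord_recr /= -IHm; first last.
- by move=> i lt_im; apply: dA; rewrite ltnW.
- by move=> i j /andP[ij jm]; apply: dX; rewrite ij ltnW.
rewrite -(@pr_and (\bigcup_(i < m) X i)%SET (X m)); first last.
- exact: dA.
- move=> E E' eE AE i im; move: (AE i im); apply: (dA i (ltnW im)).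
  have sX : (X i \subset \bigcup_(i < m) X i)%SET.
    by apply: (bigcup_sup (Ordinal im)).
  by rewrite -(setIidPr sX) !setIA eE.
- rewrite -setI_eq0 -subset0; apply/subsetP => e; rewrite !inE => /andP[/bigcupP[i _ eX] em].
  have /disjoint_setI0 /setP/(_ e) : [disjoint X i & X m] by apply: dX; rewrite ltn_ord /=.
  by rewrite !inE eX em.
apply: eq_bigr => E _; congr (_ * _%:R); congr nat_of_bool.
apply/asboolP/asboolP => [AE|[AE Am] i].
  by split=> [i im|]; apply: AE => //; rewrite ltnW.
by rewrite ltnS leq_eqVlt => /orP[/eqP->|/AE].
Qed.

Lemma pr_not A : pr (fun E => ~ A E) = 1 - pr A.
Proof.
rewrite -[X in X - _]sum_bwt -sumrB; apply: eq_bigr => E _.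
by rewrite asbool_neg; case: `[< _ >] => /=; ring.
Qed.

Hypothesis a01 : forall e, 0 <= a e <= 1.

Lemma bwt_ge0 E : 0 <= bwt E.
Proof.
apply: prodr_ge0 => e _; have /andP[a0 a1] := a01 e.
by case: ifP => _ //; rewrite subr_ge0.
Qed.

Lemma pr_ge0 A : 0 <= pr A.
Proof. by apply: sumr_ge0 => E _; rewrite mulr_ge0 ?bwt_ge0. Qed.

Lemma pr_le A B : (forall E, A E -> B E) -> pr A <= pr B.
Proof.
move=> AB; apply: ler_sum => E _; apply: ler_wpM2l; first exact: bwt_ge0.
by rewrite ler_nat; case: asboolP => // /AB BE; rewrite asboolT.
Qed.

Lemma pr_le1 A : pr A <= 1.
Proof.
by rewrite -subr_ge0 -pr_not pr_ge0.
Qed.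

Lemma pr_or A B : pr (fun E => A E \/ B E) <= pr A + pr B.
Proof.
rewrite -big_split; apply: ler_sum => E _ /=; rewrite -mulrDr.
apply: ler_wpM2l; first exact: bwt_ge0.
by rewrite asbool_or; case: `[< A E >]; case: `[< B E >]; rewrite /= ?addr0 ?add0r // lerDl.
Qed.

Lemma pr_ex (m n : nat) (A : nat -> {set T} -> Prop) :
  pr (fun E => exists2 i, (m <= i < n)%N & A i E) <= \sum_(m <= i < n) pr (A i).
Proof.
elim: n => [|n IHn].
  rewrite big_geq // /pr big1 // => E _; rewrite asboolF ?mulr0 //.
  by case=> i; rewrite ltn0 andbF.
have [lemn|ltnm] := leqP m n; last first.
  rewrite big_geq // /pr big1 // => E _; rewrite asboolF ?mulr0 //.
  by case=> i; lia.
rewrite big_nat_recr //=; apply: le_trans (lerD IHn (lexx _)).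
apply: le_trans (pr_or _ _); apply: pr_le => E [i /andP[mi]].
rewrite ltnS leq_eqVlt => /orP[/eqP-> An|im Ai]; first by right.
by left; exists i; rewrite ?mi.
Qed.

(** Setting the absence weight to 0 on [J] in the expansion [bwt_prod] leaves exactly the supersets
    of [J]; [pr_eqI] uses the same device. *)
Lemma pr_superset J : pr (fun E => J \subset E) = \prod_(e in J) a e.
Proof.
have -> : \prod_(e in J) a e =
    \prod_e ((if e \in J then a e else a e) + (if e \in J then 0 else 1 - a e)).
  rewrite [RHS](bigID (mem J)) /= [X in _ = _ * X]big1 ?mulr1.
    by apply: eq_bigr => e ->; rewrite addr0.
  by move=> e /negPf->; rewrite addrC subrK.
rewrite -bwt_prod; apply: eq_bigr => E _.
have [sJE|nsJE] := boolP (J \subset E).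
  rewrite asboolT // mulr1; apply: eq_bigr => e _.
  have := subsetP sJE e.
  by case: (e \in J) => [->|_]; case: (e \in E).
rewrite asboolF; last exact/negP.
have [e eJ eE] := subsetPn nsJE.
by rewrite mulr0 (bigD1 e) //= (negPf eE) eJ mul0r.
Qed.

Lemma pr_eqI X J : J \subset X ->
  pr (fun E => (E :&: X)%SET = J) =
  \prod_(e in X) (if e \in J then a e else 1 - a e).
Proof.
move=> sJX.
have -> : \prod_(e in X) (if e \in J then a e else 1 - a e) =
    \prod_e ((if (e \in X) && (e \notin J) then 0 else a e)
              + (if e \in J then 0 else 1 - a e)).
  rewrite [RHS](bigID (mem X)) /= [X in _ = _ * X]big1 ?mulr1.
    apply: eq_bigr => e -> /=; case: ifP => _ /=; by rewrite ?addr0 ?add0r.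
  move=> e eX; rewrite (negPf eX) /=.
  have /negPf-> : e \notin J by apply: contra eX => /(subsetP sJX).
  by rewrite addrC subrK.
rewrite -bwt_prod; apply: eq_bigr => E _.
have [EJ|EJ] := pselect ((E :&: X)%SET = J).
  rewrite asboolT // mulr1; apply: eq_bigr => e _.
  have := congr1 (fun S : {set T} => e \in S) EJ; rewrite !inE.
  by case: (e \in J); case: (e \in E); case: (e \in X).
rewrite asboolF // mulr0.
have [e] : exists e, (e \in (E :&: X)%SET) != (e \in J).
  apply/existsP; apply: contra_notT EJ => /existsPn EJ; apply/setP => e.
  by apply/eqP; have := EJ e; rewrite negbK.
rewrite !inE => ne; rewrite (bigD1 e) //=.
have := subsetP sJX e.
move: ne; case: (e \in E); case: (e \in J); case: (e \in X);
  rewrite //= ?mul0r // => _ H; by have := H isT.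
Qed.

Variable p : R.

(** Union bound over the [j]-subsets of [X] that [E] may contain. *)
Lemma pr_atleast X j : (forall e, e \in X -> a e = p) ->
  pr (fun E => (j <= #|E :&: X|)%N) <= p ^+ j *+ 'C(#|X|, j).
Proof.
move=> aX; have p0 J : (J \in [set A : {set T} | A \subset X & #|A| == j])%SET ->
   pr (fun E => J \subset E) = p ^+ j.
  rewrite inE => /andP[sJX /eqP <-]; rewrite pr_superset -prodr_const.
  by apply: eq_bigr => e /(subsetP sJX)/aX.
rewrite -cards_draws -sumr_const -(eq_bigr _ p0) /pr exchange_big /=.
apply: ler_sum => E _; rewrite -mulr_sumr; apply: ler_wpM2l; first exact: bwt_ge0.
case: asboolP => [lej|_] /=; last by apply: sumr_ge0.
have [J] : exists J, J \in [set A : {set T} | A \subset E :&: X & #|A| == j]%SET.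
  by apply/set0Pn; rewrite -card_gt0 cards_draws bin_gt0.
rewrite inE subsetI => /andP[/andP[sJE sJX] cJ].
rewrite (bigD1 J) /= ?inE ?sJX //= asboolT // lerDl.
by apply: sumr_ge0.
Qed.

Lemma pr_card_lt X j : (forall e, e \in X -> a e = p) ->
  pr (fun E => (#|E :&: X| < j)%N) =
  \sum_(i < j) p ^+ i * (1 - p) ^+ (#|X| - i) *+ 'C(#|X|, i).
Proof.
move=> aX.
transitivity (\sum_(i < j) pr (fun E => #|E :&: X| = i)).
  rewrite /pr exchange_big; apply: eq_bigr => E _ /=.
  rewrite -mulr_sumr; congr (_ * _).
  have [ltj|gej] := ltnP #|E :&: X| j.
    rewrite asboolT // (bigD1 (Ordinal ltj)) //= asboolT // big1 ?addr0 //.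
    move=> i ne; rewrite asboolF // => e; case/eqP: ne; exact: val_inj.
  rewrite asboolF //.
  rewrite big1 // => i _.
  by rewrite asboolF // => e; move: gej; rewrite e leqNgt ltn_ord.
apply: eq_bigr => i _; rewrite -cards_draws -sumr_const.
have pJ J : (J \in [set A : {set T} | A \subset X & #|A| == i])%SET ->
   pr (fun E => (E :&: X)%SET = J) = p ^+ i * (1 - p) ^+ (#|X| - i).
  rewrite inE => /andP[sJX /eqP cJ]; rewrite pr_eqI // (big_setID J) /=.
  have XJ : X :&: J = J by apply/setIidPr.
  have cXJ : #|X :\: J| = (#|X| - #|J|)%N by rewrite cardsD XJ.
  rewrite XJ -cJ -cXJ; congr (_ * _).
    rewrite -prodr_const; apply: eq_bigr => e eJ.
    by rewrite eJ aX // (subsetP sJX).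
  rewrite -prodr_const; apply: eq_bigr => e; rewrite inE => /andP[/negPf-> eX].
  by rewrite aX.
rewrite -(eq_bigr _ pJ) /pr exchange_big; apply: eq_bigr => E _ /=.
rewrite -mulr_sumr; congr (_ * _).
have [eqi|nei] := eqVneq #|E :&: X| i.
  rewrite asboolT // (bigD1 (E :&: X)%SET) /=; last first.
    by rewrite inE subsetIr eqi eqxx.
  rewrite asboolT // big1 ?addr0 // => J /andP[_ /eqP ne].
  by rewrite asboolF // => e; case: ne.
rewrite asboolF; last exact/eqP.
rewrite big1 // => J; rewrite inE => /andP[_ /eqP cJ].
by rewrite asboolF // => e; case/eqP: nei; rewrite e.
Qed.

End BernoulliProduct.

(** P(Bin(m, p) >= sigma), written through the complement: the sum has [sigma] terms for every [m],
    so the Poisson limit can be taken term by term. *)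
Definition binomial_tail (R : realType) (p : R) (sigma m : nat) : R :=
  1 - \sum_(i < sigma) p ^+ i * (1 - p) ^+ (m - i) *+ 'C(m, i).

(** * Bounds on binomial tails *)

Section BinomialTail.
Variables (R : realType) (p : R).
Hypothesis p01 : 0 <= p <= 1.
Implicit Types (sigma m : nat).

Lemma binomial_tailE (T : finType) (X : {set T}) sigma :
  pr (fun=> p) (fun E => (sigma <= #|E :&: X|)%N) = binomial_tail p sigma #|X|.
Proof.
rewrite /binomial_tail -(@pr_card_lt _ _ (fun=> p)) // -pr_not.
by apply: eq_bigr => E _; rewrite asbool_neg !asboolb leqNgt.
Qed.

(** A coupling: all Bin(k, p) with k <= m are realised on the same m trials, which makes
    monotonicity in k an inclusion of events. *)
Lemma binomial_tail_ord sigma m k : (k <= m)%N ->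
  binomial_tail p sigma k =
  pr (fun=> p) (fun E => (sigma <= #|E :&: [set i : 'I_m | (i < k)%N]|)%N).
Proof.
move=> lekm; rewrite binomial_tailE; congr binomial_tail.
have -> : [set i : 'I_m | (i < k)%N] = [set widen_ord lekm i | i in 'I_k].
  apply/setP => i; rewrite inE; apply/idP/imsetP => [lti|[j _ ->]]; last exact: (ltn_ord j).
  by exists (Ordinal lti) => //; apply: val_inj.
rewrite card_imset ?card_ord // => i j e; apply: val_inj; exact: (congr1 val e).
Qed.

Lemma binomial_tail_ge0 sigma m : 0 <= binomial_tail p sigma m.
Proof. by rewrite (binomial_tail_ord sigma (leqnn m)); apply: pr_ge0. Qed.

Lemma binomial_tail_le1 sigma m : binomial_tail p sigma m <= 1.
Proof. by rewrite (binomial_tail_ord sigma (leqnn m)); apply: pr_le1. Qed.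

Lemma binomial_tail_homo sigma m k : (k <= m)%N ->
  binomial_tail p sigma k <= binomial_tail p sigma m.
Proof.
move=> lekm; rewrite (binomial_tail_ord sigma lekm) (binomial_tail_ord sigma (leqnn m)).
apply: pr_le => // E /leq_trans; apply; apply/subset_leq_card/subsetP => i.
by rewrite !inE => /andP[-> _] /=.
Qed.

Lemma binomial_tail_ge sigma m :
  p ^+ sigma * (1 - p) ^+ (m - sigma) *+ 'C(m, sigma) <= binomial_tail p sigma m.
Proof.
have := binomial_tail_ge0 sigma.+1 m.
by rewrite /binomial_tail big_ord_recr /= opprD addrA subr_ge0.
Qed.

(** For i < sigma the i-th term is at most 2^sigma times the same term with p^i replaced by (p/2)^i,
    and the latter sum to at most (1 - p + p/2)^m <= exp(-m p / 2). *)
Lemma binomial_tail_chernoff sigma m :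
  1 - 2 ^+ sigma * expR (- (m%:R * p / 2)) <= binomial_tail p sigma m.
Proof.
have /andP[p0 p1] := p01.
have pos i : 0 <= (p / 2) ^+ i * (1 - p) ^+ (m - i) *+ 'C(m, i).
  by rewrite mulrn_wge0 // mulr_ge0 ?exprn_ge0 ?subr_ge0 ?divr_ge0.
rewrite /binomial_tail lerD2l lerNl opprK.
have sum_le : \sum_(i < sigma) (p / 2) ^+ i * (1 - p) ^+ (m - i) *+ 'C(m, i) <= (1 - p / 2) ^+ m.
  have -> : 1 - p / 2 = (1 - p) + p / 2 by field.
  rewrite exprDn; set F := fun i : nat => (p / 2) ^+ i * (1 - p) ^+ (m - i) *+ 'C(m, i).
  have -> : \sum_(i < m.+1) (1 - p) ^+ (m - i) * (p / 2) ^+ i *+ 'C(m, i) = \sum_(i < m.+1) F i.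
    by apply: eq_bigr => i _; rewrite mulrC.
  rewrite -!(big_mkord xpredT F); have [le_m|lt_m] := leqP sigma m.+1.
    by rewrite (big_cat_nat (leq0n _) le_m) //= lerDl sumr_ge0 // => i _; apply: pos.
  rewrite (big_cat_nat (leq0n _) (ltnW lt_m)) //= [X in _ + X <= _]big_nat_cond.
  rewrite [X in _ + X <= _]big1 ?addr0 // => i /andP[/andP[lt_i _] _].
  by rewrite /F bin_small ?mulr0n.
have exp_le : (1 - p / 2) ^+ m <= expR (- (m%:R * p / 2)).
  have -> : - (m%:R * p / 2) = m%:R * (- (p / 2)) by field.
  rewrite expRM_natl; apply: lerXn2r; rewrite ?nnegrE ?expR_ge0 ?expR_ge1Dx //.
  by rewrite subr_ge0; lra.
apply: le_trans (ler_wpM2l (exprn_ge0 _ (ler0n _ 2)) (le_trans sum_le exp_le)).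
rewrite mulr_sumr; apply: ler_sum => i _.
have -> : p ^+ i * (1 - p) ^+ (m - i) *+ 'C(m, i) =
    2 ^+ i * ((p / 2) ^+ i * (1 - p) ^+ (m - i) *+ 'C(m, i)).
  by rewrite -!mulrnAr mulrA -exprMn mulrCA divff // mulr1.
by apply: (ler_wpM2r (pos i)); rewrite ler_weXn2l ?ler1n // ltnW.
Qed.


End BinomialTail.

Section AttachLow.
Variables (R : realType) (sigma : nat).
Implicit Type p : R.

(** The binomial tail vanishes for m < sigma; there the edge to the neighbouring vertex, of
    probability p, still attaches the next vertex. *)
Definition attach_low p m : R := Num.max p (binomial_tail p sigma m).

Lemma attach_low_gt0 p m : 0 < p -> 0 < attach_low p m.
Proof. by move=> p0; rewrite lt_max p0. Qed.

Lemma attach_low_le1 p m : 0 <= p <= 1 -> attach_low p m <= 1.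
Proof. by move=> /[dup] /andP[_ p1] p01; rewrite ge_max p1 binomial_tail_le1. Qed.

End AttachLow.

(** Induction on j through (1 + 1/j)^j <= e. *)
Lemma expn_le_fact (R : realType) (j : nat) :
  j%:R ^+ j <= expR j%:R * j`!%:R :> R.
Proof.
elim: j => [|j IHj]; first by rewrite expr0 expR0 mul1r.
have [->|j0] := eqVneq j 0%N.
  by rewrite expr1 mulr1; apply: le_trans (expR_ge1Dx _); rewrite lerDr.
have jR : 0 < j%:R :> R by rewrite ltr0n lt0n.
rewrite factS natrM exprS mulrCA ler_pM2l ?ltr0n //.
have e1 : j.+1%:R = j%:R * (1 + j%:R^-1) :> R by rewrite mulrDr mulr1 divff ?gt_eqF // -natr1.
rewrite [X in X ^+ _]e1 exprMn; have -> : expR (j.+1%:R) * j`!%:R = expR j%:R * j`!%:R * expR 1 :> R.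
  by rewrite -natr1 expRD mulrAC.
have i0 : 0 <= j%:R^-1 :> R by rewrite invr_ge0 ltW.
apply: ler_pM => //.
have -> : expR 1 = expR j%:R^-1 ^+ j :> R by rewrite -expRM_natl divff ?gt_eqF.
by apply: lerXn2r; rewrite ?nnegrE ?expR_ge0 ?expR_ge1Dx ?addr_ge0.
Qed.

Lemma bin_le_expn m j : ('C(m, j) * j`! <= m ^ j)%N.
Proof.
rewrite bin_ffact ffact_prod -[X in (_ <= _ ^ X)%N]card_ord -prod_nat_const.
by apply: leq_prod => i _; apply: leq_subr.
Qed.

(** * Jigsaw dynamics on a graph *)

Section Dynamics.
Local Open Scope nat_scope.
Variables (V : finType) (puz ppl : rel V) (sigma tau : nat) (theta : option nat).
Implicit Types (A B C D : {set V}) (P : {set {set V}}) (x y : V).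

Notation edge := (cluster_graph puz ppl sigma tau theta).
Notation step := (jigsaw_step puz ppl sigma tau theta).
Notation jig := (jigsaw puz ppl sigma tau theta).
Notation merge := (merges puz ppl sigma tau theta).

Definition component P A : {set V} := cover [set B in P | connect (edge P) A B].

Lemma mem_component P A B x :
  B \in P -> connect (edge P) A B -> x \in B -> x \in component P A.
Proof. by move=> PB cAB xB; apply/bigcupP; exists B => //; rewrite inE PB. Qed.

Lemma component_disjoint P A B x : trivIset P -> A \in P -> B \in P ->
  x \in component P A -> x \in component P B -> connect (edge P) A B.
Proof.
move=> tP PA PB /bigcupP[A']; rewrite inE => /andP[PA' cA] xA'.
case/bigcupP=> B'; rewrite inE => /andP[PB' cB] xB'.
have eAB : A' = B'.
  by rewrite -(def_pblock tP PA' xA') (def_pblock tP PB' xB').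
apply: connect_trans cA _; rewrite eAB.
by rewrite cluster_graph_sym.
Qed.

Lemma jigsaw_step_partition P : partition P [set: V] -> partition (step P) [set: V].
Proof.
case/and3P=> /eqP cP tP nP; apply/and3P; split.
- rewrite eqEsubset subsetT; apply/subsetP => x _.
  have /bigcupP[A PA xA] : x \in cover P by rewrite cP inE.
  apply/bigcupP; exists (component P A); first exact: imset_f.
  exact: mem_component (connect0 _ _) xA.
- apply/trivIsetP => _ _ /imsetP[A PA ->] /imsetP[B PB ->].
  apply: contraNT => /pred0Pn[x /andP[/= xA xB]]; apply/eqP.
  have cAB := component_disjoint tP PA PB xA xB.
  congr cover; apply/setP => D; rewrite !inE.
  by rewrite (same_connect (@cluster_graph_sym _ _ _ _ _ _ _) cAB).
- apply/imsetP => -[A PA e0].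
  have /set0Pn[x xA] : A != set0 by apply: contraNneq nP => <-.
  have := mem_component PA (connect0 (edge P) A) xA.
  by rewrite /component -e0 inE.
Qed.

Lemma jigsaw_partition t : partition (jig t) [set: V].
Proof.
elim: t => [|t]; last exact: jigsaw_step_partition.
apply/and3P; split.
- rewrite eqEsubset subsetT; apply/subsetP => x _.
  by apply/bigcupP; exists [set x]; rewrite ?imset_f ?inE.
- apply/trivIsetP => _ _ /imsetP[x _ ->] /imsetP[y _ ->] ne.
  rewrite -setI_eq0; apply/eqP/setP => z; rewrite !inE.
  by apply/negP => /andP[/eqP-> /eqP e]; rewrite e eqxx in ne.
- by apply/imsetP => -[x _ /setP/(_ x)]; rewrite !inE eqxx.
Qed.

Lemma jigsaw_trivIset t : trivIset (jig t).
Proof. by case/and3P: (jigsaw_partition t). Qed.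

Definition cluster t x := pblock (jig t) x.

Lemma cluster_in t x : cluster t x \in jig t.
Proof.
by apply: pblock_mem; rewrite (cover_partition (jigsaw_partition t)) inE.
Qed.

Lemma mem_cluster t x : x \in cluster t x.
Proof. by rewrite mem_pblock (cover_partition (jigsaw_partition t)) inE. Qed.

Lemma clusterE t C x : C \in jig t -> x \in C -> cluster t x = C.
Proof. exact/def_pblock/jigsaw_trivIset. Qed.

Lemma cluster_eq t x y : x \in cluster t y -> cluster t x = cluster t y.
Proof. exact/clusterE/cluster_in. Qed.

Lemma cluster_nonempty t C : C \in jig t -> exists x, C = cluster t x.
Proof.
move=> tC; have /set0Pn[x xC] : C != set0.
  by case/and3P: (jigsaw_partition t) => _ _; apply: contraNneq => <-.
by exists x; rewrite (clusterE tC).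
Qed.

Lemma clusterS t x : cluster t.+1 x = component (jig t) (cluster t x).
Proof.
apply: clusterE; first exact/imset_f/cluster_in.
exact: mem_component (cluster_in t x) (connect0 _ _) (mem_cluster t x).
Qed.

Lemma clusterS_connect t x y :
  (y \in cluster t.+1 x) = connect (edge (jig t)) (cluster t x) (cluster t y).
Proof.
rewrite clusterS; apply/idP/idP => [/bigcupP[B]|cxy].
  by rewrite inE => /andP[tB cB] yB; rewrite (clusterE tB yB).
exact: mem_component (cluster_in t y) cxy (mem_cluster t y).
Qed.

Lemma cluster_subS t x : cluster t x \subset cluster t.+1 x.
Proof.
by apply/subsetP => y yx; rewrite clusterS_connect (cluster_eq yx) connect0.
Qed.

Lemma cluster_sub t s x : t <= s -> cluster t x \subset cluster s x.
Proof.
elim: s => [|s IHs]; first by rewrite leqn0 => /eqP->.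
rewrite leq_eqVlt => /orP[/eqP-> //|/IHs]; move/subset_trans; apply.
exact: cluster_subS.
Qed.

Lemma cluster_merge t x y : merge (cluster t x) (cluster t y) ->
  y \in cluster t.+1 x.
Proof.
move=> mxy; rewrite clusterS_connect.
have [->|ne] := eqVneq (cluster t x) (cluster t y); first exact: connect0.
by apply: connect1; rewrite /cluster_graph !cluster_in ne mxy.
Qed.

Lemma jigsaw_new_neighbour t C : C \in jig t.+1 -> C \notin jig t ->
  exists x y, [/\ C = cluster t.+1 x & edge (jig t) (cluster t x) (cluster t y)].
Proof.
move=> tC ntC; have [x eC] := cluster_nonempty tC; exists x.
have [y yC nyx] : exists2 y, y \in C & y \notin cluster t x.
  apply/subsetPn; apply: contra ntC => sC.
  suff -> : C = cluster t x by apply: cluster_in.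
  by apply/eqP; rewrite eqEsubset sC eC cluster_subS.
move: yC; rewrite eC clusterS_connect => /connectP[[|D p]] /=.
  by move=> _ e; rewrite -e mem_cluster in nyx.
case/andP=> eD _ _; have /cluster_nonempty[z eDz] : D \in jig t by case/and4P: eD.
by exists z; rewrite -eDz.
Qed.

(* Whether two clusters merge depends on these two clusters only, so a cluster
   born at time t has absorbed a cluster born at time t - 1. *)
Lemma jigsaw_new_size t C : C \in jig t.+1 -> C \notin jig t -> t.+2 <= #|C|.
Proof.
elim: t C => [|t IHt] C tC ntC;
  have [x [y [eC exy]]] := jigsaw_new_neighbour tC ntC.
  have /and4P[_ _ nxy _] := exy.
  have cxy : y \in C by rewrite eC clusterS_connect connect1.
  have ne : y != x by apply: contraNneq nxy => ->.
  by rewrite (cardD1 x) (cardD1 y) !inE cxy eC mem_cluster ne.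
have /and4P[_ _ nxy mxy] := exy.
have dxy : [disjoint cluster t.+1 x & cluster t.+1 y].
  by apply: (trivIsetP (jigsaw_trivIset t.+1)) => //; apply: cluster_in.
have sC : cluster t.+1 x :|: cluster t.+1 y \subset C.
  rewrite subUset eC cluster_subS /=; apply/subsetP => z zy.
  by rewrite clusterS_connect (cluster_eq zy) connect1.
apply: leq_trans (subset_leq_card sC); rewrite cardsU.
rewrite (disjoint_setI0 dxy) cards0 subn0.
have pos z : 0 < #|cluster t.+1 z|.
  by rewrite card_gt0; apply/set0Pn; exists z; apply: mem_cluster.
have [tx|/(IHt _ (cluster_in _ _))] := boolP (cluster t.+1 x \in jig t); last first.
  by have := pos y; lia.
have [ty|/(IHt _ (cluster_in _ _))] := boolP (cluster t.+1 y \in jig t); last first.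
  by have := pos x; lia.
have ex := clusterE tx (mem_cluster t.+1 x).
have ey := clusterE ty (mem_cluster t.+1 y).
have : y \in cluster t.+1 x.
  rewrite clusterS_connect ex ey connect1 // /cluster_graph.
  by rewrite -{1}ex -{1}ey !cluster_in nxy.
by move/cluster_eq/eqP; rewrite eq_sym (negPf nxy).
Qed.

Notation time := (jigsaw_time puz ppl sigma tau theta).

Lemma jigsaw_time_stable : jig time.+1 = jig time.
Proof. by rewrite /jigsaw_time; case: ex_minnP => t /eqP. Qed.

Lemma jigsaw_time_le t : jig t.+1 = jig t -> time <= t.
Proof. by move=> /eqP; rewrite /jigsaw_time; case: ex_minnP => m _; apply. Qed.

Lemma jigsaw_after t : time <= t -> jig t = jig time.
Proof.
elim: t => [|t IHt]; first by rewrite leqn0 => /eqP->.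
rewrite leq_eqVlt => /orP[/eqP-> //|/IHt e].
by rewrite -jigsaw_time_stable /jigsaw !iterS -!/(jig _) e.
Qed.

(** Both sides partition the whole vertex set, so an inclusion leaves no room for a further
    block. *)
Lemma jigsaw_sub_eq t s : jig s \subset jig t -> jig s = jig t.
Proof.
move=> sst; apply/eqP; rewrite eqEsubset sst /=; apply/subsetP => C tC.
have [x eC] := cluster_nonempty tC.
have /(subsetP sst) st := cluster_in s x.
by rewrite eC (clusterE st (mem_cluster s x)) cluster_in.
Qed.

(** The last effective step creates a cluster at time T_f, and by [jigsaw_new_size] it has at least
    T_f + 1 vertices. *)
Lemma jigsaw_time_lt K : 0 < K -> (forall t x, #|cluster t x| < K) -> time < K.
Proof.
move=> K0 ltK; case E : time => [//|T].
have [sub|/subsetPn[C tC ntC]] := boolP (jig T.+1 \subset jig T).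
  by have := jigsaw_time_le (jigsaw_sub_eq sub); rewrite E ltnn.
have := jigsaw_new_size tC ntC; have [x ->] := cluster_nonempty tC.
by have := ltK T.+1 x; lia.
Qed.

Lemma jigsaw_time_solved t : (forall x y, y \in cluster t x) -> time <= t.
Proof.
move=> sol; apply: jigsaw_time_le; apply: jigsaw_sub_eq.
apply/subsetP => C /cluster_nonempty[x ->].
suff -> : cluster t.+1 x = cluster t x by apply: cluster_in.
apply/eqP; rewrite eqEsubset cluster_subS andbT.
by apply/subsetP => y _; apply: sol.
Qed.

(** The partition is constant from T_f on, so a pair joined at some time but not yet at time [t]
    shows that the dynamics has not stopped by then. *)
Lemma jigsaw_time_gt t s x y : y \in cluster s x -> y \notin cluster t x -> t < time.
Proof.
move=> ys; apply: contraR; rewrite -leqNgt => le_t; rewrite /cluster.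
have [les|/ltnW lts] := leqP s time.
  by rewrite (jigsaw_after le_t) (subsetP (cluster_sub _ les)).
by rewrite (jigsaw_after le_t) -(jigsaw_after lts).
Qed.

End Dynamics.

(** * Clusters on the ring *)

Section RingArcs.
Local Open Scope nat_scope.
Variables (n : nat).
Implicit Types (s a b k m i : nat) (x y v : 'I_n.+1) (A B U : {set 'I_n.+1}).

(** Positions are natural numbers read modulo n + 1, so arcs through 0 need no separate treatment; n
    + 1 keeps the ring nonempty. *)
Definition vtx i : 'I_n.+1 := inZp i.

Definition arc s k : {set 'I_n.+1} := [set vtx (s + i) | i : 'I_k].

Lemma vtx_eq i j : (vtx i == vtx j) = (i == j %[mod n.+1]).
Proof. by []. Qed.

Lemma vtx_mod i j : i = j %[mod n.+1] -> vtx i = vtx j.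
Proof. by move=> e; apply/eqP; rewrite vtx_eq e. Qed.

Lemma vtxDn i : vtx (i + n.+1) = vtx i.
Proof. by apply: vtx_mod; rewrite modnDr. Qed.

Lemma vtx_val x : vtx x = x.
Proof. exact: valZpK. Qed.

Lemma ordS_vtx i : ordS (vtx i) = vtx i.+1.
Proof. by apply: val_inj => /=; rewrite -addn1 modnDml addn1. Qed.

Lemma arcP s k x : reflect (exists2 i, i < k & x = vtx (s + i)) (x \in arc s k).
Proof.
apply: (iffP imsetP) => [[i _ ->]|[i ltik ->]]; first by exists i.
by exists (Ordinal ltik).
Qed.

Lemma mem_arc s k i : i < k -> vtx (s + i) \in arc s k.
Proof. by move=> ltik; apply/arcP; exists i. Qed.

Lemma arc1 x : arc x 1 = [set x].
Proof.
apply/setP => y; rewrite !inE; apply/arcP/eqP => [[[|//] _ ->]|->].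
  by rewrite addn0 vtx_val.
by exists 0; rewrite ?addn0 ?vtx_val.
Qed.

Lemma arc_mod s s' k : s = s' %[mod n.+1] -> arc s k = arc s' k.
Proof.
move=> e; apply: eq_imset => i; apply: vtx_mod.
by rewrite -modnDml e modnDml.
Qed.

Lemma arcD s a b : arc s (a + b) = arc s a :|: arc (s + a) b.
Proof.
apply/setP => x; rewrite inE; apply/arcP/orP => [[i lti ->]|].
  have [ltia|leai] := ltnP i a; first by left; apply: mem_arc.
  right; apply/arcP; exists (i - a); first lia.
  by congr vtx; lia.
case=> /arcP[i lti ->]; first by exists i => //; lia.
by exists (a + i); [lia|congr vtx; lia].
Qed.

Lemma arc_subset s a b k : a + b <= k -> arc (s + a) b \subset arc s k.
Proof.
move=> le_k; apply/subsetP => x /arcP[i lti ->].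
by rewrite -addnA; apply: mem_arc; lia.
Qed.

Lemma arc_subset0 s a k : a <= k -> arc s a \subset arc s k.
Proof. by move=> le_k; rewrite -{1}[s]addn0; apply: arc_subset; lia. Qed.

Lemma arc_subsetS s k : arc s.+1 k \subset arc s k.+1.
Proof. by rewrite -[s.+1]addn1; apply: arc_subset; rewrite add1n. Qed.

Lemma vtx_inj s i j : i <= n -> j <= n -> vtx (s + i) = vtx (s + j) -> i = j.
Proof.
move=> lei lej /eqP; rewrite vtx_eq eqn_modDl.
by rewrite !modn_small ?ltnS // => /eqP.
Qed.

Lemma card_arc s k : k <= n.+1 -> #|arc s k| = k.
Proof.
move=> lek; rewrite card_imset ?card_ord // => i j /vtx_inj e.
by apply: val_inj; apply: e; rewrite -ltnS (leq_trans (ltn_ord _)).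
Qed.

Lemma leq_card_arc s k : #|arc s k| <= k.
Proof. by rewrite -[k in _ <= k]card_ord leq_imset_card. Qed.

Lemma arc_disjoint s a b : a + b <= n.+1 -> [disjoint arc s a & arc (s + a) b].
Proof.
move=> le_n; rewrite -setI_eq0; apply/eqP/setP => x; rewrite !inE.
apply/negP => /andP[/arcP[i lti ->] /arcP[j ltj]].
by rewrite -addnA => /vtx_inj; lia.
Qed.

Lemma arc_enter s k v : v \in arc s k -> ordS v \notin arc s k -> ordS v = vtx (s + k).
Proof.
case/arcP=> i ltik ->; rewrite ordS_vtx -addnS => nin; congr (vtx (_ + _)).
apply/eqP; rewrite eqn_leq ltik leqNgt; apply: contra nin; exact: mem_arc.
Qed.

Lemma arc_leave s k v : v \notin arc s k -> ordS v \in arc s k -> ordS v = vtx s.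
Proof.
move=> nin /arcP[[_|i ltik]]; first by rewrite addn0.
move: nin; rewrite -[v]vtx_val ordS_vtx => nin /eqP.
rewrite vtx_eq addnS -addn1 -[(_ + i).+1]addn1 eqn_modDr => e; case/negP: nin.
by rewrite (vtx_mod (eqP e)); apply: mem_arc; rewrite ltnW.
Qed.

Lemma vtx_notin_arc s m : (m <= n)%N -> vtx (s + m) \notin arc s m.
Proof.
move=> lem; apply/negP => /arcP[i lti /vtx_inj e].
by have := e lem; lia.
Qed.

Lemma vtx_neq s i j : (i < j <= n)%N -> vtx (s + i) != vtx (s + j).
Proof. by move=> /andP[ij jn]; apply/eqP => /vtx_inj; lia. Qed.

Lemma vtx_notin_arcS s m : (m <= n)%N -> vtx s \notin arc s.+1 m.
Proof.
move=> lem; apply/negP => /arcP[i lti]; rewrite -{1}[s]addn0 addSnnS => /vtx_inj e.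
by have := e (leq0n _) (leq_trans lti lem).
Qed.


Lemma vtx_neqS s : 0 < n -> vtx s != vtx s.+1.
Proof. by move=> n0; rewrite -[s.+1]addn1 -{1}[s]addn0 vtx_neq. Qed.

End RingArcs.

(** * Arcs spanned by their own edges *)

Section Spanned.
Local Open Scope nat_scope.
Variables (n sigma : nat) (E : {set {set 'I_n.+1}}).
Implicit Types (s a b k m i : nat) (x y v : 'I_n.+1) (A B U : {set 'I_n.+1}).

Notation vtx := (vtx n).
Notation arc := (arc n).
Notation coll := (nbr_count (adj E)).

(** With tau = 1 a vertex must have a ring neighbour in the other set, so for two consecutive arcs
    only the two vertices at the junction are tested. *)
Definition merge_arcs s a b : bool :=
  [|| adj E (vtx (s + a).-1) (vtx (s + a)),
      sigma <= coll (vtx (s + a).-1) (arc (s + a) b)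
    | sigma <= coll (vtx (s + a)) (arc s a)].

(* [spanned s k]: the arc of length k starting at s ends up in one cluster of
   the jigsaw dynamics restricted to this arc. *)
Inductive spanned : nat -> nat -> Prop :=
| spanned1 s : spanned s 1
| spannedD s a b :
    spanned s a -> spanned (s + a) b -> merge_arcs s a b -> spanned s (a + b).

Lemma spanned_gt0 s k : spanned s k -> 0 < k.
Proof. by elim=> // *; lia. Qed.

Lemma merge_arcs_mod s s' a b : 0 < a -> s = s' %[mod n.+1] ->
  merge_arcs s a b = merge_arcs s' a b.
Proof.
case: a => // a _ e; have eD i : s + i = s' + i %[mod n.+1].
  by rewrite -modnDml e modnDml.
rewrite /merge_arcs !addnS /= -!addnS (vtx_mod (eD _)) (vtx_mod (eD a.+1)).
by rewrite (arc_mod _ (eD _)) (arc_mod _ e).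
Qed.

Lemma spanned_mod s s' k : s = s' %[mod n.+1] -> spanned s k -> spanned s' k.
Proof.
move=> e sp; elim: sp s' e => [*|{}s a b spa IHa _ IHb mab s' e]; first exact: spanned1.
apply: spannedD; [exact: IHa| |by rewrite -(merge_arcs_mod _ _ e) ?(spanned_gt0 spa)].
by apply: IHb; rewrite -modnDml e modnDml.
Qed.

Lemma coll_subset x A B : A \subset B -> coll x A <= coll x B.
Proof.
move=> sAB; apply: subset_leq_card; apply/subsetP => y; rewrite !inE.
by case/andP=> /(subsetP sAB)->.
Qed.

Lemma adj_sym x y : adj E x y = adj E y x.
Proof. by rewrite /adj setUC. Qed.

Lemma ring_graph_sym x y : ring_graph x y = ring_graph y x.
Proof. by rewrite /ring_graph eq_sym orbC. Qed.

Notation jig := (jigsaw (@ring_graph n.+1) (adj E) sigma 1 None).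
Notation merge := (merges (@ring_graph n.+1) (adj E) sigma 1 None).
Notation edge := (cluster_graph (@ring_graph n.+1) (adj E) sigma 1 None).
Notation cluster := (cluster (@ring_graph n.+1) (adj E) sigma 1 None).

Definition contact A B x y : bool :=
  [|| adj E x y, sigma <= coll x B | sigma <= coll y A].

Lemma contact_sym A B x y : contact A B x y = contact B A y x.
Proof. by rewrite /contact adj_sym orbCA orbC orbA orbC orbA. Qed.

Lemma merge_contact A B : merge A B ->
  exists x y, [/\ x \in A, y \in B, ring_graph x y & contact A B x y].
Proof.
rewrite /merges /merges_link /= => /orP[].
  case/existsP=> x /andP[xA /existsP[y /andP[yB /andP[axy rxy]]]].
  by exists x, y; rewrite /contact axy.
case/existsP=> x /andP[xA /andP[cx]]; rewrite /link /nbr_count => /card_gt0P.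
case=> y; rewrite !inE => /and3P[yB _ rxy].
by exists x, y; rewrite /contact -/(Defs.coll _ _ _) cx orbT.
Qed.

Lemma contact_merge A B x y : x \in A -> y \in B -> ring_graph x y ->
  contact A B x y -> merge A B || merge B A.
Proof.
move=> xA yB rxy /or3P[axy|cx|cy].
- apply/orP; left; apply/orP; left; apply/existsP; exists x; rewrite xA.
  by apply/existsP; exists y; rewrite yB /doubly_connected axy.
- apply/orP; left; apply/orP; right; apply/existsP; exists x.
  rewrite xA /= /Defs.coll cx /=; apply/card_gt0P; exists y.
  by rewrite !inE yB rxy eq_sym andbT; case/andP: rxy.
- apply/orP; right; apply/orP; right; apply/existsP; exists y.
  rewrite yB /= /Defs.coll cy /=; apply/card_gt0P; exists x.
  by rewrite !inE xA ring_graph_sym rxy andbT; case/andP: rxy.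
Qed.

(** The ring edge between the arcs decides their order: the arc containing the successor must start,
    modulo n + 1, exactly where the other one ends. The auxiliary claim [right] treats one order,
    and the other follows by symmetry. *)
Lemma spanned_join s k s' k' x y : spanned s k -> spanned s' k' ->
  [disjoint arc s k & arc s' k'] -> x \in arc s k -> y \in arc s' k' ->
  ring_graph x y -> contact (arc s k) (arc s' k') x y ->
  exists2 s'', spanned s'' (k + k') & arc s'' (k + k') = arc s k :|: arc s' k'.
Proof.
have right s1 k1 s2 k2 u v : spanned s1 k1 -> spanned s2 k2 ->
    [disjoint arc s1 k1 & arc s2 k2] -> u \in arc s1 k1 -> v \in arc s2 k2 ->
    v = ordS u -> contact (arc s1 k1) (arc s2 k2) u v ->
    spanned s1 (k1 + k2) /\ arc s1 (k1 + k2) = arc s1 k1 :|: arc s2 k2.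
  move=> sp1 sp2 dis us vs vu con.
  have vns : v \notin arc s1 k1 by rewrite (disjointFl dis vs).
  have uns : u \notin arc s2 k2 by rewrite (disjointFr dis us).
  rewrite vu in vs vns.
  have e1 := arc_enter us vns; have e2 := arc_leave uns vs.
  have es : s2 = s1 + k1 %[mod n.+1] by apply/eqP; rewrite -vtx_eq -e1 -e2.
  have k1_gt0 := spanned_gt0 sp1.
  have eu : u = vtx (s1 + k1).-1.
    move: e1; rewrite -[u]vtx_val ordS_vtx -(prednK k1_gt0) addnS /=.
    move/eqP; rewrite vtx_eq -addn1 -[(_ + k1.-1).+1]addn1 eqn_modDr.
    by move/eqP/vtx_mod.
  rewrite arcD -(arc_mod _ es); split=> //; apply: spannedD => //.
    exact: spanned_mod sp2.
  by rewrite /merge_arcs -eu -(arc_mod _ es) -e1 -vu.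
move=> sp sp' dis xs ys /andP[_ /orP[/eqP yx|/eqP xy]] con.
  by have [H1 H2] := right _ _ _ _ _ _ sp sp' dis xs ys yx con; exists s.
rewrite contact_sym in con; rewrite disjoint_sym in dis.
by have [H1 H2] := right _ _ _ _ _ _ sp' sp dis ys xs xy con; exists s'; rewrite addnC // setUC.
Qed.

Lemma contact_subset A B A' B' x y : A \subset A' -> B \subset B' ->
  contact A B x y -> contact A' B' x y.
Proof.
move=> sA sB; rewrite /contact => /or3P[->//|cx|cy].
  by rewrite (leq_trans cx (coll_subset x sB)) orbT.
by rewrite (leq_trans cy (coll_subset y sA)) !orbT.
Qed.

Lemma connect_exit (T : finType) (e : rel T) (Q : pred T) (u v : T) :
  connect e u v -> Q u -> ~~ Q v ->
  exists c d, [/\ Q c, ~~ Q d, connect e u c & e c d].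
Proof.
case/connectP=> q; elim: q u => [|c q IHq] u /=; first by move=> _ -> ->.
case/andP=> euc qc ev Qu nQv; have [Qc|nQc] := boolP (Q c); last first.
  by exists u, c; rewrite connect0.
have [d [d' [Qd nQd' cd dd']]] := IHq c qc ev Qc nQv.
by exists d, d'; split=> //; apply: connect_trans cd; apply: connect1.
Qed.

(* No arc of length in [K, 2K) touching I 0 is spanned, and I t shrinks by 2K at
   each step: what lies outside I 0 has no influence on the clusters
   meeting I t at time t. *)
Lemma cluster_spanned K (I : nat -> {set 'I_n.+1}) : 1 < K ->
  (forall t s k x, x \in I t.+1 -> x \in arc s k -> k <= 2 * K -> arc s k \subset I t) ->
  (forall s k x, K <= k < 2 * K -> x \in arc s k -> x \in I 0 -> ~ spanned s k) ->
  forall t x, x \in I t ->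
  exists s k, [/\ cluster t x = arc s k, spanned s k & k < K].
Proof.
move=> K1 shrinkI nspan; have subI t : I t.+1 \subset I t.
  apply/subsetP => x xI.
  have /subsetP : arc x 1 \subset I t.
    by apply: (shrinkI t x 1 x xI); [rewrite arc1 inE | lia].
  by apply; rewrite arc1 inE.
have subI0 t : I t \subset I 0.
  by elim: t => // t; apply: subset_trans.
elim=> [|t IHt] x xI.
  exists x, 1; split=> //; last exact: spanned1.
  by rewrite arc1; apply: clusterE; [apply: imset_f|rewrite inE].
(* A good arc is a spanned arc around [x], shorter than [K], that is a union of time-t clusters
   inside the new cluster. A longest one must be the whole new cluster: otherwise a neighbouring
   cluster merges with it, the union is spanned of length below 2K, hence below K by [nspan], and is
   a longer good arc. *)
pose good k := exists s, [/\ spanned s k, x \in arc s k, k < K,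
  forall y, y \in arc s k -> cluster t y \subset arc s k
  & arc s k \subset cluster t.+1 x].
have ex_good : exists k, `[< good k >].
  have [s [k [eC sp ltk]]] := IHt x (subsetP (subI t) x xI).
  exists k; apply/asboolP; exists s; rewrite -eC mem_cluster; split=> //.
    by move=> y /cluster_eq ->.
  exact: cluster_subS.
have good_lt k : `[< good k >] -> k <= K by move=> /asboolP[s [_ _ /ltnW]].
have [k /asboolP[s [sp xs ltk closed_s sub_s]] max_k] := ex_maxnP ex_good good_lt.
exists s, k; split=> //; apply/eqP; rewrite eqEsubset sub_s andbT.
apply: contraT => /subsetPn[y yC nys].
move: yC; rewrite clusterS_connect => cxy.
have [||A [B [sA nsB cxA eAB]]] :=
  connect_exit (Q := fun A : {set _} => A \subset arc s k) cxy.
- exact: closed_s.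
- apply: contra nys => /subsetP; apply; exact: mem_cluster.
have /and4P[tA tB nAB mAB] := eAB.
have [v1 [v2 [v1A v2B r12 c12]]] : exists v1 v2,
    [/\ v1 \in A, v2 \in B, ring_graph v1 v2 & contact A B v1 v2].
  case/orP: mAB => /merge_contact // [v2 [v1 [v2B v1A r c]]].
  by exists v1, v2; rewrite ring_graph_sym contact_sym.
have eB := clusterE tB v2B.
have disB : [disjoint arc s k & B].
  rewrite -setI_eq0; apply/eqP/setP => z; rewrite !inE.
  apply/negP => /andP[/closed_s zs zB]; case/negP: nsB.
  by rewrite -(clusterE tB zB).
have v1s := subsetP sA _ v1A.
have lek : k.+1 <= 2 * K by clear -ltk; lia.
(* [v2] sits just beyond one end of the arc, so it lies in an arc of length k + 1 <= 2K around [x],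
   to which [shrinkI] applies. *)
have v2I : v2 \in I t.
  have v2ns : v2 \notin arc s k by rewrite (disjointFl disB v2B).
  case/andP: r12 => _ /orP[] /eqP e.
    apply: (subsetP (shrinkI t s k.+1 x xI _ _)); last first.
    - by rewrite e (arc_enter v1s) -?e // mem_arc.
    - exact: lek.
    - by apply: (subsetP _ _ xs); apply: arc_subset0.
  (* On the left side [s + n] plays the role of s - 1 modulo n + 1. *)
  have es : s + n + 1 = s %[mod n.+1] by rewrite -addnA addn1 modnDr.
  have ss : arc (s + n) k.+1 = arc (s + n) 1 :|: arc s k.
    by rewrite -[k.+1]add1n arcD (arc_mod _ es).
  apply: (subsetP (shrinkI t (s + n) k.+1 x xI _ _)).
  - by rewrite ss inE xs orbT.
  - exact: lek.
  have ev : v2 = vtx (s + n).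
    have := arc_leave v2ns; rewrite -e => /(_ v1s).
    rewrite e -(vtx_mod es) addn1 -ordS_vtx => /(can_inj (@ordSK _)); exact.
  by rewrite ev -{1}[s + n]addn0; apply: mem_arc.
have [s' [k' [eB' sp' ltk']]] := IHt v2 v2I.
rewrite eB in eB'; rewrite eB' in disB v2B c12.
have c12' := contact_subset sA (subxx _) c12.
have [s'' sp'' e''] := spanned_join sp sp' disB v1s v2B r12 c12'.
have x'' : x \in arc s'' (k + k') by rewrite e'' inE xs.
have lt'' : k + k' < K.
  rewrite ltnNge; apply/negP => le''; apply: (nspan s'' (k + k') x) => //.
    by rewrite le''; clear -ltk ltk'; lia.
  by apply: (subsetP (subI0 t.+1)).
have k'_gt0 := spanned_gt0 sp'.
suff : k + k' <= k by clear -k'_gt0; lia.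
apply: max_k; apply/asboolP; exists s''; split=> //.
- move=> z; rewrite e'' inE => /orP[/closed_s|] zs; apply: subset_trans zs _ || idtac.
    exact: subsetUl.
  rewrite -eB' -eB in zs; rewrite (cluster_eq zs) eB eB'; exact: subsetUr.
- rewrite e'' subUset sub_s -eB' -eB; apply/subsetP => z zB.
  rewrite clusterS_connect (cluster_eq zB) eB.
  by apply: connect_trans cxA (connect1 _).
Qed.

Definition attached s m : bool :=
  adj E (vtx (s + m).-1) (vtx (s + m)) || (sigma <= coll (vtx (s + m)) (arc s m)).

Lemma attached_subset s s' m m' : s + m = s' + m' %[mod n.+1] ->
  arc s m \subset arc s' m' -> sigma <= coll (vtx (s + m)) (arc s m) ->
  attached s' m'.
Proof.
move=> e sub c; apply/orP; right; rewrite -(vtx_mod e).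
by apply: leq_trans c _; apply: coll_subset.
Qed.

Lemma cluster_grow t s m : 0 < m -> attached s m ->
  arc s m \subset cluster t (vtx s) -> arc s m.+1 \subset cluster t.+1 (vtx s).
Proof.
case: m => // m _ att sub; rewrite -[m.+2]addn1 arcD subUset.
rewrite (subset_trans sub (cluster_subS _ _ _ _ _ _ _)) /=.
apply/subsetP => v /arcP[[|//] _ ->]; rewrite addn0.
have u_in : vtx (s + m) \in cluster t (vtx s).
  by apply: (subsetP sub); apply: mem_arc.
set v' := vtx (s + m.+1).
have [v_in|v_nin] := boolP (v' \in cluster t (vtx s)).
  exact: (subsetP (cluster_subS _ _ _ _ _ _ _)).
have ruv : ring_graph v' (vtx (s + m)).
  rewrite /ring_graph (ordS_vtx n (s + m)) -addnS eqxx orbT andbT.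
  by apply: contraNneq v_nin => ->.
have /orP[] : merge (cluster t v') (cluster t (vtx s)) ||
              merge (cluster t (vtx s)) (cluster t v').
- apply: contact_merge ruv _; [exact: mem_cluster|by []|].
  rewrite /contact; case/orP: att => [|c]; last first.
    by rewrite (leq_trans c) ?orbT // coll_subset.
  by rewrite addnS /= -addnS adj_sym => ->.
- by move/cluster_merge/cluster_eq => ->; apply: mem_cluster.
- by move/cluster_merge.
Qed.

Lemma cluster_grows s t : (forall m, 0 < m <= t -> attached s m) ->
  arc s t.+1 \subset cluster t (vtx s).
Proof.
elim: t => [|t IHt] att.
  apply/subsetP => x /arcP[[|//] _ ->]; rewrite addn0; exact: mem_cluster.
apply: cluster_grow => //; first by apply: att; rewrite leqnn.
by apply: IHt => m /andP[m0 mt]; apply: att; rewrite m0 ltnW.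
Qed.

(** Each nucleus grows to the right, helped by its own attachments up to length [L] and by [far]
    afterwards, and covers 3D + 1 vertices after 3D steps. Since every block of length [D] contains
    a starting point, every ring edge lies inside one of these arcs. *)
Lemma nucleation L D G : 0 < L -> 0 < G -> G * D <= n.+1 < G.+1 * D ->
  (forall s, sigma <= coll (vtx (s + L)) (arc s L)) ->
  (forall g, g < G -> exists s, g * D <= s < g.+1 * D /\
     forall m, 0 < m < L -> attached s m) ->
  forall x y, y \in cluster (3 * D) x.
Proof.
move=> L0 G0 /andP[leG ltG] far nuc.
have big_arc g : g < G -> exists s, g * D <= s < g.+1 * D /\
    arc s (3 * D).+1 \subset cluster (3 * D) (vtx s).
  case/nuc=> s [gs att]; exists s; split=> //; apply: cluster_grows => m /andP[m0 _].
  have [ltm|lem] := ltnP m L; first by apply: att; rewrite m0.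
  apply: (@attached_subset (s + (m - L)) s L m); last exact: far.
    by congr (_ %% _); lia.
  by apply: arc_subset; lia.
have stepY (y : nat) : y < n.+1 -> vtx y.+1 \in cluster (3 * D) (vtx y).
  have conn s j : arc s (3 * D).+1 \subset cluster (3 * D) (vtx s) ->
      s <= j -> j < s + 3 * D -> vtx j.+1 \in cluster (3 * D) (vtx j).
    move=> /subsetP sub lej ltj.
    have /sub/cluster_eq -> : vtx j \in arc s (3 * D).+1.
      by apply/arcP; exists (j - s); [lia|congr vtx; lia].
    by apply: sub; apply/arcP; exists (j.+1 - s); [lia|congr vtx; lia].
  move=> lty; have D0 : 0 < D by case: D ltG {nuc leG big_arc conn}; lia.
  (* The nucleus is taken from the block before that of [y], so it starts to the left of [y] and at
     distance less than 2D. *)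
  have [leDy|ltyD] := leqP D y.
    have lq : y %/ D - 1 < G.
      have : y %/ D < G.+1 by rewrite ltn_divLR //; lia.
      lia.
    have [s [/andP[les lts] sub]] := big_arc _ lq.
    have := divn_eq y D; have := ltn_pmod y D0; move: les lts.
    have : 0 < y %/ D by rewrite divn_gt0.
    case: (y %/ D) => // q _; rewrite subn1 /= => les lts ltr ey.
    apply: conn sub _ _; nia.
  (* For [y] in the first block the last full block is used, across 0: the incomplete block after it
     is shorter than D, so the distance is less than 3D. This is the source of the constant 3. *)
  have lG : G.-1 < G by lia.
  have [s [/andP[les lts] sub]] := big_arc _ lG.
  have := conn s (y + n.+1) sub; rewrite -addSn !vtxDn; apply; nia.
have all0 (y : nat) : vtx y \in cluster (3 * D) (vtx 0).
  elim: y => [|y IHy]; first exact: mem_cluster.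
  rewrite -(cluster_eq IHy) -(vtx_mod (modn_mod y n.+1)).
  have := stepY (y %% n.+1) (ltn_pmod y (ltn0Sn n)).
  suff -> : vtx (y %% n.+1).+1 = vtx y.+1 by [].
  by apply: vtx_mod; rewrite -addn1 modnDml addn1.
by move=> x y; rewrite -(vtx_val x) -(vtx_val y) (cluster_eq (all0 x)).
Qed.

End Spanned.

(** * Spanning probabilities *)

Section GraphEvents.
Variables (R : realType) (p : R) (n : nat).
Implicit Types (s a b k m i : nat) (x y v : 'I_n.+1) (S : {set 'I_n.+1}).
Implicit Types (E : {set {set 'I_n.+1}}).

Notation vtx := (vtx n).
Notation arc := (arc n).

Definition edge_weight (e : {set 'I_n.+1}) : R :=
  if e \in vertex_pairs 'I_n.+1 then p else 0.

Notation P := (pr edge_weight).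

Lemma edge_weight01 e : 0 <= p <= 1 -> 0 <= edge_weight e <= 1.
Proof. by move=> p01; rewrite /edge_weight; case: ifP => _ //; rewrite lexx ler01. Qed.

Lemma er_probE (A : pred {set {set 'I_n.+1}}) : er_prob p A = P (fun E => A E).
Proof.
rewrite /er_prob /pr big_mkcond; apply: eq_bigr => E _ /=.
case: (boolP (E \subset _)) => /= [sE|/subsetPn[e eE ne]]; last first.
  by rewrite /bwt (bigD1 e) //= eE /edge_weight (negPf ne) !mul0r.
rewrite asboolb; case: (A E); rewrite ?mulr0 ?mulr1 // /bwt.
rewrite [RHS](bigID (mem (vertex_pairs 'I_n.+1))) /= [X in _ * X]big1 ?mulr1.
  by apply: eq_bigr => e eV; rewrite /edge_weight eV.
move=> e eV; rewrite /edge_weight (negPf eV) subr0.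
by have /negPf-> : e \notin E by apply: contra eV => /(subsetP sE).
Qed.

Definition pairs_in S := [set e in vertex_pairs 'I_n.+1 | e \subset S].

Definition star v S := [set [set u; v] | u in S :\ v].

Lemma star_pairs v S e : e \in star v S -> e \in vertex_pairs 'I_n.+1.
Proof.
by case/imsetP=> u; rewrite !inE => /andP[uv _] ->; rewrite cards2 uv.
Qed.

Lemma card_star v S : #|star v S| = #|S :\ v|.
Proof.
apply: card_in_imset => x y; rewrite !inE => /andP[xv _] /andP[yv _] e.
have : x \in [set y; v] by rewrite -e !inE eqxx.
by rewrite !inE (negPf xv) orbF => /eqP.
Qed.

Lemma collE E v S : nbr_count (adj E) v S = #|E :&: star v S|.
Proof.
rewrite /nbr_count; pose U := [set u in S | (u != v) && adj E v u].
have -> : #|[pred u in S | (u != v) && adj E v u]| = #|U|.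
  by apply: eq_card => u; rewrite !inE.
have -> : E :&: star v S = [set [set u; v] | u in U].
  apply/setP => e; rewrite inE; apply/andP/imsetP => [[eE /imsetP[u]]|[u]].
    rewrite !inE => /andP[uv uS] eu; exists u => //.
    by rewrite !inE uS uv /adj setUC -eu.
  rewrite !inE => /and3P[uS uv auv] ->; split; first by rewrite setUC.
  by apply/imsetP; exists u; rewrite // !inE uv.
rewrite card_in_imset // => x y; rewrite !inE => /and3P[_ xv _] /and3P[_ yv _] e.
have : x \in [set y; v] by rewrite -e !inE eqxx.
by rewrite !inE (negPf xv) orbF => /eqP.
Qed.

Lemma star_pairs_in v S S' : v \in S' -> S \subset S' -> star v S \subset pairs_in S'.
Proof.
move=> vS' sS; apply/subsetP => e eS; rewrite inE (star_pairs eS) /=.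
case/imsetP: eS => u; rewrite !inE => /andP[_ uS] ->.
by rewrite subUset !sub1set vS' (subsetP sS).
Qed.

Lemma pairs_inS S S' : S \subset S' -> pairs_in S \subset pairs_in S'.
Proof.
move=> sS; apply/subsetP => e; rewrite !inE => /andP[-> /subset_trans]; exact.
Qed.

(** This is the independence behind one-vertex growth: what happens inside an arc does not look at
    the edges of a vertex outside it. *)
Lemma star_pairs_in_disjoint v S S' : v \notin S' -> [disjoint star v S & pairs_in S'].
Proof.
move=> vS'; rewrite -setI_eq0; apply/eqP/setP => e; rewrite !inE.
apply/negP => /and3P[/imsetP[u _ ->] _].
by rewrite subUset !sub1set (negPf vS') andbF.
Qed.

Lemma pairs_in_disjoint S S' : [disjoint S & S'] -> [disjoint pairs_in S & pairs_in S'].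
Proof.
move=> dS; rewrite -setI_eq0; apply/eqP/setP => e; rewrite !inE.
apply/negP => /andP[/andP[/eqP e2 /subsetP eS] /andP[_ /subsetP eS']].
have /card_gt0P[x xe] : (0 < #|e|)%N by rewrite e2.
by have := disjointFr dS (eS _ xe); rewrite eS'.
Qed.

Lemma depends_coll sigma v S :
  depends_on (star v S) (fun E => (sigma <= nbr_count (adj E) v S)%N).
Proof. by move=> E E' e; rewrite !collE e. Qed.

Lemma depends_adj (X : {set {set 'I_n.+1}}) x y :
  [set x; y] \in X -> depends_on X (fun E => adj E x y).
Proof.
move=> xyX E E' e; have := congr1 (fun S : {set {set _}} => [set x; y] \in S) e.
by rewrite !inE xyX !andbT /adj => ->.
Qed.

Lemma mem_star v u S : u \in S -> u != v -> [set u; v] \in star v S.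
Proof. by move=> uS uv; apply/imsetP; exists u; rewrite // !inE uv. Qed.

Lemma depends_attached sigma s m : (0 < m <= n)%N ->
  depends_on (star (vtx (s + m)) (arc s m)) (fun E => attached sigma E s m).
Proof.
case: m => [//|m] /andP[_ lem] E E' e; rewrite /attached addnS /= -!addnS.
have aE : adj E (vtx (s + m)) (vtx (s + m.+1)) -> adj E' (vtx (s + m)) (vtx (s + m.+1)).
  apply: (depends_adj _ e); apply: mem_star; first exact: mem_arc.
  by apply: vtx_neq; lia.
by case/orP=> [/aE->//|H]; rewrite (depends_coll e H) orbT.
Qed.

Lemma depends_spanned sigma s k : (k <= n.+1)%N ->
  depends_on (pairs_in (arc s k)) (fun E => spanned sigma E s k).
Proof.
move=> lek E E' e sp; elim: sp lek e => {s k} [s _ _|s a b spa IHa spb IHb mab leab e].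
  exact: spanned1.
have restr S : S \subset arc s (a + b) -> E :&: pairs_in S = E' :&: pairs_in S.
  by move=> /pairs_inS sS; rewrite -(setIidPr sS) !setIA e.
have sa : arc s a \subset arc s (a + b) by apply: arc_subset0; lia.
have sb : arc (s + a) b \subset arc s (a + b) by apply: arc_subset.
have a0 := spanned_gt0 spa; have b0 := spanned_gt0 spb.
have pa : (s + a).-1 = (s + a.-1)%N by clear -a0; lia.
have ua : vtx (s + a).-1 \in arc s a by rewrite pa mem_arc // prednK.
have ub : vtx (s + a) \in arc (s + a) b by rewrite -[X in vtx X]addn0 mem_arc.
have collE' v S : v \in arc s (a + b) -> S \subset arc s (a + b) ->
    nbr_count (adj E) v S = nbr_count (adj E') v S.
  move=> vs sS; rewrite !collE.
  have sst := star_pairs_in vs sS.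
  by rewrite -(setIidPr sst) !setIA e.
apply: spannedD; [apply: IHa; [lia|exact: restr]|apply: IHb; [lia|exact: restr]|].
case/or3P: mab => [aE|c|c]; apply/or3P.
- constructor 1; apply: (depends_adj _ e aE).
  rewrite !inE subUset !sub1set (subsetP sa _ ua) (subsetP sb _ ub) !andbT cards2.
  suff -> : vtx (s + a).-1 != vtx (s + a) by [].
  by rewrite pa; apply: vtx_neq; clear -a0 b0 leab; lia.
- by constructor 2; rewrite -collE' // (subsetP sa).
- by constructor 3; rewrite -collE' // (subsetP sb).
Qed.

End GraphEvents.

(** * Decomposition by the last merge, and the resulting recursions *)

Section Attachment.
Variables (R : realType) (p : R) (n sigma : nat).
Hypothesis p01 : 0 <= p <= 1.
Hypothesis sigma_gt0 : (0 < sigma)%N.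
Implicit Types (s a b k m i : nat) (x y v : 'I_n.+1) (S : {set 'I_n.+1}).
Implicit Types (E : {set {set 'I_n.+1}}).

Notation vtx := (vtx n).
Notation arc := (arc n).
Notation P := (pr (@edge_weight R p n)).

Let a01 e := @edge_weight01 R p n e p01.

Lemma pr_coll v S : v \notin S ->
  P (fun E => (sigma <= nbr_count (adj E) v S)%N) = binomial_tail p sigma #|S|.
Proof.
move=> vS; have eS : S :\ v = S.
  by apply/setP => u; rewrite !inE; case: eqVneq => [->|]//; rewrite (negPf vS).
have cS : #|star v S| = #|S| by rewrite card_star eS.
rewrite /binomial_tail -cS -(@pr_card_lt _ _ (@edge_weight R p n)); last first.
  by move=> e /star_pairs eV; rewrite /edge_weight eV.
rewrite -pr_not; apply: eq_bigr => E _; congr (_ * _%:R); congr nat_of_bool.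
by rewrite asbool_neg !asboolb collE leqNgt.
Qed.

Lemma pr_edge x y : x != y -> P (fun E => adj E x y) = p.
Proof.
move=> xy; transitivity (P (fun E => [set [set x; y]] \subset E)).
  by apply: eq_bigr => E _; rewrite sub1set.
by rewrite pr_superset big_set1 /edge_weight inE cards2 xy.
Qed.

(** Union bound over the edge to the neighbour and the count of neighbours. The cap at 1 controls
    the lengths beyond the last Riemann block. *)
Definition attach_bound m : R := Num.min 1 (p + binomial_tail p sigma m).

Lemma attach_bound_ge0 m : 0 <= attach_bound m.
Proof.
by case/andP: p01 => p0 _; rewrite le_min ler01 addr_ge0 ?binomial_tail_ge0.
Qed.

Lemma attach_bound_le k m : (k <= m)%N -> attach_bound k <= attach_bound m.
Proof.
move=> lekm; rewrite /attach_bound le_min !ge_min lexx /= lerD2l.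
by rewrite binomial_tail_homo ?orbT.
Qed.

Lemma pr_attached s m : (0 < m <= n)%N -> P (fun E => attached sigma E s m) <= attach_bound m.
Proof.
case: m => // m /andP[_ lem]; rewrite /attach_bound le_min pr_le1 //=.
have H E : attached sigma E s m.+1 -> adj E (vtx (s + m)) (vtx (s + m.+1)) \/
    (sigma <= nbr_count (adj E) (vtx (s + m.+1)) (arc s m.+1))%N.
  by rewrite /attached addnS /= => /orP.
apply: le_trans (pr_le a01 H) _; apply: le_trans (pr_or a01 _ _) _.
rewrite (pr_coll (vtx_notin_arc s lem)) card_arc; last by clear -lem; lia.
by rewrite pr_edge // vtx_neq //; clear -lem; lia.
Qed.

Lemma pr_attached_ge s m : (0 < m <= n)%N ->
  Num.max p (binomial_tail p sigma m) <= P (fun E => attached sigma E s m).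
Proof.
case: m => // m /andP[_ lem]; rewrite ge_max; apply/andP; split.
  rewrite -{1}(@pr_edge (vtx (s + m)) (vtx (s + m.+1))); last by rewrite vtx_neq //; lia.
  by apply: pr_le => // E; rewrite /attached addnS /= -addnS => ->.
have e : #|arc s m.+1| = m.+1 by rewrite card_arc; lia.
rewrite -[in binomial_tail _ _ _]e -(pr_coll (vtx_notin_arc s lem)).
by apply: pr_le => // E; rewrite /attached => ->; rewrite orbT.
Qed.

Definition attachedL E s m : bool :=
  adj E (vtx s) (vtx s.+1) || (sigma <= nbr_count (adj E) (vtx s) (arc s.+1 m))%N.

Lemma pr_attachedL s m : (0 < m <= n)%N -> P (fun E => attachedL E s m) <= attach_bound m.
Proof.
move=> /andP[m0 lem]; rewrite /attach_bound le_min pr_le1 //=.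
have H E : attachedL E s m -> adj E (vtx s) (vtx s.+1) \/
    (sigma <= nbr_count (adj E) (vtx s) (arc s.+1 m))%N by move/orP.
apply: le_trans (pr_le a01 H) _; apply: le_trans (pr_or a01 _ _) _.
rewrite (pr_coll (vtx_notin_arcS s lem)) card_arc; last by clear -lem; lia.
by rewrite pr_edge // vtx_neqS //; clear -m0 lem; lia.
Qed.

Lemma depends_attachedL s m : (0 < m <= n)%N ->
  depends_on (star (vtx s) (arc s.+1 m)) (fun E => attachedL E s m).
Proof.
move=> /andP[m0 lem] E E' e; rewrite /attachedL => /orP[aE|H]; last first.
  by rewrite (depends_coll e H) orbT.
suff -> : adj E' (vtx s) (vtx s.+1) by [].
apply: (depends_adj _ e aE); rewrite setUC; apply: mem_star.
  by rewrite -[X in vtx X]addn0 mem_arc.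
by rewrite eq_sym vtx_neqS //; clear -m0 lem; lia.
Qed.

Lemma coll1 E v u : (sigma <= nbr_count (adj E) v [set u])%N -> adj E v u.
Proof.
move=> /(leq_trans sigma_gt0) /card_gt0P[w].
by rewrite !inE => /and3P[/eqP-> _].
Qed.

Lemma spanned_split E s k : spanned sigma E s k -> (1 < k)%N ->
  exists a b, [/\ k = (a + b)%N, spanned sigma E s a, spanned sigma E (s + a) b
    & merge_arcs sigma E s a b].
Proof. by case=> // {}s a b *; exists a, b. Qed.

Definition wide_split E s k := exists2 a, (2 <= a < k.-1)%N &
  spanned sigma E s a /\ spanned sigma E (s + a) (k - a).

(** Look at the last merge. When one piece is a single vertex, having sigma >= 1 neighbours in that
    piece is just having the edge to it ([coll1]), so the merge reduces to attachment of that
    vertex. *)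
Lemma spanned_cases E s k : (1 < k)%N -> spanned sigma E s k ->
  [\/ spanned sigma E s k.-1 /\ attached sigma E s k.-1,
      attachedL E s k.-1 /\ spanned sigma E s.+1 k.-1 | wide_split E s k].
Proof.
move=> k1 /spanned_split/(_ k1)[a [b [ek sa sb mab]]].
have a0 := spanned_gt0 sa; have b0 := spanned_gt0 sb.
have single u : arc u 1 = [set vtx u].
  by apply/setP => x; rewrite inE; apply/arcP/eqP => [[[|//] _ ->]|->];
    [rewrite addn0|exists 0%N; rewrite ?addn0].
have [b1|b2] := eqVneq b 1%N.
  constructor 1; subst b k; rewrite addn1 /=; split=> //.
  rewrite /attached; move: mab; rewrite /merge_arcs single => /or3P[->//|/coll1->//|->].
  by rewrite orbT.
have [a1|a2] := eqVneq a 1%N.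
  constructor 2; subst a k; rewrite add1n /= -addn1; split=> //.
  rewrite /attachedL; move: mab; rewrite /merge_arcs !addn1 /= single.
  case/or3P=> [->//|->|/coll1]; first by rewrite orbT.
  by rewrite adj_sym => ->.
constructor 3; exists a; first by clear -a0 a2 b0 b2 ek; lia.
by split=> //; suff -> : (k - a)%N = b by []; clear -ek; lia.
Qed.

Definition left_only E s k :=
  [/\ attachedL E s k.-1, spanned sigma E s.+1 k.-1 & ~ (spanned sigma E s k.-1 /\ attached sigma E s k.-1)].

(* If the arc minus its two ends is spanned and the right end attaches to it,
   then the left end needs the right one only if the edge joining them is open. *)
Lemma left_only_cases E s k : (2 < k <= n.+1)%N -> left_only E s k ->
  (adj E (vtx s) (vtx (s + k.-1)) /\ (attached sigma E s.+1 k.-2 /\ spanned sigma E s.+1 k.-2)) \/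
  (attachedL E s k.-1 /\ (left_only E s.+1 k.-1 \/ wide_split E s.+1 k.-1)).
Proof.
case: k => [//|[//|[//|k]]] /andP[_ lek]; rewrite /left_only /= => -[aL sp nsp].
have [[spR attR]|nalpha] := pselect (spanned sigma E s.+1 k.+1 /\ attached sigma E s.+1 k.+1).
- left; split; last by [].
  have attR' : attached sigma E s k.+2.
    rewrite /attached addnS /=; move: attR; rewrite /attached !addSn /=.
    case/orP=> [->//|c]; apply/orP; right; rewrite addnS.
    apply: leq_trans c _; rewrite !addnS; apply: coll_subset.
    exact: arc_subsetS.
  have nL : ~~ attachedL E s k.+1.
    apply/negP => aL'; apply: nsp; split=> //.
    rewrite -[k.+2]add1n; apply: spannedD; [exact: spanned1|by rewrite addn1|].
    rewrite /merge_arcs addn1 /=; move: aL'; rewrite /attachedL => /orP[->//|->].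
    by rewrite orbT.
  (* Without the edge between the extreme vertices, dropping the last vertex of the arc does not
     change the number of neighbours of the first one in it. *)
  apply: contraNT nL => nadj; move: aL; rewrite /attachedL => /orP[->//|c].
  apply/orP; right; apply: leq_trans c _; apply: subset_leq_card.
  apply/subsetP => u; rewrite !inE -[k.+2]addn1 arcD inE => /and3P[us uv uadj].
  rewrite uv uadj !andbT; case/orP: us => // /arcP[[|//] _ eu].
  case/negP: nadj; move: uadj; rewrite eu addn0 addSnnS; exact.
- right; split=> //; have [//|alpha|[aL' sp']|bs] := @spanned_cases E s.+1 k.+2 _ sp.
    - by case: nalpha.
    - by left; split.
  by right.
Qed.

(** The maximum over starting points gives one number per length without appeal to rotation
    invariance of the law. *)
Definition span_max k : R := \big[Num.max/0]_(s < n.+1) P (fun E => spanned sigma E s k).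
Definition left_max k : R := \big[Num.max/0]_(s < n.+1) P (fun E => left_only E s k).
Definition split_sum k : R := \sum_(2 <= a < k.-1) span_max a * span_max (k - a).

Lemma bigmax0_le (F : 'I_n.+1 -> R) (c : R) : 0 <= c ->
  (forall j : 'I_n.+1, F j <= c) -> \big[Num.max/0]_(j < n.+1) F j <= c.
Proof. by move=> c0 Fc; apply/bigmax_leP; split=> // j _; apply: Fc. Qed.

Lemma span_max_ge0 k : 0 <= span_max k. Proof. exact: bigmax_ge_id. Qed.
Lemma left_max_ge0 k : 0 <= left_max k. Proof. exact: bigmax_ge_id. Qed.

Lemma pr_spanned s k : P (fun E => spanned sigma E s k) <= span_max k.
Proof.
have := @le_bigmax _ _ _ 0 (fun i : 'I_n.+1 => P (fun E => spanned sigma E i k)) (vtx s).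
apply: le_trans; apply: pr_le => // E; apply: spanned_mod => /=.
by rewrite modn_mod.
Qed.

Lemma left_only_mod E s s' k : s = s' %[mod n.+1] -> (1 < k)%N ->
  left_only E s k -> left_only E s' k.
Proof.
case: k => [//|[//|k]] e _; rewrite /left_only /= => -[aL sp nsp].
have eD i : (s + i = s' + i %[mod n.+1])%N by rewrite -modnDml e modnDml.
have eS : (s.+1 = s'.+1 %[mod n.+1])%N by have := eD 1%N; rewrite !addn1.
split.
- by move: aL; rewrite /attachedL (vtx_mod e) (vtx_mod eS) (arc_mod _ eS).
- exact: spanned_mod sp.
- move=> [sp' att']; apply: nsp; split; first exact: spanned_mod sp'.
  move: att'; rewrite /attached !addnS /= -!addnS.
  by rewrite (vtx_mod (eD k)) (vtx_mod (eD k.+1)) (arc_mod _ e).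
Qed.

Lemma pr_left_only s k : (1 < k)%N -> P (fun E => left_only E s k) <= left_max k.
Proof.
move=> k1.
have := @le_bigmax _ _ _ 0 (fun i : 'I_n.+1 => P (fun E => left_only E i k)) (vtx s).
apply: le_trans; apply: pr_le => // E; apply: left_only_mod => //=.
by rewrite modn_mod.
Qed.

Lemma split_sum_ge0 k : 0 <= split_sum k.
Proof. by apply: sumr_ge0 => i _; rewrite mulr_ge0 ?span_max_ge0. Qed.

Lemma pr_wide_split s k : (k <= n.+1)%N -> P (fun E => wide_split E s k) <= split_sum k.
Proof.
move=> lek; apply: le_trans (pr_ex a01 _ _ _) _.
apply: ler_sum_nat => a /andP[a2 ak].
rewrite (@pr_and _ _ _ (pairs_in (arc s a)) (pairs_in (arc (s + a) (k - a)))).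
- by apply: ler_pM; rewrite ?pr_ge0 ?pr_spanned.
- by apply: pairs_in_disjoint; apply: arc_disjoint; lia.
- by apply: depends_spanned; lia.
- by apply: depends_spanned; lia.
Qed.

Lemma pr_spanned_attached s k : (0 < k <= n)%N ->
  P (fun E => spanned sigma E s k /\ attached sigma E s k) <= span_max k * attach_bound k.
Proof.
move=> /andP[k0 lek].
rewrite (@pr_and _ _ _ (pairs_in (arc s k)) (star (vtx (s + k)) (arc s k))).
- by apply: ler_pM; rewrite ?pr_ge0 ?pr_spanned ?pr_attached ?k0.
- by rewrite disjoint_sym star_pairs_in_disjoint ?vtx_notin_arc.
- by apply: depends_spanned; lia.
- by apply: depends_attached; rewrite k0.
Qed.

Lemma span_max_rec k : (1 < k <= n.+1)%N ->
  span_max k <= attach_bound k.-1 * span_max k.-1 + left_max k + split_sum k.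
Proof.
move=> /andP[k1 lek]; apply: bigmax0_le => [|i].
  by rewrite !addr_ge0 ?mulr_ge0 ?attach_bound_ge0 ?span_max_ge0 ?left_max_ge0 ?split_sum_ge0.
have H E : spanned sigma E i k -> ((spanned sigma E i k.-1 /\ attached sigma E i k.-1) \/ left_only E i k) \/ wide_split E i k.
  move=> sp; have [sa|[aL sp']|bs] := spanned_cases k1 sp; [by left; left| |by right].
  left; have [sa|nsa] := pselect (spanned sigma E i k.-1 /\ attached sigma E i k.-1); first by left.
  by right; split.
apply: le_trans (pr_le a01 H) _; apply: le_trans (pr_or a01 _ _) _.
apply: lerD; last exact: pr_wide_split.
apply: le_trans (pr_or a01 _ _) _; apply: lerD; last exact: pr_left_only.
by rewrite mulrC; apply: pr_spanned_attached; clear -k1 lek; lia.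
Qed.

Lemma depends_left_only s k : (1 < k <= n.+1)%N ->
  depends_on (pairs_in (arc s k)) (fun E => left_only E s k).
Proof.
case: k => [//|[//|k]] /andP[_ lek] E E' e [/= aL sp nsp].
have sub1 : arc s k.+1 \subset arc s k.+2 by apply: arc_subset0.
have subS := arc_subsetS n s k.+1.
have vs : vtx s \in arc s k.+2 by rewrite -[X in vtx X]addn0 mem_arc.
have ve : vtx (s + k.+1) \in arc s k.+2 by rewrite mem_arc.
have symE := esym e.
have lek1 : (0 < k.+1 <= n)%N by [].
have lek2 : (k.+1 <= n.+1)%N by rewrite ltnW.
split=> /=.
- exact: depends_onS (star_pairs_in vs subS) (depends_attachedL lek1) _ _ e aL.
- exact: depends_onS (pairs_inS subS) (depends_spanned lek2) _ _ e sp.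
- move=> [sp' att']; apply: nsp; split.
    exact: depends_onS (pairs_inS sub1) (depends_spanned lek2) _ _ symE sp'.
  exact: depends_onS (star_pairs_in ve sub1) (depends_attached lek1) _ _ symE att'.
Qed.

Lemma depends_wide_split s k : (k <= n.+1)%N ->
  depends_on (pairs_in (arc s k)) (fun E => wide_split E s k).
Proof.
move=> lek E E' e [a /andP[a2 ak] [sa sb]]; exists a; first by rewrite a2.
have leak : (a <= k)%N by clear -ak; lia.
have leS : (a + (k - a) <= k)%N by rewrite subnKC.
have lea : (a <= n.+1)%N by clear -leak lek; lia.
have leb : (k - a <= n.+1)%N by clear -lek; lia.
split.
  exact: depends_onS (pairs_inS (arc_subset0 n s leak)) (depends_spanned lea) _ _ e sa.
apply: (depends_onS (pairs_inS (arc_subset n s leS)) (depends_spanned leb)) e sb.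
Qed.

(** In the first case of [left_only_cases] three independent events occur: the edge between the
    ends, attachment of the right end to the inner arc, spanning of the inner arc. In the second the
    star of the left end is independent of the rest. Raising the attachment bound from k - 2 to k -
    1 lets both cases share one factor. *)
Lemma left_max_rec k : (3 < k <= n.+1)%N ->
  left_max k <= attach_bound k.-1 * (left_max k.-1 + p * span_max k.-2 + split_sum k.-1).
Proof.
move=> /andP[k3 lek]; have /andP[p0 p1] := p01; apply: bigmax0_le => [|i].
  by rewrite mulr_ge0 ?addr_ge0 ?mulr_ge0 ?attach_bound_ge0 ?span_max_ge0 ?left_max_ge0 ?split_sum_ge0.
have lek3 : (2 < k <= n.+1)%N by clear -k3 lek; lia.
apply: le_trans (pr_le a01 (fun E => @left_only_cases E i k lek3)) _.
apply: le_trans (pr_or a01 _ _) _.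
have -> : left_max k.-1 + p * span_max k.-2 + split_sum k.-1 =
  p * span_max k.-2 + (left_max k.-1 + split_sum k.-1) by ring.
rewrite mulrDr; apply: lerD.
  case: k k3 lek lek3 => [//|[//|[//|k]]] _ lek _ /=.
  have v1 : vtx i \notin arc i.+1 k.+1 by rewrite vtx_notin_arcS //; lia.
  have v2 : vtx (i + k.+2) \notin arc i.+1 k.+1 by rewrite -addSnnS vtx_notin_arc; lia.
  have v12 : vtx i != vtx (i + k.+2) by rewrite -[X in vtx X]addn0 vtx_neq //; lia.
  rewrite (@pr_and _ _ _ [set [set vtx i; vtx (i + k.+2)]]
     (star (vtx (i + k.+2)) (arc i.+1 k.+1) :|: pairs_in (arc i.+1 k.+1))).
  - rewrite pr_edge // mulrCA; apply: ler_wpM2l => //.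
    rewrite (@pr_and _ _ _ (star (vtx (i + k.+2)) (arc i.+1 k.+1)) (pairs_in (arc i.+1 k.+1))).
    + apply: ler_pM; rewrite ?pr_ge0 ?pr_spanned //.
      apply: le_trans (pr_attached _ _) _; first by lia.
      exact: attach_bound_le.
    + exact: star_pairs_in_disjoint.
    + rewrite -addSnnS; apply: depends_attached; lia.
    + apply: depends_spanned; lia.
  - rewrite disjoints1 !inE negb_or subUset !sub1set (negPf v1) /= andbF andbT.
    apply/imsetP => -[u]; rewrite !inE => /andP[_ us] e.
    have : vtx i \in [set u; vtx (i + k.+2)] by rewrite -e !inE eqxx.
    rewrite !inE (negPf v12) orbF => /eqP eu; by rewrite eu us in v1.
  - by apply: depends_adj; rewrite inE.
  - apply: depends_onI.
      apply: depends_onS (subsetUl _ _) _; rewrite -addSnnS; apply: depends_attached; lia.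
    apply: depends_onS (subsetUr _ _) _; apply: depends_spanned; lia.
rewrite (@pr_and _ _ _ (star (vtx i) (arc i.+1 k.-1)) (pairs_in (arc i.+1 k.-1))).
- apply: ler_pM; rewrite ?pr_ge0 ?pr_attachedL //; first by clear -k3 lek; lia.
  apply: le_trans (pr_or a01 _ _) _; apply: lerD.
    by apply: pr_left_only; clear -k3; lia.
  by apply: pr_wide_split; clear -lek; lia.
- by apply: star_pairs_in_disjoint; apply: vtx_notin_arcS; clear -lek; lia.
- by apply: depends_attachedL; clear -k3 lek; lia.
- apply: depends_onU; first by apply: depends_left_only; clear -k3 lek; lia.
  by apply: depends_wide_split; clear -lek; lia.
Qed.

Lemma left_max_le k : (1 < k <= n.+1)%N -> left_max k <= span_max k.
Proof.
move=> /andP[k1 lek]; apply: bigmax0_le => [|i]; first exact: span_max_ge0.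
apply: le_trans (pr_spanned i k); apply: pr_le => // E [aL sp _].
case: k k1 lek aL sp => [//|[//|k]] _ lek /= aL sp.
rewrite -[k.+2]add1n; apply: spannedD; [exact: spanned1|by rewrite addn1|].
rewrite /merge_arcs addn1 /=; move: aL; rewrite /attachedL => /orP[->//|->].
by rewrite orbT.
Qed.

(** Every merge uses an edge between the two pieces, and such an edge lies inside neither of them,
    so the k - 1 merges use distinct edges. *)
Lemma spanned_edges E s k : (k <= n.+1)%N -> spanned sigma E s k ->
  (k.-1 <= #|E :&: pairs_in (arc s k)|)%N.
Proof.
move=> lek sp; elim: sp lek => // {}s a b spa IHa spb IHb mab leab.
have a0 := spanned_gt0 spa; have b0 := spanned_gt0 spb.
have pa : (s + a).-1 = (s + a.-1)%N by clear -a0; lia.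
have ua : vtx (s + a).-1 \in arc s a by rewrite pa mem_arc // prednK.
have ub : vtx (s + a) \in arc (s + a) b by rewrite -[X in vtx X]addn0 mem_arc.
have nba : vtx (s + a) \notin arc s a.
  by apply: vtx_notin_arc; clear -leab b0; lia.
have nab : vtx (s + a).-1 \notin arc (s + a) b.
  have dis := arc_disjoint s leab.
  by rewrite (disjointFr dis ua).
have [x [y [xa yb xyE]]] : exists x y, [/\ x \in arc s a, y \in arc (s + a) b & adj E x y].
  have wit v S : (sigma <= nbr_count (adj E) v S)%N -> exists2 u, u \in S & adj E v u.
    move=> /(leq_trans sigma_gt0) /card_gt0P[u]; rewrite !inE => /and3P[uS _ vu].
    by exists u.
  case/or3P: mab => [H|/wit[u us vu]|/wit[u us vu]].
  - by exists (vtx (s + a).-1), (vtx (s + a)).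
  - by exists (vtx (s + a).-1), u.
  - by exists u, (vtx (s + a)); rewrite adj_sym.
have dis := arc_disjoint s leab.
have xy : x != y by apply: contraTneq xa => ->; rewrite (disjointFl dis yb).
have sub : [set [set x; y]] :|: (E :&: pairs_in (arc s a) :|: E :&: pairs_in (arc (s + a) b))
    \subset E :&: pairs_in (arc s (a + b)).
  have xyE' : [set x; y] \in E := xyE.
  rewrite !subUset !sub1set !inE xyE' cards2 xy subUset !sub1set arcD !inE xa yb orbT /=.
  by rewrite !setIS // pairs_inS // ?subsetUl ?subsetUr.
apply: leq_trans (subset_leq_card sub).
have d1 : (E :&: pairs_in (arc s a)) :&: (E :&: pairs_in (arc (s + a) b)) = set0.
  by rewrite setIACA (disjoint_setI0 (pairs_in_disjoint dis)) setI0.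
have d2 : [set [set x; y]] :&: (E :&: pairs_in (arc s a) :|: E :&: pairs_in (arc (s + a) b)) = set0.
  apply/setP => e; rewrite !inE; apply/negP => /andP[/eqP-> ].
  rewrite !subUset !sub1set (disjointFl dis yb) (disjointFr dis xa) !andbF.
  by rewrite orbF.
rewrite cardsU d2 cards0 subn0 cards1 cardsU d1 cards0 subn0.
have /IHa : (a <= n.+1)%N by clear -leab; lia.
have /IHb : (b <= n.+1)%N by clear -leab; lia.
move=> hb ha; have -> : (a + b).-1 = (1 + (a.-1 + b.-1))%N by clear -a0 b0; lia.
by rewrite leq_add2l leq_add.
Qed.

Lemma card_pairs_in S : #|pairs_in S| = 'C(#|S|, 2).
Proof.
by rewrite -cards_draws; apply: eq_card => e; rewrite !inE andbC.
Qed.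

(** Union bound over the choices of j = k - 1 edges among C(k, 2) <= k j: the binomial coefficient
    is at most (k j)^j / j!, and j^j <= e^j j!. *)
Lemma span_max_crude k : (0 < k <= n.+1)%N ->
  span_max k <= (expR 1 * k%:R * p) ^+ k.-1.
Proof.
move=> /andP[k0 lek]; have /andP[p0 p1] := p01.
have base0 : 0 <= expR 1 * k%:R * p :> R by rewrite !mulr_ge0 ?expR_ge0.
apply: bigmax0_le => [|i]; first exact: exprn_ge0.
apply: le_trans (pr_le a01 (fun E => @spanned_edges E i k lek)) _.
apply: le_trans (@pr_atleast _ _ _ a01 p _ _ _) _.
  by move=> e; rewrite inE => /andP[eV _]; rewrite /edge_weight eV.
rewrite card_pairs_in card_arc // -mulr_natr exprMn mulrC; apply: ler_wpM2r.
  exact: exprn_ge0.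
case: k k0 {lek base0} => // j _; rewrite /= exprMn.
have f0 : 0 < j`!%:R :> R by rewrite ltr0n fact_gt0.
have h1 : 'C('C(j.+1, 2), j)%:R * j`!%:R <= j.+1%:R ^+ j * j%:R ^+ j :> R.
  rewrite -natrM -!natrX -natrM ler_nat -expnMn.
  apply: leq_trans (bin_le_expn _ _) _.
  have : ('C(j.+1, 2) <= j.+1 * j)%N by rewrite bin2 /= -leq_double; lia.
  by case: (j) => // j'; rewrite leq_exp2r.
rewrite -(ler_pM2r f0); apply: le_trans h1 _.
rewrite -expRM_natl mulr1 [X in _ <= X]mulrAC [X in _ <= X]mulrC; apply: ler_wpM2l; first exact: exprn_ge0.
exact: expn_le_fact.
Qed.

End Attachment.

(** * From spanning and nucleation probabilities to bounds on the stopping time *)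

Section TimeBounds.
Variables (R : realType) (p : R) (n sigma : nat).
Hypothesis p01 : 0 <= p <= 1.
Hypothesis sigma_gt0 : (0 < sigma)%N.
Implicit Types (s k L K t W D G J : nat) (E : {set {set 'I_n.+1}}).

Notation vtx := (vtx n).
Notation arc := (arc n).
Notation P := (pr (@edge_weight R p n)).
Notation cluster := (fun E => cluster (@ring_graph n.+1) (adj E) sigma 1 None).

Let a01 e := @edge_weight01 R p n e p01.

Definition nucleus E s L := forall m, (0 < m < L)%N -> attached sigma E s m.

Lemma depends_nucleus s L : (L <= n.+1)%N ->
  depends_on (pairs_in (arc s L)) (fun E => nucleus E s L).
Proof.
move=> leL E E' e nuc m /andP[m0 ltm].
have mn : (0 < m <= n)%N by rewrite m0; clear -ltm leL; lia.
have sub : star (vtx (s + m)) (arc s m) \subset pairs_in (arc s L).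
  apply: star_pairs_in; first exact: mem_arc.
  by apply: arc_subset0; apply: ltnW.
have attm : attached sigma E s m by apply: nuc; rewrite m0.
exact: depends_onS sub (depends_attached mn) _ _ e attm.
Qed.

(** The m-th attachment depends only on the edges from vertex s + m back to the arc before it. These
    stars are disjoint for different m, so the probabilities multiply. *)
Lemma pr_nucleus s L : (L <= n.+1)%N ->
  \prod_(1 <= m < L) attach_low sigma p m <= P (fun E => nucleus E s L).
Proof.
move=> leL; rewrite big_add1 big_mkord.
have -> : P (fun E => nucleus E s L) =
    P (fun E => forall i, (i < L.-1)%N -> attached sigma E s i.+1).
  apply: eq_bigr => E _; congr (_ * _%:R); congr nat_of_bool.
  apply/asboolP/asboolP => [nuc i lti|att [//|i] /andP[_ lti]].
    by apply: nuc; clear -lti; lia.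
  by apply: att; clear -lti; lia.
rewrite (@pr_forall _ _ _ _ (fun i => star (vtx (s + i.+1)) (arc s i.+1))).
- apply: ler_prod => i _; apply/andP; split.
    by case/andP: p01 => p0 _; rewrite le_max p0.
  by apply: pr_attached_ge => //; have := ltn_ord i; clear -leL; lia.
- move=> i j /andP[ij jL]; rewrite disjoint_sym.
  have sub : star (vtx (s + i.+1)) (arc s i.+1) \subset pairs_in (arc s i.+2).
    by apply: star_pairs_in; [apply: mem_arc|apply: arc_subset0].
  apply: disjointWr sub _; apply: star_pairs_in_disjoint.
  apply/negP => /arcP[r ltr /vtx_inj e].
  have jn : (j.+1 <= n)%N by clear -jL leL; lia.
  have rn : (r <= n)%N by clear -ltr ij jn; lia.
  by have := e jn rn; clear -ltr ij; lia.
- by move=> i lti; apply: depends_attached; clear -lti leL; lia.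
Qed.

Lemma pr_no_nucleus s L J (q : R) : (J * L <= n)%N -> (0 < L)%N ->
  q <= \prod_(1 <= m < L) attach_low sigma p m ->
  P (fun E => forall i, (i < J)%N -> ~ nucleus E (s + i * L) L) <= (1 - q) ^+ J.
Proof.
move=> leJ L0 leq.
rewrite (@pr_forall _ _ _ _ (fun i => pairs_in (arc (s + i * L) L))).
- have [->|J0] := eqVneq J 0%N; first by rewrite big_ord0 expr0.
  have leL : (L <= n.+1)%N by move: J0; clear -leJ; nia.
  rewrite -[X in _ ^+ X]card_ord -prodr_const; apply: ler_prod => i _.
  rewrite pr_ge0 // pr_not lerD2l lerN2; apply: le_trans leq _.
  exact: pr_nucleus.
- move=> i j /andP[ij jJ]; apply: pairs_in_disjoint.
  have e : (s + j * L = (s + i * L) + (j - i) * L)%N by clear -ij; nia.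
  have dis : [disjoint arc (s + i * L) L & arc (s + i * L + L) ((j - i) * L)].
    by apply: arc_disjoint; clear -ij jJ leJ; nia.
  apply: disjointWr dis; rewrite e.
  have -> : (s + i * L + (j - i) * L = (s + i * L + L) + (j - i).-1 * L)%N by clear -ij; nia.
  by apply: arc_subset; clear -ij; nia.
- move=> i lti; apply: depends_onN; apply: depends_nucleus.
  by move: lti; clear -leJ; nia.
Qed.

Lemma pr_exists_spanned K W (b : R) :
  (forall s k, (K <= k < 2 * K)%N -> P (fun E => spanned sigma E s k) <= b) ->
  P (fun E => exists2 s, (0 <= s < W)%N & exists2 k, (K <= k < 2 * K)%N & spanned sigma E s k)
    <= W%:R * K%:R * b.
Proof.
move=> le_b; apply: le_trans (pr_ex a01 _ _ _) _.
apply: le_trans (_ : \sum_(0 <= s < W) (K%:R * b) <= _); last first.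
  by rewrite sumr_const_nat subn0 -[X in X <= _]mulr_natl mulrA.
apply: ler_sum_nat => s _; apply: le_trans (pr_ex a01 _ _ _) _.
apply: le_trans (_ : \sum_(K <= k < 2 * K) b <= _).
  by apply: ler_sum_nat => k /le_b.
by rewrite sumr_const_nat -[X in X <= _]mulr_natl mul2n -addnn addnK.
Qed.

Lemma ring_time_lt E K : (1 < K)%N ->
  (forall s k, (s < n.+1)%N -> (K <= k < 2 * K)%N -> ~ spanned sigma E s k) ->
  (ring_time sigma E < K)%N.
Proof.
move=> K1 nsp; apply: jigsaw_time_lt; first exact: ltnW.
move=> t x; have nsp' s k y : (K <= k < 2 * K)%N -> y \in arc s k ->
    y \in [set: 'I_n.+1] -> ~ spanned sigma E s k.
  move=> lek _ _ sp; apply: (nsp (s %% n.+1)%N k) => //; first exact: ltn_pmod.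
  by apply: spanned_mod sp; rewrite modn_mod.
(* The window is the whole ring at all times: with no outside, nothing has to shrink. *)
have [|s [k [-> _ ltk]]] :=
    cluster_spanned (I := fun=> [set: 'I_n.+1]) K1 _ nsp' (t := t) (in_setT x).
  by move=> *; apply: subsetT.
exact: leq_ltn_trans (leq_card_arc _ _ _) ltk.
Qed.

Lemma pr_late K (b : R) : (1 < K)%N ->
  (forall s k, (K <= k < 2 * K)%N -> P (fun E => spanned sigma E s k) <= b) ->
  P (fun E => ~ (ring_time sigma E < K)%N) <= n.+1%:R * K%:R * b.
Proof.
move=> K1 le_b; apply: le_trans (pr_exists_spanned n.+1 le_b); apply: pr_le => // E.
apply: contra_notP => nex; apply: ring_time_lt => // s k lts lek sp.
by apply: nex; exists s => //; exists k.
Qed.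

(** A window of width [W] without spanned arcs of length in [K, 2K) loses 2K vertices at each end
    per step; as W >= 4K(t + 1), a point survives at time t, and its cluster is shorter than K. *)
Lemma unsolved E K t W : (1 < K)%N -> (4 * K * t.+1 <= W)%N -> (W <= n)%N ->
  (forall s k, (s < W.+1)%N -> (K <= k < 2 * K)%N -> ~ spanned sigma E s k) ->
  exists x y, y \notin cluster E t x.
Proof.
move=> K1 leW Wn nsp.
pose I t : {set 'I_n.+1} := [set x : 'I_n.+1 | (2 * K * t.+1 <= x) && (x + 2 * K * t.+1 <= W)]%N.
pose x := vtx (2 * K * t.+1).
have vx : x = (2 * K * t.+1)%N :> nat by rewrite /= modn_small //; clear -leW Wn; nia.
have xI : x \in I t by rewrite inE vx leqnn /=; clear -leW; nia.
(* The window keeps arcs away from 0, so a start known modulo n + 1 can be replaced by the integer y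
   - i. *)
have shift s i (y : 'I_n.+1) : y = vtx (s + i) -> (i <= y)%N ->
    (y - i = s %[mod n.+1])%N.
  move=> ey ley; apply/eqP; rewrite -(eqn_modDr i) subnK //.
  by apply/eqP; rewrite ey /= modn_mod.
have [||s [k [eC _ ltk]]] := @cluster_spanned n sigma E K I K1 _ _ t x xI.
- move=> u s k y; rewrite inE => /andP[y1 y2] /arcP[i lti ey] lek.
  have iy : (i <= y)%N by clear -y1 lti lek; nia.
  have es := shift s i y ey iy.
  apply/subsetP => z /arcP[j ltj ez].
  have {}ez : z = (y - i + j)%N :> nat.
    rewrite ez /= -modnDml -es modnDml modn_small //.
    by clear -y2 Wn iy ltj lek; nia.
  by rewrite inE ez; clear -y1 y2 iy lti ltj lek; nia.
- move=> s k y lek /arcP[i lti ey]; rewrite inE muln1 => /andP[y1 y2] sp.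
  have iy : (i <= y)%N by clear -y1 lti lek; lia.
  apply: (nsp (y - i)%N k) => //; first by clear -y2; lia.
  by apply: spanned_mod sp; rewrite (shift _ _ _ ey iy).
exists x; apply/existsP; apply: contraT => /existsPn allx.
have : (#|'I_n.+1| <= #|arc s k|)%N.
  apply/subset_leq_card/subsetP => y _; rewrite -eC.
  by have := allx y; rewrite negbK.
rewrite card_ord; have := leq_card_arc n s k; clear -ltk leW Wn; nia.
Qed.

Lemma pr_not_far L : (L <= n)%N ->
  P (fun E => exists2 s, (0 <= s < n.+1)%N & ~ (sigma <= nbr_count (adj E) (vtx (s + L)) (arc s L))%N)
    <= n.+1%:R * (2 ^+ sigma * expR (- (L%:R * p / 2))).
Proof.
move=> leL; apply: le_trans (pr_ex a01 _ _ _) _.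
apply: le_trans (_ : \sum_(0 <= s < n.+1) (2 ^+ sigma * expR (- (L%:R * p / 2))) <= _); last first.
  by rewrite sumr_const_nat subn0 -[X in X <= _]mulr_natl.
apply: ler_sum_nat => s _; rewrite pr_not (pr_coll _ _ (vtx_notin_arc s leL)).
rewrite card_arc; last exact: leqW.
by have := binomial_tail_chernoff p01 sigma L; lra.
Qed.

(** By [nucleation], failure needs either a vertex with fewer than sigma neighbours among the [L]
    preceding ones, or one of at most n + 1 blocks of length J L whose J disjoint arcs all fail to
    be nuclei. *)
Lemma pr_unsolved L J (q : R) : (0 < L)%N -> (0 < J)%N -> (J * L <= n)%N ->
  q <= \prod_(1 <= m < L) attach_low sigma p m ->
  P (fun E => ~ forall x y, y \in cluster E (3 * (J * L)) x) <=
  n.+1%:R * (2 ^+ sigma * expR (- (L%:R * p / 2))) + n.+1%:R * (1 - q) ^+ J.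
Proof.
move=> L0 J0 leJ leq; set D := (J * L)%N.
have D0 : (0 < D)%N by rewrite muln_gt0 J0.
pose G := (n.+1 %/ D)%N.
have G0 : (0 < G)%N by rewrite divn_gt0 // leqW.
have GD : (G * D <= n.+1 < G.+1 * D)%N by rewrite leq_divM -ltn_divLR // ltnSn.
have leG : (G <= n.+1)%N by apply: leq_div.
have q1 : 0 <= 1 - q.
  rewrite subr_ge0; apply: le_trans leq _.
  apply: prodr_ile1 => m _; rewrite attach_low_le1 // andbT.
  by case/andP: p01 => p0 _; rewrite le_max p0.
have leL : (L <= n)%N by clear -leJ J0; nia.
apply: le_trans (_ : P (fun E => (exists2 s, (0 <= s < n.+1)%N &
     ~ (sigma <= nbr_count (adj E) (vtx (s + L)) (arc s L))%N) \/
   (exists2 g, (0 <= g < G)%N & forall i, (i < J)%N -> ~ nucleus E (g * D + i * L) L)) <= _).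
  apply: pr_le => // E; apply: contra_notP => nex.
  apply: (@nucleation n sigma E L D G) => //.
  - move=> s; apply: contrapT => nfar; apply: nex; left; exists (s %% n.+1)%N.
      by rewrite ltn_pmod.
    have e i : (s %% n.+1 + i = s + i %[mod n.+1])%N by rewrite modnDml.
    by rewrite (vtx_mod (e _)) (arc_mod _ (modn_mod s n.+1)).
  - move=> g ltg; apply: contrapT => nng; apply: nex; right; exists g => // i lti nuc.
    apply: nng; exists (g * D + i * L)%N; split=> //.
    by rewrite leq_addr /= /D; clear -lti L0; nia.
apply: le_trans (pr_or a01 _ _) _; apply: lerD; first exact: pr_not_far.
apply: le_trans (pr_ex a01 _ _ _) _.
apply: le_trans (_ : \sum_(0 <= g < G) (1 - q) ^+ J <= _).
  by apply: ler_sum_nat => g _; apply: pr_no_nucleus.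
by rewrite sumr_const_nat subn0 -[X in X <= _]mulr_natl ler_wpM2r ?exprn_ge0 // ler_nat.
Qed.

Lemma pr_slow (B : R) D : P (fun E => ~ forall x y, y \in cluster E D x) <= B ->
  P (fun E => ~ (ring_time sigma E <= D)%N) <= B.
Proof.
apply: le_trans; apply: pr_le => // E; apply: contra_not => sol.
exact: jigsaw_time_solved.
Qed.

(** Being unsolved at time [t] does not exclude having stopped; being solved at a later time [D]
    does. *)
Lemma pr_fast (B b : R) D K t W : (1 < K)%N -> (4 * K * t.+1 <= W)%N -> (W <= n)%N ->
  (forall s k, (K <= k < 2 * K)%N -> P (fun E => spanned sigma E s k) <= b) ->
  P (fun E => ~ forall x y, y \in cluster E D x) <= B ->
  P (fun E => ~ (t < ring_time sigma E)%N) <= W.+1%:R * K%:R * b + B.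
Proof.
move=> K1 leW Wn le_b le_B; apply: le_trans (lerD (pr_exists_spanned W.+1 le_b) le_B).
apply: le_trans (pr_or a01 _ _); apply: pr_le => // E nlt.
have [sol|] := pselect (forall x y, y \in cluster E D x); last by right.
left; apply: contrapT => nex; apply: nlt.
have [|x [y nyx]] := @unsolved E K t W K1 leW Wn.
  by move=> s k lts lek sp; apply: nex; exists s => //; exists k.
exact: jigsaw_time_gt (sol x y) nyx.
Qed.

End TimeBounds.

Lemma sum_linear_geometric (R : realType) (m n : nat) :
  \sum_(m <= b < n) b%:R * 2^-1 ^+ b <= 2 :> R.
Proof.
have H k : \sum_(0 <= b < k.+1) b%:R * 2^-1 ^+ b = 2 - (k%:R + 2) * 2^-1 ^+ k :> R.
  elim: k => [|k IHk]; first by rewrite big_nat1 mul0r expr0; lra.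
  by rewrite big_nat_recr //= IHk exprS -natr1; field.
have pos b : 0 <= b%:R * 2^-1 ^+ b :> R by rewrite mulr_ge0 ?exprn_ge0 // invr_ge0.
apply: (@le_trans _ _ (\sum_(0 <= b < n.+1) b%:R * 2^-1 ^+ b : R)).
  have [lemn|ltnm] := leqP m n; last first.
    by rewrite big_geq ?sumr_ge0 // ltnW.
  rewrite (big_cat_nat (leq0n m) (leqW lemn)) /= (big_nat_recr _ _ _ lemn) /=.
  by rewrite -[X in X <= _]add0r lerD ?sumr_ge0 // lerDl.
by rewrite H gerBl mulr_ge0 ?addr_ge0 ?exprn_ge0 // invr_ge0.
Qed.

(** * Solving the recursion by comparison with a product *)

Section Recursion.
Variables (R : realType) (C h eps p : R) (N K0 : nat) (F Q L : nat -> R).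
Hypotheses (C0 : 0 <= C) (h01 : 0 < h <= 1) (eps01 : 0 < eps <= 1) (p0 : 0 <= p).
Hypotheses (F_ge0 : forall m, 0 <= F m)
  (F_homo : forall k m, (k <= m)%N -> F k <= F m).
Hypotheses (Q_ge0 : forall k, 0 <= Q k).

Let G k := \sum_(2 <= a < k.-1) Q a * Q (k - a).

Hypothesis crude : forall k, (0 < k <= N)%N -> Q k <= (C * k%:R * p) ^+ k.-1.
Hypothesis recQ : forall k, (1 < k <= N)%N -> Q k <= F k.-1 * Q k.-1 + L k + G k.
Hypothesis recL : forall k, (3 < k <= N)%N ->
  L k <= F k.-1 * (L k.-1 + p * Q k.-2 + G k.-1).
Hypothesis L_le : forall k, (1 < k <= N)%N -> L k <= Q k.
Hypothesis K0_gt : (3 < K0)%N.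
Hypothesis K0_small : C * K0%:R * p <= h / 4.

(** Bound on the sum of all wide splits, relative to the comparison product. The first term comes
    from splits with a piece of length at most [K0], the second from the at most [N] splits with two
    longer pieces. *)
Definition slack : R := 64 * C * p / h ^+ 2 + N%:R * (2 / h) * 2^-1 ^+ K0.

Hypothesis small : slack + 2 * p / h <= eps ^+ 2 / 4.

(** Below [K0] the factor h/2 is twice the base h/4 of the crude bound, and half of the floor h
    valid from [K0] on. Both gaps are used: the first makes short pieces rare, the second penalises
    two long pieces. *)
Definition growth m : R := if (m < K0)%N then h / 2 else (1 + eps) * Num.max (F m) h.

Definition growth_prod k : R := \prod_(1 <= m < k) growth m.

Let h0 : 0 < h. Proof. by case/andP: h01. Qed.
Let e0 : 0 < eps. Proof. by case/andP: eps01. Qed.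

Lemma growth_ge_h m : (K0 <= m)%N -> h <= growth m.
Proof.
move=> leK; rewrite /growth ltnNge leK /=.
apply: (@le_trans _ _ (Num.max (F m) h)); first by rewrite le_max lexx orbT.
by rewrite ler_peMl ?lerDl ?ltW // lt_max h0 orbT.
Qed.

Lemma growth_ge m : h / 2 <= growth m.
Proof.
have [ltm|/growth_ge_h] := ltnP m K0; first by rewrite /growth ltm.
by apply: le_trans; have := h0; lra.
Qed.

Lemma growth_gt0 m : 0 < growth m.
Proof. by apply: lt_le_trans (growth_ge m); rewrite divr_gt0. Qed.

Lemma growth_homo k m : (k <= m)%N -> growth k <= growth m.
Proof.
move=> lekm; have [ltk|lek] := ltnP k K0; first by rewrite {1}/growth ltk growth_ge.
rewrite /growth !ltnNge lek (leq_trans lek lekm) /=.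
rewrite ler_pM2l ?addr_gt0 // ge_max !le_max lexx orbT andbT.
by rewrite F_homo.
Qed.

Lemma growth_prod_gt0 k : 0 < growth_prod k.
Proof. by apply: prodr_gt0 => m _; apply: growth_gt0. Qed.

Lemma growth_prodS k : (0 < k)%N -> growth_prod k.+1 = growth_prod k * growth k.
Proof. by move=> k0; rewrite /growth_prod big_nat_recr. Qed.

Lemma growth_prodD a b : (0 < a)%N ->
  growth_prod (a + b) = growth_prod a * \prod_(i < b) growth (a + i).
Proof.
move=> a0; elim: b => [|b IHb]; first by rewrite addn0 big_ord0 mulr1.
by rewrite addnS growth_prodS ?addn_gt0 ?a0 // IHb big_ord_recr mulrA.
Qed.

Lemma growth_prod_small k : (k <= K0)%N -> growth_prod k = (h / 2) ^+ k.-1.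
Proof.
move=> lek; rewrite /growth_prod (eq_big_nat _ _ (F2 := fun=> h / 2)).
  by rewrite prodr_const_nat subn1.
by move=> i /andP[_ ltik]; rewrite /growth (leq_trans ltik lek).
Qed.

Lemma growth_prod_step k : (0 < k)%N -> (1 + eps) * F k * growth_prod k <= growth_prod k.+1 \/ (k < K0)%N.
Proof.
move=> k0; have [|lek] := ltnP k K0; [by right|left].
rewrite growth_prodS // mulrC ler_pM2l ?growth_prod_gt0 // /growth ltnNge lek /=.
by rewrite ler_pM2l ?addr_gt0 // le_max lexx.
Qed.

Lemma Q_small k : (0 < k <= K0)%N -> (k <= N)%N ->
  Q k <= 2^-1 ^+ k.-1 * growth_prod k.
Proof.
move=> /andP[k0 lek] leN; apply: le_trans (crude _) _; first by rewrite k0.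
rewrite growth_prod_small // -exprMn; apply: lerXn2r.
- by rewrite nnegrE !mulr_ge0.
- by rewrite nnegrE mulr_ge0 ?invr_ge0 // divr_ge0 // ltW.
apply: le_trans (_ : h / 4 <= _); last by have := h0; lra.
apply: le_trans K0_small; rewrite ler_wpM2r // ler_wpM2l // ler_nat //.
Qed.

(** One factor C b p of the crude bound for the short piece is kept, the others are at most h/4.
    Lengthening the comparison product by b costs at least (h/2)^b, which leaves p b 2^-b up to
    constants. *)
Lemma Q_split_small a b : (0 < a)%N -> (1 < b <= K0)%N -> (b <= N)%N ->
  Q a <= growth_prod a ->
  Q b * Q a <= growth_prod (a + b) * (16 * C * p / h ^+ 2 * (b%:R * 2^-1 ^+ b)).
Proof.
move=> a0 /andP[b1 lebK] lebN Qa.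
have prod_ge : growth_prod a * (h / 2) ^+ b <= growth_prod (a + b).
  rewrite growth_prodD // ler_pM2l ?growth_prod_gt0 //.
  rewrite -[X in _ ^+ X]card_ord -prodr_const; apply: ler_prod => i _.
  rewrite growth_ge andbT divr_ge0 //. by rewrite ltW.
have c0 : 0 <= 16 * C * p / h ^+ 2 * (b%:R * 2^-1 ^+ b).
  by rewrite !mulr_ge0 ?invr_ge0 ?exprn_ge0 // ltW.
apply: le_trans (ler_wpM2r c0 prod_ge).
rewrite [X in X <= _]mulrC -[X in _ <= X]mulrA; apply: ler_pM => //.
apply: le_trans (crude _) _; first by rewrite lebN (ltnW b1).
case: b b1 lebK lebN {prod_ge c0} => [//|[//|b]] _ lebK _; rewrite /= exprS.
have -> : (h / 2) ^+ b.+2 * (16 * C * p / h ^+ 2 * (b.+2%:R * 2^-1 ^+ b.+2)) =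
    C * b.+2%:R * p * (h / 4) ^+ b.
  have -> : h / 4 = h / 2 * 2^-1 by field.
  rewrite [in RHS]exprMn !exprSr; set u := (h / 2) ^+ b; set v := 2^-1 ^+ b.
  by field; exact: lt0r_neq0.
apply: ler_wpM2l; first by rewrite !mulr_ge0.
apply: lerXn2r; [by rewrite nnegrE !mulr_ge0|by rewrite nnegrE divr_ge0 // ltW|].
by apply: le_trans K0_small; rewrite ler_wpM2r // ler_wpM2l // ler_nat.
Qed.

(** Compare the factors of the shorter product with the last factors of the long one: the first K0 -
    1 of them are h/2 against at least h, the others are ordered by monotonicity, and one factor, at
    least h, remains. *)
Lemma growth_prod_split a b : (K0 < b <= a)%N ->
  growth_prod b * growth_prod a <= growth_prod (a + b) * ((2 / h) * 2^-1 ^+ K0).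
Proof.
move=> /andP[ltb leba]; have a0 : (0 < a)%N by clear -ltb leba; lia.
rewrite growth_prodD // -mulrA [X in X <= _]mulrC ler_pM2l ?growth_prod_gt0 //.
case: b ltb leba => // b ltb leba; rewrite big_ord_recl /= addn0.
have -> : growth_prod b.+1 = \prod_(i < b) growth i.+1.
  by rewrite /growth_prod big_add1 big_mkord.
have split_b (f : nat -> R) : \prod_(i < b) f i =
    \prod_(i < K0.-1) f i * \prod_(K0.-1 <= i < b) f i.
  by rewrite -!(big_mkord xpredT f) -(@big_cat_nat _ _ _ K0.-1) //; clear -ltb; lia.
rewrite (split_b (fun i => growth i.+1)) (split_b (fun i => growth (a + bump 0 i))).
have le1 : \prod_(i < K0.-1) growth i.+1 <=
    \prod_(i < K0.-1) growth (a + bump 0 i) * 2^-1 ^+ K0.-1.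
  rewrite -[X in _ ^+ X]card_ord -prodr_const -big_split /=; apply: ler_prod => i _.
  rewrite ltW ?growth_gt0 //=; have lti : (i.+1 < K0)%N by have := ltn_ord i; clear -K0_gt; lia.
  rewrite {1}/growth lti ler_pM2r ?invr_gt0 //; apply: growth_ge_h.
  by clear -ltb leba; lia.
have le2 : \prod_(K0.-1 <= i < b) growth i.+1 <=
    \prod_(K0.-1 <= i < b) growth (a + bump 0 i).
  apply: ler_prod => i _; rewrite ltW ?growth_gt0 //=; apply: growth_homo.
  by rewrite /bump /=; clear -a0; lia.
have p1 : 0 <= \prod_(i < K0.-1) growth i.+1 by apply: prodr_ge0 => i _; rewrite ltW ?growth_gt0.
have p2 : 0 <= \prod_(K0.-1 <= i < b) growth i.+1 by apply: prodr_ge0 => i _; rewrite ltW ?growth_gt0.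
have := ler_pM p1 p2 le1 le2.
set X := \prod_(i < K0.-1) growth (a + _); set Y := \prod_(_ <= i < b) growth (a + _).
set Z := _ * _ => le3; apply: le_trans le3 _.
have X0 : 0 <= X by apply: prodr_ge0 => i _; rewrite ltW ?growth_gt0.
have Y0 : 0 <= Y by apply: prodr_ge0 => i _; rewrite ltW ?growth_gt0.
have -> : (2 / h) * 2^-1 ^+ K0 = h^-1 * 2^-1 ^+ K0.-1.
  by rewrite -[in LHS](prednK (ltnW (ltnW (ltnW K0_gt)))) exprS; field; exact: lt0r_neq0.
have ha : 1 <= growth a / h.
  by rewrite ler_pdivlMr // mul1r growth_ge_h //; clear -ltb leba; lia.
have -> : growth a * (X * Y) * (h^-1 * 2^-1 ^+ K0.-1) = (growth a / h) * (X * 2^-1 ^+ K0.-1 * Y).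
  by ring.
by rewrite ler_peMl // !mulr_ge0 // exprn_ge0 // invr_ge0.
Qed.

Lemma G_le k : (k <= N)%N -> (forall j, (0 < j < k)%N -> Q j <= growth_prod j) ->
  G k <= slack * growth_prod k.
Proof.
move=> leN Qle.
have term a : (2 <= a < k.-1)%N -> Q a * Q (k - a) <= growth_prod k *
   (16 * C * p / h ^+ 2 * (a%:R * 2^-1 ^+ a + (k - a)%:R * 2^-1 ^+ (k - a)) +
    (2 / h) * 2^-1 ^+ K0).
  (* [b] is the shorter piece; the bound is symmetric in the two pieces. *)
  have wl b c : (1 < b)%N -> (b <= c)%N -> (b + c = k)%N -> Q b * Q c <= growth_prod k *
   (16 * C * p / h ^+ 2 * (b%:R * 2^-1 ^+ b + c%:R * 2^-1 ^+ c) + (2 / h) * 2^-1 ^+ K0).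
    move=> b1 lebc ek.
    have pos j : 0 <= j%:R * 2^-1 ^+ j :> R by rewrite mulr_ge0 ?exprn_ge0 // invr_ge0.
    have cpos : 0 <= 16 * C * p / h ^+ 2 by rewrite !mulr_ge0 ?invr_ge0 ?exprn_ge0 // ltW.
    have dpos : 0 <= (2 / h) * 2^-1 ^+ K0 by rewrite mulr_ge0 ?divr_ge0 ?exprn_ge0 ?invr_ge0 // ltW.
    have Qb : Q b <= growth_prod b by apply: Qle; clear -b1 lebc ek; lia.
    have Qc : Q c <= growth_prod c by apply: Qle; clear -b1 lebc ek; lia.
    have [leb|ltb] := leqP b K0.
      have c0 : (0 < c)%N by clear -b1 lebc; lia.
      apply: le_trans (Q_split_small c0 _ _ Qc) _.
      - by rewrite b1.
      - by clear -ek leN; lia.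
      rewrite -ek addnC ler_pM2l ?growth_prod_gt0 //.
      by apply: ler_wpDr => //; rewrite ler_wpM2l // lerDl.
    apply: le_trans (ler_pM _ _ Qb Qc) _ => //.
    apply: le_trans (growth_prod_split _) _; first by rewrite ltb.
    rewrite -ek addnC ler_pM2l ?growth_prod_gt0 // lerDr.
    by rewrite mulr_ge0 // addr_ge0.
  move=> /andP[a2 ak]; have [le_a|lt_a] := leqP a (k - a).
    by apply: wl => //; clear -ak; lia.
  rewrite mulrC [X in _ * X + _]addrC; apply: wl; clear -a2 ak lt_a; lia.
rewrite /G big_nat; apply: le_trans (ler_sum _ term) _.
rewrite -big_nat -mulr_sumr [X in _ <= X]mulrC ler_pM2l ?growth_prod_gt0 //.
rewrite big_split /= -mulr_sumr big_split /=.
have s1 := sum_linear_geometric R 2 k.-1.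
have s2 : \sum_(2 <= a < k.-1) (k - a)%:R * 2^-1 ^+ (k - a) <= 2 :> R.
  rewrite big_nat_rev /=; apply: le_trans s1.
  rewrite big_nat [X in _ <= X]big_nat; apply: ler_sum => a /andP[a2 ak].
  by have -> : (k - (2 + k.-1 - a.+1) = a)%N by clear -a2 ak; lia.
rewrite sumr_const_nat.
apply: le_trans (_ : 16 * C * p / h ^+ 2 * 4 + N%:R * ((2 / h) * 2^-1 ^+ K0) <= _); last first.
  by rewrite /slack mulrA lerD2r; lra.
apply: lerD.
  have cpos : 0 <= 16 * C * p / h ^+ 2 by rewrite !mulr_ge0 ?invr_ge0 ?exprn_ge0 // ltW.
  by rewrite ler_wpM2l // (natrD _ 2 2) lerD.
rewrite -[X in X <= _]mulr_natl ler_wpM2r //.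
  by rewrite mulr_ge0 ?divr_ge0 ?exprn_ge0 ?invr_ge0 // ltW.
by rewrite ler_nat; clear -leN; lia.
Qed.

(** Joint induction for [Q] and [L]. The constant [xi] is the fixed point of the recursion for [L]:
    each step multiplies by at most 1/(1 + eps) and adds relative errors slack + 2p/h, so L stays
    below xi times the product. *)
Lemma span_bound k : (0 < k <= N)%N -> Q k <= growth_prod k.
Proof.
pose xi := (slack + 2 * p / h) / eps.
suff H j : (0 < j <= N)%N -> Q j <= growth_prod j /\
    ((K0 <= j)%N -> L j <= xi * growth_prod j) by move=> /H[].
elim/ltn_ind: j => j IHj /andP[j0 leN].
have IHQ i : (0 < i < j)%N -> Q i <= growth_prod i.
  by case/andP=> i0 ltij; case: (IHj i ltij) => //; rewrite i0 /=; clear -ltij leN; lia.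
have slack0 : 0 <= slack.
  by rewrite addr_ge0 // !mulr_ge0 ?invr_ge0 ?exprn_ge0 ?invr_ge0 // ltW.
have ph0 : 0 <= 2 * p / h by rewrite !mulr_ge0 ?invr_ge0 // ltW.
have xi_eps : slack + 2 * p / h = xi * eps by rewrite divfK // lt0r_neq0.
have xi_small : xi <= eps / 4 by rewrite ler_pdivrMr //; apply: le_trans small _; rewrite expr2; lra.
have /andP[_ e1] := eps01.
have xi_slack : slack <= xi.
  rewrite ler_pdivlMr //; apply: le_trans (_ : slack * 1 <= _).
    by rewrite ler_wpM2l.
  by rewrite mulr1 lerDl.
have Pj := growth_prod_gt0 j.
have [lej|ltj] := leqP j K0.
  have Qj : Q j <= 2^-1 ^+ j.-1 * growth_prod j by apply: Q_small; rewrite ?j0.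
  split.
    by apply: le_trans Qj _; rewrite ler_piMl ?(ltW Pj) // exprn_ile1 ?invr_ge0 // invf_le1 // ler1n.
  (* At length [K0] the recursion for [L] has not started, but the crude gain 2^-(K0 - 1) is already
     below the second term of [slack]. *)
  move=> geK; have ejK : j = K0 by apply/eqP; rewrite eqn_leq lej geK.
  apply: le_trans (L_le _) _; first by rewrite leN andbT; clear -ejK K0_gt; lia.
  apply: le_trans Qj _; rewrite ler_pM2r //; apply: le_trans xi_slack.
  rewrite ejK /slack; apply: ler_wpDl.
    by rewrite !mulr_ge0 ?invr_ge0 ?exprn_ge0 // ltW.
  rewrite -[in X in _ <= X](prednK (ltnW (ltnW (ltnW K0_gt)))) exprS mulrA.
  rewrite ler_peMl ?exprn_ge0 ?invr_ge0 //.
  have /andP[_ h1] := h01.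
  have -> : N%:R * (2 / h) * 2^-1 = N%:R / h by field; exact: lt0r_neq0.
  rewrite ler_pdivlMr // mul1r; apply: le_trans h1 _.
  by rewrite ler1n; clear -j0 leN; lia.
have lej1 : (K0 <= j.-1)%N by clear -ltj; lia.
have j1 : (0 < j.-1 < j)%N by clear -lej1 K0_gt; lia.
have j2 : (0 < j.-2 < j)%N by clear -lej1 K0_gt; lia.
have [_ /(_ lej1) L1] : Q j.-1 <= growth_prod j.-1 /\
    ((K0 <= j.-1)%N -> L j.-1 <= xi * growth_prod j.-1).
  by apply: IHj; clear -j1 leN; lia.
have step : (1 + eps) * F j.-1 * growth_prod j.-1 <= growth_prod j.
  have /andP[j1' _] := j1; have [|ltK] := growth_prod_step j1'; first by rewrite prednK.
  by clear -ltK lej1; lia.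
have FP : F j.-1 * growth_prod j.-1 <= growth_prod j / (1 + eps).
  by rewrite ler_pdivlMr ?addr_gt0 // mulrC mulrA.
have Lj : L j <= xi * growth_prod j.
  apply: le_trans (recL _) _; first by rewrite leN andbT; clear -ltj K0_gt; lia.
  have G1 : G j.-1 <= slack * growth_prod j.-1.
    apply: G_le => [|i /andP[i0 lti]]; first by clear -leN; lia.
    by apply: IHQ; rewrite i0; clear -lti; lia.
  have P2 : p * Q j.-2 <= 2 * p / h * growth_prod j.-1.
    have /andP[j2' _] := j2.
    have e2 : j.-1 = j.-2.+1 by clear -j2; lia.
    rewrite [X in _ * growth_prod X]e2 growth_prodS //; apply: le_trans (ler_wpM2l p0 (IHQ _ j2)) _.
    have := growth_ge j.-2; have Pp := growth_prod_gt0 j.-2 => gg.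
    have -> : 2 * p / h * (growth_prod j.-2 * growth j.-2) =
      p * growth_prod j.-2 * (growth j.-2 / (h / 2)) by field; exact: lt0r_neq0.
    apply: ler_peMr; first by rewrite mulr_ge0 // ltW.
    by rewrite ler_pdivlMr ?divr_gt0 // mul1r.
  apply: le_trans (ler_wpM2l (F_ge0 _) (lerD (lerD L1 P2) G1)) _.
  rewrite -!mulrDl mulrCA mulrC.
  have -> : xi + 2 * p / h + slack = xi * (1 + eps).
    by rewrite mulrDr mulr1 -xi_eps; ring.
  rewrite mulrC -mulrA ler_wpM2l ?mulrA //.
  by apply: le_trans slack0 xi_slack.
split=> //; apply: le_trans (recQ _) _; first by rewrite leN andbT; clear -ltj K0_gt; lia.
have Gj := G_le leN IHQ.
have Q1 : F j.-1 * Q j.-1 <= growth_prod j / (1 + eps).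
  by apply: le_trans FP; rewrite ler_wpM2l // IHQ.
apply: le_trans (lerD (lerD Q1 Lj) Gj) _.
rewrite [growth_prod j / _]mulrC -!mulrDl -[X in _ <= X]mul1r ler_pM2r //.
(* The factor 1 + eps in [growth] leaves room eps/2, of which [xi] and [slack] take at most eps/4
   each. *)
have : (1 + eps)^-1 <= 1 - eps / 2.
  by rewrite -[X in X <= _]mul1r ler_pdivrMr ?addr_gt0 //; have := e0; nra.
by have := e0; lra.
Qed.

End Recursion.

Import mathcomp.classical.classical_sets.
Local Open Scope classical_set_scope.
Local Open Scope ring_scope.

(** * Poisson limit and Riemann sums *)

Section PoissonLimit.
Variables (R : realType).

Definition poisson_tail sigma (x : R) : R :=
  1 - \sum_(i < sigma) x ^+ i / i`!%:R * expR (- x).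

Variables (T : Type) (F : set_system T) (FF : Filter F).
Variables (m : T -> nat) (p : T -> R) (x : R).
Hypothesis p0 : \forall t \near F, 0 < p t.
Hypothesis p_cvg : p t @[t --> F] --> (0 : R).
Hypothesis mp_cvg : (m t)%:R * p t @[t --> F] --> x.

Lemma subn_mul_cvg i : (m t - i)%N%:R * p t @[t --> F] --> x.
Proof.
apply: (@squeeze_cvgr _ _ _ _ (fun t => (m t)%:R * p t - i%:R * p t) (fun t => (m t)%:R * p t)) => //.
  near=> t; have pt : 0 < p t by near: t.
  rewrite -mulrBl !ler_pM2r // ler_nat leq_subr andbT lerBlDr -natrD ler_nat.
  by rewrite addnC -leq_subLR.
rewrite -[X in _ --> X]subr0 -[X in _ - X](mulr0 i%:R).
by apply: cvgB => //; apply: cvgMl_tmp.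
Unshelve. all: by end_near. Qed.

Lemma ffact_mul_cvg i : (m t ^_ i)%:R * p t ^+ i @[t --> F] --> x ^+ i.
Proof.
elim: i => [|i IHi].
  rewrite expr0; under eq_fun do rewrite ffactn0 expr0 mulr1.
  exact: cvg_cst.
rewrite exprSr.
under eq_fun do rewrite ffactnSr natrM exprSr mulrACA.
exact: cvgM IHi (subn_mul_cvg i).
Qed.

(** Squeeze through exp(-p/(1 - p)) <= 1 - p <= exp(-p). *)
Lemma expr_exp_cvg i : (1 - p t) ^+ (m t - i) @[t --> F] --> expR (- x).
Proof.
have mi := subn_mul_cvg i.
apply: (@squeeze_cvgr _ _ _ _ (fun t => expR (- ((m t - i)%N%:R * p t * (1 - p t)^-1)))
   (fun t => expR (- ((m t - i)%N%:R * p t)))).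
- near=> t; have pt : 0 < p t by near: t.
  have p1 : p t < 1 by near: t; apply: (cvgr_lt (0 : R)) => //; exact: ltr01.
  have q0 : 0 < 1 - p t by rewrite subr_gt0.
  apply/andP; split.
    have -> : - ((m t - i)%N%:R * p t * (1 - p t)^-1) = (m t - i)%N%:R * - (p t * (1 - p t)^-1).
      by rewrite mulrN mulrA.
    rewrite expRM_natl; apply: lerXn2r; rewrite ?nnegrE ?expR_ge0 ?(ltW q0) //.
    rewrite expRN invf_ple ?posrE ?expR_gt0 //; apply: le_trans (expR_ge1Dx _).
    by rewrite le_eqVlt; apply/orP; left; apply/eqP; field; rewrite gt_eqF.
  rewrite -mulrN expRM_natl; apply: lerXn2r; rewrite ?nnegrE ?expR_ge0 ?(ltW q0) //.
  exact: expR_ge1Dx.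
- apply: continuous_cvg; first exact: continuous_expR.
  apply: cvgN; rewrite -[X in _ --> X]mulr1; apply: cvgM => //.
  rewrite -[X in _ --> X]invr1; apply: cvgV; first by rewrite oner_eq0.
  by rewrite -[X in _ --> X]subr0; apply: cvgB => //; apply: cvg_cst.
- apply: continuous_cvg; first exact: continuous_expR.
  exact: cvgN.
Unshelve. all: by end_near. Qed.

Lemma binomial_tail_cvg sigma :
  binomial_tail (p t) sigma (m t) @[t --> F] --> poisson_tail sigma x.
Proof.
apply: cvgB; first exact: cvg_cst.
apply: cvg_big => [|i _]; first exact: add_continuous.
have -> : (fun t => p t ^+ i * (1 - p t) ^+ (m t - i) *+ 'C(m t, i)) =
  (fun t => ((m t ^_ i)%:R * p t ^+ i) / i`!%:R * (1 - p t) ^+ (m t - i)).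
  apply/funext => t; rewrite -bin_ffact natrM -mulr_natr.
  have f0 : i`!%:R != 0 :> R by rewrite pnatr_eq0 -lt0n fact_gt0.
  by field.
apply: cvgM; last exact: expr_exp_cvg.
by apply: cvgMr_tmp; exact: ffact_mul_cvg.
Qed.

End PoissonLimit.

(** * Monotonicity of the Poisson tail and Riemann sums for lambda_sigma *)

Section PoissonTail.
Variables (R : realType) (sigma : nat).
Implicit Types (x y d p : R).

Lemma truncn_div_cvg d : 0 <= d -> (Num.truncn (d / p))%:R * p @[p --> 0^'+] --> d.
Proof.
move=> d0; have idp : p @[p --> 0^'+] --> (0 : R) by apply: cvg_at_right_filter; exact: cvg_id.
apply: (@squeeze_cvgr _ _ _ _ (fun p => d - p) (fun=> d)).
- near=> p; have p0 : 0 < p by near: p; exact: nbhs_right_gt.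
  have /andP[le1 lt1] := truncn_itv (divr_ge0 d0 (ltW p0)).
  apply/andP; split; last by rewrite -ler_pdivlMr.
  rewrite lerBlDr; rewrite ltr_pdivrMr // -natr1 mulrDl mul1r in lt1.
  exact: ltW.
- by rewrite -[X in _ --> X]subr0; apply: cvgB => //; exact: cvg_cst.
- exact: cvg_cst.
Unshelve. all: by end_near. Qed.

Lemma binomial_tail_block_cvg d j : 0 <= d ->
  binomial_tail p sigma (j * Num.truncn (d / p)) @[p --> 0^'+] --> poisson_tail sigma (j%:R * d).
Proof.
move=> d0; apply: binomial_tail_cvg.
- exact: nbhs_right_gt.
- by apply: cvg_at_right_filter; exact: cvg_id.
- under eq_fun do rewrite natrM -mulrA.
  by apply: cvgMl_tmp; exact: truncn_div_cvg.
Qed.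

(** Inherited in the limit from the monotonicity of binomial tails in the number of trials. *)
Lemma poisson_tail_homo x y : 0 <= x -> x <= y ->
  poisson_tail sigma x <= poisson_tail sigma y.
Proof.
move=> x0 xy; have y0 := le_trans x0 xy.
have /= cx := @binomial_tail_block_cvg x 1 x0.
have /= cy := @binomial_tail_block_cvg y 1 y0.
rewrite !mul1r in cx cy; apply: ler_cvg_to cx cy _.
near=> p; have p0 : 0 < p by near: p; exact: nbhs_right_gt.
have p1 : p < 1 by near: p; apply: nbhs_right_lt.
apply: binomial_tail_homo; first by rewrite !ltW.
by rewrite !mul1n le_truncn // ler_pM2r // invr_gt0.
Unshelve. all: by end_near. Qed.

Lemma poisson_probE x : 0 < x ->
  poisson_prob x 0%N [set k | (sigma <= k)%N] = (poisson_tail sigma x)%:E.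
Proof.
move=> x0; have -> : [set k | (sigma <= k)%N] = ~` `I_sigma.
  by apply/seteqP; split=> k /=; [rewrite leqNgt => /negP | move/negP; rewrite -leqNgt].
rewrite probability_setC // /poisson_tail EFinB; congr (_ - _)%E.
transitivity (poisson_prob x 0%N `I_sigma) => //; rewrite /poisson_prob x0.
rewrite esum_fset //=; last first.
  by move=> k _; rewrite lee_fin poisson_pmf_ge0.
rewrite -fsbig_ord sumEFin; congr (_%:E).
by apply: eq_bigr => k _; rewrite /poisson_pmf x0.
Qed.

Lemma poisson_tail_gt0 x : 0 < x -> 0 < poisson_tail sigma x.
Proof.
move=> x0; rewrite -lte_fin -poisson_probE //.
apply: lt_le_trans (_ : poisson_prob x 0%N [set sigma] <= _)%E; last first.
  by apply: le_measure; rewrite ?inE // => k /= ->.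
rewrite /poisson_prob x0 esum_set1 ?lee_fin ?poisson_pmf_ge0 // lte_fin /poisson_pmf x0.
by rewrite !mulr_gt0 ?exprn_gt0 ?invr_gt0 ?expR_gt0 // ltr0n fact_gt0.
Qed.

Lemma poisson_tail_le1 x : 0 < x -> poisson_tail sigma x <= 1.
Proof. by move=> x0; rewrite -lee_fin -poisson_probE // probability_le1. Qed.

Definition nucleation_rate x : R := - ln (poisson_tail sigma x).

Lemma nucleation_rate_ge0 x : 0 < x -> 0 <= nucleation_rate x.
Proof. by move=> x0; rewrite oppr_ge0 ln_le0 // poisson_tail_le1. Qed.

Lemma nucleation_rate_anti x y : 0 < x -> x <= y -> nucleation_rate y <= nucleation_rate x.
Proof.
move=> x0 xy; have y0 := lt_le_trans x0 xy.
by rewrite lerN2 ler_ln ?posrE ?poisson_tail_gt0 // poisson_tail_homo // ltW.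
Qed.

Lemma g_E x : 0 < x -> g_ sigma x = (nucleation_rate x)%:E.
Proof. by move=> x0; rewrite /g_ poisson_probE // lne_EFin ?poisson_tail_gt0. Qed.

Local Notation mu := (@lebesgue_measure R).

Lemma measurable_g : measurable_fun (`]0, +oo[ : set R) (@g_ R sigma).
Proof.
apply: (@eq_measurable_fun _ _ _ _ _ (fun x => (nucleation_rate x)%:E)).
  by move=> x; rewrite inE /= in_itv /= andbT => x0; rewrite g_E.
apply/measurable_EFinP; apply: measurableT_comp => //.
apply: measurableT_comp => //; apply: measurable_funTS.
apply: measurable_funB => //; apply: measurable_sum => i.
apply: measurable_funM; first exact: measurable_funM.
by apply: measurableT_comp.
Qed.

Lemma measurable_gS (A : set R) : measurable A -> A `<=` `]0, +oo[ ->
  measurable_fun A (@g_ R sigma).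
Proof. by move=> mA sA; apply: measurable_funS sA measurable_g. Qed.

Lemma g_ge0 (A : set R) x : A `<=` `]0, +oo[ -> A x -> (0 <= g_ sigma x)%E.
Proof.
move=> sA /sA /=; rewrite in_itv /= andbT => x0.
by rewrite g_E // lee_fin nucleation_rate_ge0.
Qed.

(** The null set {0} is dropped because [g_E] holds only for x > 0: for sigma >= 1, [g_] is infinite
    at 0, while [nucleation_rate] is finite there by the convention ln 0 = 0. *)
Lemma lambda_open : lambda_ R sigma = (\int[mu]_(x in `]0%R, +oo[) g_ sigma x)%E.
Proof. by rewrite /lambda_ integral_itv_obnd_cbnd //; exact: measurable_g. Qed.

Lemma itv_pos0 (a b : R) : 0 <= a -> `]a, b]%classic `<=` `]0, +oo[%classic.
Proof. by move=> a0 x /=; rewrite !in_itv /= => /andP[/(le_lt_trans a0) -> _]. Qed.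

Lemma integral_block (a b c : R) : a <= b ->
  (\int[mu]_(x in `]a, b]) (cst c%:E x))%E = (c * (b - a))%:E.
Proof.
move=> ab; rewrite integral_cst //= lebesgue_measure_itv /= lte_fin.
case: ltP => [_|ba]; first by rewrite -EFinB -EFinM.
by rewrite mule0 (le_anti (introT andP (conj ab ba))) subrr mulr0.
Qed.

Lemma integral_block_ge (a b : R) : 0 <= a < b ->
  ((nucleation_rate b * (b - a))%:E <= \int[mu]_(x in `]a, b]) g_ sigma x)%E.
Proof.
move=> /andP[a0 ab]; have b0 := le_lt_trans a0 ab; have sab := @itv_pos0 a b a0.
rewrite -(integral_block _ (ltW ab)); apply: ge0_le_integral => //.
- by move=> x _; rewrite lee_fin nucleation_rate_ge0.
- exact: measurable_gS.
- move=> x xab; have := sab _ xab; rewrite /= in_itv /= andbT => x0.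
  rewrite g_E // lee_fin nucleation_rate_anti //.
  by move: xab; rewrite /= in_itv /= => /andP[].
Qed.

Lemma integral_block_le (a b : R) : 0 < a < b ->
  (\int[mu]_(x in `]a, b]) g_ sigma x <= (nucleation_rate a * (b - a))%:E)%E.
Proof.
move=> /andP[a0 ab]; have sab := @itv_pos0 a b (ltW a0).
rewrite -(integral_block _ (ltW ab)); apply: ge0_le_integral => //.
- by move=> x /(g_ge0 sab).
- exact: measurable_gS.
- move=> x xab; have := sab _ xab; rewrite /= in_itv /= andbT => x0.
  rewrite g_E // lee_fin nucleation_rate_anti //.
  by move: xab; rewrite /= in_itv /= => /andP[/ltW].
Qed.

Lemma integral_g_split (a b c : R) : 0 <= a -> a <= b -> b <= c ->
  (\int[mu]_(x in `]a, c]) g_ sigma x =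
   \int[mu]_(x in `]a, b]) g_ sigma x + \int[mu]_(x in `]b, c]) g_ sigma x)%E.
Proof.
move=> a0 ab bc; have sac := @itv_pos0 a c a0.
have eU : `]a, c]%classic = `]a, b]%classic `|` `]b, c]%classic.
  by rewrite -itv_bndbnd_setU // bnd_simp.
rewrite eU ge0_integral_setU // -?eU.
- exact: measurable_gS.
- by move=> x /(g_ge0 sac).
- apply/disj_setPS => x [] /=; rewrite !in_itv /= => /andP[_ xb] /andP[bx _].
  by have := lt_le_trans bx xb; rewrite ltxx.
Qed.

(** Since g_sigma decreases, the same sum is a right-endpoint sum on ]0, J d] and a left-endpoint
    sum on ]d, (J + 1) d]; [riemann_ge] is the second reading. *)
Lemma riemann_le d J : 0 < d ->
  ((d * \sum_(j < J) nucleation_rate (j.+1%:R * d))%:E <=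
    \int[mu]_(x in `]0%R, (J%:R * d)%R]) g_ sigma x)%E.
Proof.
move=> d0; elim: J => [|J IHJ].
  by rewrite big_ord0 mulr0; apply: integral_ge0 => x /(g_ge0 (itv_pos0 (lexx 0))).
have lt_d : J%:R * d < J.+1%:R * d by rewrite ltr_pM2r // ltr_nat.
have Jd : 0 <= J%:R * d by rewrite mulr_ge0 // ltW.
rewrite (@integral_g_split 0 (J%:R * d)) ?(ltW lt_d) //.
rewrite big_ord_recr mulrDr EFinD /=; apply: leeD => //.
apply: le_trans (integral_block_ge _); last by rewrite Jd.
by rewrite -mulrBl -natrB // subSnn mul1r mulrC.
Qed.

Lemma riemann_ge d J : 0 < d ->
  (\int[mu]_(x in `]d, (J.+1%:R * d)%R]) g_ sigma x <=
    (d * \sum_(j < J) nucleation_rate (j.+1%:R * d))%:E)%E.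
Proof.
move=> d0; elim: J => [|J IHJ].
  by rewrite mul1r big_ord0 mulr0 set_itvoc0 integral_set0.
have lt_d : J.+1%:R * d < J.+2%:R * d by rewrite ltr_pM2r // ltr_nat.
have Jd : d <= J.+1%:R * d by rewrite ler_peMl ?ler1n // ltW.
rewrite (@integral_g_split d (J.+1%:R * d)) ?(ltW lt_d) ?(ltW d0) //.
rewrite big_ord_recr mulrDr EFinD /=; apply: leeD => //.
apply: le_trans (integral_block_le _) _; first by rewrite (lt_le_trans d0).
by rewrite -mulrBl -natrB // subSnn mul1r mulrC.
Qed.

Lemma lambda_ge_riemann d J : 0 < d ->
  ((d * \sum_(j < J) nucleation_rate (j.+1%:R * d))%:E <= lambda_ R sigma)%E.
Proof.
move=> d0; apply: le_trans (riemann_le J d0) _; rewrite lambda_open.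
apply: ge0_subset_integral => //; [exact: measurable_g | |].
  by move=> x /(g_ge0 (@subset_refl _ _)).
exact: itv_pos0.
Qed.

Lemma lambda_ge0 : (0 <= lambda_ R sigma)%E.
Proof.
by have := @lambda_ge_riemann 1 0 ltr01; rewrite big_ord0 mulr0.
Qed.

Lemma lambda_fin_num c : (lambda_ R sigma < c%:E)%E -> lambda_ R sigma \is a fin_num.
Proof.
move=> ltc; apply/fin_numP; split; last by rewrite lt_eqF // (lt_trans ltc) // ltry.
by rewrite gt_eqF // (lt_le_trans _ lambda_ge0) // ltNyr.
Qed.

(** If all sums were at most c, [riemann_ge] would bound the integrals over the intervals ]1/(i +
    1), i + 1], taken with mesh 1/(i + 1), and monotone convergence would give lambda_sigma <= c.
    This covers an infinite value as well. *)
Lemma lambda_lt_riemann c : (c%:E < lambda_ R sigma)%E ->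
  exists d J, 0 < d /\ c < d * \sum_(j < J) nucleation_rate (j.+1%:R * d).
Proof.
move=> ltc; pose F i : set R := `]i.+1%:R^-1, i.+1%:R]%classic.
have F_pos i : F i `<=` `]0, +oo[%classic by apply: itv_pos0.
have F_homo : {homo F : n m / (n <= m)%N >-> (n <= m)%O}.
  move=> n m nm; apply/subsetPset => x; rewrite /F /= !in_itv /= => /andP[nx xn].
  rewrite (le_trans xn) ?ler_nat // andbT (le_lt_trans _ nx) //.
  by rewrite lef_pV2 ?posrE ?ltr0n // ler_nat.
have F_cup : \bigcup_i F i = `]0, +oo[%classic.
  apply/seteqP; split=> x; first by case=> i _ /F_pos.
  rewrite /= in_itv /= andbT => x0.
  exists (maxn (Num.truncn x) (Num.truncn x^-1)) => //; rewrite /F /= in_itv /=.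
  apply/andP; split.
    rewrite invf_plt ?posrE ?ltr0n //; apply: lt_le_trans (truncnS_gt _) _.
    by rewrite ler_nat ltnS leq_maxr.
  by apply: le_trans (ltW (truncnS_gt _)) _; rewrite ler_nat ltnS leq_maxl.
have cvgF : (\int[mu]_(x in F i) g_ sigma x)%E @[i --> \oo] -->
    (\int[mu]_(x in \bigcup_i F i) g_ sigma x)%E.
  apply: ge0_nondecreasing_set_cvg_integral => //.
  - by move=> i; exact: measurable_itv.
  - by move=> i; apply: measurable_gS => //; exact: measurable_itv.
  - by move=> i x; apply: g_ge0.
rewrite F_cup -lambda_open in cvgF.
apply: contrapT => nex; move: ltc; rewrite ltNge => /negP; apply.
apply: cvge_to_le cvgF _.
apply: nearW => i; pose d : R := i.+1%:R^-1.
have d0 : 0 < d by rewrite invr_gt0.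
have := riemann_ge (i.+1 * i.+1).-1 d0.
have -> : (i.+1 * i.+1).-1.+1%:R * d = i.+1%:R.
  by rewrite prednK ?muln_gt0 // natrM -mulrA divff ?mulr1.
move/le_trans; apply; rewrite lee_fin leNgt; apply/negP => ltd.
by apply: nex; exists d, (i.+1 * i.+1).-1.
Qed.

End PoissonTail.

Lemma prod_blocks_le (R : realType) (a f : nat -> R) (J M : nat) :
  (forall i, 0 <= a i) ->
  (forall j r, (j < J)%N -> (r < M)%N -> a (j * M + r)%N <= f j) ->
  \prod_(i < J * M) a i <= \prod_(j < J) f j ^+ M.
Proof.
move=> a0; elim: J => [|J IHJ] af; first by rewrite !big_ord0.
rewrite mulSn addnC big_split_ord /= big_ord_recr /=; apply: ler_pM.
- by apply: prodr_ge0 => i _.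
- by apply: prodr_ge0 => i _.
- by apply: IHJ => j r ltj; apply: af; rewrite ltnW.
- rewrite -[X in _ ^+ X]card_ord -prodr_const; apply: ler_prod => r _.
  by rewrite a0 af.
Qed.

Lemma prod_blocks_ge (R : realType) (a f : nat -> R) (J M : nat) :
  (forall j, 0 <= f j) ->
  (forall j r, (j < J)%N -> (r < M)%N -> f j <= a (j * M + r)%N) ->
  \prod_(j < J) f j ^+ M <= \prod_(i < J * M) a i.
Proof.
move=> f0; elim: J => [|J IHJ] af; first by rewrite !big_ord0.
rewrite mulSn addnC big_split_ord /= big_ord_recr /=; apply: ler_pM.
- by apply: prodr_ge0 => i _; rewrite exprn_ge0.
- by rewrite exprn_ge0.
- by apply: IHJ => j r ltj; apply: af; rewrite ltnW.
- rewrite -[X in _ ^+ X]card_ord -prodr_const; apply: ler_prod => r _.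
  by rewrite f0 af.
Qed.

(** Quadratic decay of 2^-K0 in p suffices to make the second term of [slack], which carries a
    factor of order 1/p, vanish with p. *)
Lemma expn2_ge_sqr (k : nat) : (k ^ 2 <= 2 * 2 ^ k)%N.
Proof.
elim: k => // k IHk; rewrite [in X in (_ <= X)%N]expnS.
have [|lek] := ltnP k 3; first by case: k IHk => [|[|[|]]].
apply: leq_trans (_ : 2 * k ^ 2 <= _)%N; first nia.
by rewrite leq_mul2l.
Qed.

(** * Asymptotics of the spanning probability *)

Section SpanUpper.
Variables (R : realType) (sigma : nat).
Hypothesis sigma_gt0 : (0 < sigma)%N.
Implicit Types (c d p : R).

Notation tail := (poisson_tail sigma).
Notation rate := (@nucleation_rate R sigma).

(** Each of the J blocks of M factors is bounded by its last value, one 1 + eps coming from [growth]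
    and one from the Poisson approximation. The fewer than K remaining factors are at most 1 + eps
    each; together the errors cost 3 eps K in the exponent. *)
Lemma growth_prod_le h eps p d (J K0 k : nat) :
  let M := Num.truncn (d / p) in let K := (J * M).+1 in
  0 < eps -> 0 < d -> 0 < p < 1 -> 0 < h <= tail d -> (K <= k < 2 * K)%N ->
  (forall j : 'I_J, p + binomial_tail p sigma (j.+1 * M) <= (1 + eps) * tail (j.+1%:R * d)) ->
  growth_prod h eps K0 (attach_bound p sigma) k <=
  expR (3 * eps * K%:R - M%:R * \sum_(j < J) rate (j.+1%:R * d)).
Proof.
move=> M K e0 d0 /andP[p0 p1] /andP[h0 hd] /andP[leK ltK] near_tail.
have p01 : 0 <= p <= 1 by rewrite !ltW.
have e1 : 1 <= 1 + eps by rewrite lerDl ltW.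
have e1' : 0 <= 1 + eps by apply: le_trans e1.
set F := attach_bound p sigma; set g := growth h eps K0 F.
have g_le m : g m <= (1 + eps) * Num.max (F m) h.
  rewrite /g /growth; case: ifP => // _.
  apply: le_trans (_ : h <= _); first by have := h0; lra.
  apply: le_trans (_ : Num.max (F m) h <= _); first by rewrite le_max lexx orbT.
  by rewrite ler_peMl // le_max (ltW h0) orbT.
have g0 m : 0 <= g m.
  rewrite /g /growth; case: ifP => _; first by rewrite divr_ge0 // ltW.
  by rewrite mulr_ge0 // le_max (ltW h0) orbT.
have tail_pos j : 0 < tail (j.+1%:R * d) by rewrite poisson_tail_gt0 // mulr_gt0.
rewrite /growth_prod (@big_cat_nat _ _ _ K) //=.
have -> : expR (3 * eps * K%:R - M%:R * \sum_(j < J) rate (j.+1%:R * d)) =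
    expR (- (M%:R * \sum_(j < J) rate (j.+1%:R * d)) + 2 * eps * K%:R) * expR (eps * K%:R).
  by rewrite -expRD; congr expR; ring.
apply: ler_pM; rewrite ?prodr_ge0 //; last first.
  apply: le_trans (_ : (1 + eps) ^+ (k - K) <= _).
    rewrite -prodr_const_nat; apply: ler_prod => m _; rewrite g0 /=.
    apply: le_trans (g_le m) _; rewrite ler_piMr // ge_max ge_min lexx /=.
    by apply: le_trans hd _; apply: poisson_tail_le1.
  apply: le_trans (_ : (1 + eps) ^+ K <= _).
    by rewrite ler_weXn2l //; clear -ltK; lia.
  by rewrite mulrC expRM_natl; apply: lerXn2r; rewrite ?nnegrE ?expR_ge0 ?expR_ge1Dx.
rewrite big_add1 /= big_mkord.
apply: le_trans (@prod_blocks_le _ (fun i => g i.+1)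
   (fun j => (1 + eps) ^+ 2 * tail (j.+1%:R * d)) J M _ _) _ => [//|j r ltj ltr|].
  apply: le_trans (g_le _) _; rewrite expr2 -mulrA ler_wpM2l // ge_max; apply/andP; split.
    apply: le_trans (_ : F (j.+1 * M)%N <= _).
      by apply: attach_bound_le => //; clear -ltr; lia.
    by rewrite ge_min (near_tail (Ordinal ltj)) orbT.
  apply: le_trans hd _; apply: le_trans (_ : tail (j.+1%:R * d) <= _).
    by apply: poisson_tail_homo; [exact: ltW|rewrite ler_peMl ?ler1n // ltW].
  by rewrite ler_peMl // ltW.
have tailE j : tail (j.+1%:R * d) = expR (- rate (j.+1%:R * d)).
  by rewrite /nucleation_rate opprK lnK // posrE.
rewrite (eq_bigr (fun j : 'I_J => ((1 + eps) ^+ 2) ^+ M * expR (- (M%:R * rate (j.+1%:R * d))))); last first.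
  by move=> j _; rewrite exprMn tailE -mulrN expRM_natl.
rewrite big_split /= prodr_const card_ord -expR_sum sumrN -mulr_sumr mulrC expRD.
rewrite ler_wpM2l ?expR_ge0 // -!exprM.
have -> : 2 * eps * K%:R = (2 * K)%:R * eps by rewrite natrM; ring.
rewrite expRM_natl; apply: le_trans (_ : (1 + eps) ^+ (2 * K) <= _).
  by rewrite ler_weXn2l // /K; clear; lia.
by apply: lerXn2r; rewrite ?nnegrE ?expR_ge0 ?expR_ge1Dx.
Qed.

Lemma span_upper c : 0 <= c -> (c%:E < lambda_ R sigma)%E ->
  exists B, 0 < B /\ \forall p \near 0^'+, exists K : nat,
  [/\ (1 < K)%N, K%:R <= B / p &
   forall n s k, (2 * K <= n)%N -> (K <= k < 2 * K)%N ->
     pr (@edge_weight R p n) (fun E => spanned sigma E s k) <= expR (- (c / p))].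
Proof.
(* An extra block only increases the sum, and J > 0 is needed to divide by it and to have K > 1. *)
move=> c0 /lambda_lt_riemann[d [J' [d0 ltc']]]; pose J := J'.+1.
pose S := \sum_(j < J) rate (j.+1%:R * d).
have rate0 (j : nat) : 0 <= rate (j.+1%:R * d) by rewrite nucleation_rate_ge0 // mulr_gt0.
have S0 : 0 <= S by apply: sumr_ge0.
have ltc : c < d * S.
  by apply: lt_le_trans ltc' _; rewrite ler_pM2l // /S big_ord_recr lerDl.
have J0 : 0 < J%:R :> R by rewrite ltr0n.
(* Chosen so that the total error 3 eps d J uses at most half of the gap between c and the Riemann
   sum. *)
pose eps := Num.min 1 ((d * S - c) / (6 * d * J%:R)).
have e0 : 0 < eps by rewrite lt_min ltr01 divr_gt0 ?subr_gt0 // !mulr_gt0.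
have e1 : eps <= 1 by rewrite ge_min lexx.
have eS : 0 < d * (S - 3 * eps * J%:R) - c.
  have : eps <= (d * S - c) / (6 * d * J%:R) by rewrite ge_min lexx orbT.
  by rewrite ler_pdivlMr ?mulr_gt0 //; nra.
pose h := tail d; have h0 : 0 < h by apply: poisson_tail_gt0.
have h1 : h <= 1 by apply: poisson_tail_le1.
pose C : R := expR 1; have C0 : 0 < C by apply: expR_gt0.
(* The three terms are the coefficients of p in the bounds for the two terms of [slack] and for
   2p/h. *)
pose D := 64 * C / h ^+ 2 + 512 * C ^+ 2 * (J%:R * d + 1) / h ^+ 3 + 2 / h.
have Jd0 : 0 < J%:R * d + 1 by rewrite addr_gt0 // mulr_gt0.
have D0 : 0 < D.
  have d1 : 0 < 64 * C / h ^+ 2 by rewrite divr_gt0 ?exprn_gt0 // mulr_gt0.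
  have d2 : 0 < 512 * C ^+ 2 * (J%:R * d + 1) / h ^+ 3.
    apply: divr_gt0; last exact: exprn_gt0.
    apply: mulr_gt0; last exact: Jd0.
    by apply: mulr_gt0; [rewrite ltr0n|apply: exprn_gt0].
  by rewrite !addr_gt0 // divr_gt0.
exists (J%:R * d + 1); split; first by rewrite addr_gt0 // mulr_gt0.
near=> p; have p0 : 0 < p by near: p; exact: nbhs_right_gt.
have p1 : p < 1 by near: p; exact: nbhs_right_lt.
have pd : p <= d by near: p; exact: nbhs_right_le.
have ph : p <= h / (16 * C) by near: p; apply: nbhs_right_le; rewrite divr_gt0 // mulr_gt0.
have pD : p <= eps ^+ 2 / (4 * D).
  by near: p; apply: nbhs_right_le; rewrite divr_gt0 ?exprn_gt0 // mulr_gt0.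
have pS : p <= (d * (S - 3 * eps * J%:R) - c) / (S + 3).
  by near: p; apply: nbhs_right_le; rewrite divr_gt0 // ltr_wpDl.
have ptail (j : 'I_J) : p + binomial_tail p sigma (j.+1 * Num.truncn (d / p)) <=
    (1 + eps) * tail (j.+1%:R * d).
  move: j; near: p; apply: filter_forall => j.
  have tj : 0 < tail (j.+1%:R * d) by rewrite poisson_tail_gt0 // mulr_gt0.
  have lim : p + binomial_tail p sigma (j.+1 * Num.truncn (d / p)) @[p --> 0^'+] -->
      0 + tail (j.+1%:R * d).
    apply: cvgD; first by apply: cvg_at_right_filter; exact: cvg_id.
    exact: binomial_tail_block_cvg (ltW d0).
  apply: (cvgr_le _ lim); rewrite add0r mulrDl mul1r ltrDl mulr_gt0 //.
pose M := Num.truncn (d / p); pose K := (J * M).+1.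
have dp0 : 0 <= d / p by rewrite divr_ge0 // ltW.
have /andP[leM ltM] : M%:R <= d / p < M.+1%:R := truncn_itv dp0.
have M0 : (0 < M)%N by rewrite truncn_gt0 ler_pdivlMr // mul1r.
have KB : K%:R <= (J%:R * d + 1) / p.
  rewrite -natr1 natrM mulrDl; apply: lerD; first by rewrite -mulrA ler_pM2l.
  by rewrite ler_pdivlMr // mul1r ltW.
exists K; split=> //; first by rewrite ltnS muln_gt0.
move=> n s k leKn /andP[leKk ltkK].
(* About the largest length for which the base C K0 p of the crude bound is at most h/4. *)
pose K0 := Num.truncn (h / (4 * C * p)).
have hp0 : 0 <= h / (4 * C * p) by rewrite divr_ge0 ?mulr_ge0 // ltW.
have /andP[leK0 ltK0] : K0%:R <= h / (4 * C * p) < K0.+1%:R := truncn_itv hp0.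
have K04 : 4 <= h / (4 * C * p).
  rewrite ler_pdivlMr ?mulr_gt0 //; move: ph; rewrite ler_pdivlMr ?mulr_gt0 //; lra.
have K0_gt : (3 < K0)%N.
  by rewrite truncn_gt_nat.
have p01 : 0 <= p <= 1 by rewrite !ltW.
apply: le_trans (_ : span_max p n sigma k <= _); first exact: pr_spanned.
have kn : (0 < k <= 2 * K)%N by clear -leKk ltkK; lia.
apply: (@le_trans _ _ (growth_prod h eps K0 (attach_bound p sigma) k)); last first.
  have p0p1 : 0 < p < 1 by rewrite p0.
  have hd : 0 < h <= tail d by rewrite h0 lexx.
  have leKkK : (K <= k < 2 * K)%N by rewrite leKk.
  apply: le_trans (growth_prod_le K0 e0 d0 p0p1 hd leKkK ptail) _.
  rewrite ler_expR -/M -/K -/S.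
  pose S' := S - 3 * eps * J%:R.
  have eS' : 0 < d * S' - c := eS.
  have pS' : p <= (d * S' - c) / (S + 3) := pS.
  have S'0 : 0 < S' by rewrite -(pmulr_rgt0 _ d0); move: eS' c0; lra.
  have S'S : S' <= S by rewrite gerBl !mulr_ge0 // ltW.
  have MS : (d / p - 1) * S' <= M%:R * S'.
    by rewrite ler_pM2r // lerBlDr natr1 ltW.
  have key : c / p + 3 * eps <= (d / p - 1) * S'.
    rewrite -(ler_pM2r p0) mulrDl divfK ?gt_eqF //.
    have -> : (d / p - 1) * S' * p = d * S' - p * S' by field; rewrite gt_eqF.
    move: pS'; rewrite ler_pdivlMr ?ltr_wpDl // => pS2.
    have : p * S' <= p * S by rewrite ler_pM2l.
    have : p * eps <= p * 1 by rewrite ler_pM2l.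
    by clear -pS2; lra.
  have : 3 * eps * K%:R - M%:R * S = 3 * eps - M%:R * S'.
    have -> : K%:R = J%:R * M%:R + 1 :> R by rewrite /K -natr1 natrM.
    by rewrite /S'; ring.
  by clear -key MS; lra.
apply: (@span_bound R C h eps p (2 * K) K0 (attach_bound p sigma)
   (span_max p n sigma) (left_max p n sigma)).
- exact: ltW.
- by rewrite h0.
- by rewrite e0.
- exact: ltW.
- by move=> m; apply: attach_bound_ge0.
- by move=> a b; apply: attach_bound_le.
- exact: span_max_ge0.
- by move=> j /andP[j0 lej]; apply: span_max_crude => //; rewrite j0 /=; clear -lej leKn; lia.
- by move=> j /andP[j0 lej]; apply: span_max_rec => //; rewrite j0 /=; clear -lej leKn; lia.
- by move=> j /andP[j0 lej]; apply: left_max_rec => //; rewrite j0 /=; clear -lej leKn; lia.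
- by move=> j /andP[j0 lej]; apply: left_max_le => //; rewrite j0 /=; clear -lej leKn; lia.
- exact: K0_gt.
- rewrite ler_pdivlMr ?mulr_gt0 // in leK0; rewrite ler_pdivlMr //.
  by apply: le_trans leK0; rewrite le_eqVlt; apply/orP; left; apply/eqP; ring.
- have y2 : h / (8 * C * p) <= K0%:R.
    have e2 : h / (4 * C * p) = 2 * (h / (8 * C * p)) by field; rewrite !gt_eqF.
    by move: K04 ltK0; rewrite e2 -natr1 => ? ?; lra.
  have y0 : 0 < h / (8 * C * p) by rewrite divr_gt0 // !mulr_gt0.
  have K00 : 0 < K0%:R :> R by apply: lt_le_trans y2.
  have pw : 2^-1 ^+ K0 <= 128 * C ^+ 2 * p ^+ 2 / h ^+ 2.
    have -> : 128 * C ^+ 2 * p ^+ 2 / h ^+ 2 = 2 * (h / (8 * C * p)) ^- 2.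
      by field; rewrite !gt_eqF.
    apply: le_trans (_ : 2 * K0%:R ^- 2 <= _); last first.
      rewrite ler_pM2l // lef_pV2 ?posrE ?exprn_gt0 //.
      by apply: lerXn2r; rewrite ?nnegrE ?ler0n ?(ltW y0).
    rewrite exprVn ler_pdivlMr ?exprn_gt0 // mulrC ler_pdivrMr ?exprn_gt0 //.
    by rewrite -!natrX -natrM ler_nat expn2_ge_sqr.
  have K2 : (2 * K)%:R <= 2 * ((J%:R * d + 1) / p) by rewrite natrM ler_pM2l.
  apply: le_trans (_ : D * p <= _); last first.
    by move: pD; rewrite ler_pdivlMr ?mulr_gt0 // => pD'; clear -pD'; lra.
  have -> : D * p = 64 * C * p / h ^+ 2 +
      2 * ((J%:R * d + 1) / p) * (2 / h) * (128 * C ^+ 2 * p ^+ 2 / h ^+ 2) + 2 * p / h.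
    by rewrite /D; field; rewrite !gt_eqF.
  rewrite /slack lerD2r lerD2l; apply: ler_pM => //.
  - by rewrite mulr_ge0 // divr_ge0 // ltW.
  - by rewrite ler_pM2r // divr_gt0.
- exact: kn.
Unshelve. all: by end_near. Qed.

End SpanUpper.

(** * Lower bound on the probability of a nucleus *)

Section NucleationLower.
Variables (R : realType) (sigma : nat).
Implicit Types (c d p eps : R).

Notation tail := (poisson_tail sigma).
Notation rate := (@nucleation_rate R sigma).

Lemma expR_ge_pow (x : R) n : 0 <= x -> x ^+ n.+1 / n.+1`!%:R <= expR x.
Proof. by move=> x0; apply: le_trans (expR_ge1Dxn n x0); rewrite lerDr. Qed.

(* For m at most d / p with d small, the chance that at least sigma of m trials
   succeed is at least of order (m p) ^ sigma, and m! >= (m / e) ^ m. *)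
Lemma seed_phase eps d p (M : nat) : 0 < eps -> 0 < d <= 2^-1 ->
  2 * sigma`!%:R * sigma.+1`!%:R * (2 * expR 1) ^+ sigma * d <= eps ^+ sigma.+1 ->
  0 < p < 1 -> p * sigma.+1`!%:R <= eps ^+ sigma.+1 ->
  M%:R * p <= d -> d / 2 <= M%:R * p -> (0 < sigma <= M)%N ->
  expR (- (2 * eps / p)) <= \prod_(1 <= m < M) attach_low sigma p m.
Proof.
move=> e0 /andP[d0 d2] d_small /andP[p0 p1] p_small Mpd dMp /andP[s0 sM].
have p01 : 0 <= p <= 1 by rewrite !ltW.
have f0 n : 0 < n`!%:R :> R by rewrite ltr0n fact_gt0.
(* Lower bound for P(Bin(m, p) = sigma) with i = m - sigma + 1: the falling factorial is at least
   i^sigma, and (1 - p)^(m - sigma) >= 1/2 because m p <= 1/2. *)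
pose w (i : nat) : R := (i%:R * p) ^+ sigma / (2 * sigma`!%:R).
have w0 i : 0 <= w i.
  by rewrite divr_ge0 ?exprn_ge0 ?mulr_ge0 // ltW.
have w1 i : (i <= M)%N -> w i <= 1.
  move=> leiM; rewrite ler_pdivrMr ?mulr_gt0 // mul1r.
  apply: le_trans (_ : 1 <= _).
    apply: exprn_ile1; first by rewrite mulr_ge0 // ltW.
    apply: le_trans (_ : M%:R * p <= _); first by rewrite ler_pM2r // ler_nat.
    by apply: le_trans Mpd _; lra.
  by rewrite -natrM ler1n muln_gt0 fact_gt0.
have low_w m : (sigma <= m < M)%N -> w (m - sigma).+1 <= attach_low sigma p m.
  move=> /andP[sm mM]; rewrite le_max; apply/orP; right.
  apply: le_trans (binomial_tail_ge p01 sigma m).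
  have half : 2^-1 <= (1 - p) ^+ (m - sigma).
    apply: le_trans (_ : 1 - (m - sigma)%:R * p <= _).
      have : (m - sigma)%:R * p <= M%:R * p.
        by rewrite ler_pM2r // ler_nat; clear -mM; lia.
      by move: Mpd; lra.
    elim: (m - sigma)%N => [|j IHj]; first by rewrite mul0r subr0 expr0.
    rewrite exprS -natr1; have q0 : 0 <= 1 - p by rewrite subr_ge0 ltW.
    apply: le_trans (ler_wpM2l q0 IHj).
    have : 0 <= j%:R * p * p by rewrite !mulr_ge0 // ltW.
    by nra.
  have bin_ge : (m - sigma).+1%:R ^+ sigma <= 'C(m, sigma)%:R * sigma`!%:R :> R.
    rewrite -natrM bin_ffact -natrX ler_nat ffact_prod.
    rewrite -[X in (_ ^ X)%N]card_ord -prod_nat_const; apply: leq_prod => i _.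
    by have := ltn_ord i; clear -sm; lia.
  rewrite /w exprMn -[X in _ <= X]mulr_natr.
  rewrite ler_pdivrMr ?mulr_gt0 //.
  have ps0 : 0 <= p ^+ sigma by rewrite exprn_ge0 // ltW.
  have -> : p ^+ sigma * (1 - p) ^+ (m - sigma) * 'C(m, sigma)%:R * (2 * sigma`!%:R) =
    (2 * (1 - p) ^+ (m - sigma)) * (('C(m, sigma)%:R * sigma`!%:R) * p ^+ sigma) by ring.
  apply: le_trans (ler_wpM2r ps0 bin_ge) _.
  rewrite ler_peMl ?mulr_ge0 //; last by move: half; lra.
have small_p : expR (- (eps / p)) <= p ^+ sigma.
  rewrite expRN invf_ple ?posrE ?expR_gt0 ?exprn_gt0 //.
  have ep0 : 0 <= eps / p by rewrite divr_ge0 // ltW.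
  apply: le_trans (expR_ge_pow sigma ep0).
  have -> : (eps / p) ^+ sigma.+1 / sigma.+1`!%:R =
      (p ^+ sigma)^-1 * (eps ^+ sigma.+1 / (p * sigma.+1`!%:R)).
    rewrite expr_div_n [p ^+ _.+1]exprS; field.
    by rewrite !gt_eqF ?exprn_gt0.
  by rewrite ler_peMr ?invr_ge0 ?exprn_ge0 ?(ltW p0) // ler_pdivlMr ?mul1r // mulr_gt0.
(* The geometric mean of the factors is a power of d up to constants. By [d_small] it is at least
   exp(-eps/d), so M <= d/p factors cost only eps/p. *)
have base_w : expR (- (eps / d)) <= (M%:R * p / expR 1) ^+ sigma / (2 * sigma`!%:R).
  apply: le_trans (_ : (d / (2 * expR 1)) ^+ sigma / (2 * sigma`!%:R) <= _); last first.
    rewrite ler_pM2r ?invr_gt0 ?mulr_gt0 //; apply: lerXn2r.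
    - by rewrite nnegrE divr_ge0 ?mulr_ge0 ?expR_ge0 // ltW.
    - by rewrite nnegrE divr_ge0 ?mulr_ge0 ?expR_ge0 // ltW.
    - by rewrite invfM mulrA ler_pM2r // invr_gt0 expR_gt0.
  rewrite expRN invf_ple ?posrE ?expR_gt0 //; last first.
    by rewrite divr_gt0 ?exprn_gt0 ?divr_gt0 ?mulr_gt0 ?expR_gt0.
  have ed0 : 0 <= eps / d by rewrite divr_ge0 // ltW.
  apply: le_trans (expR_ge_pow sigma ed0).
  have E0 : 0 < expR 1 :> R by apply: expR_gt0.
  have -> : (eps / d) ^+ sigma.+1 / sigma.+1`!%:R =
      ((d / (2 * expR 1)) ^+ sigma / (2 * sigma`!%:R))^-1 * (eps ^+ sigma.+1 /
        (2 * sigma`!%:R * sigma.+1`!%:R * (2 * expR 1) ^+ sigma * d)).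
    rewrite !expr_div_n [d ^+ _.+1]exprS; field.
    by rewrite !gt_eqF ?exprn_gt0 ?mulr_gt0.
  rewrite ler_peMr ?ler_pdivlMr ?mul1r //.
    by rewrite invr_ge0 divr_ge0 ?exprn_ge0 ?divr_ge0 ?mulr_ge0 // ltW.
  by rewrite !mulr_gt0 ?exprn_gt0 // mulr_gt0.
have prod_w : expR (- (eps / p)) <= \prod_(1 <= i < M.+1) w i.
  have -> : \prod_(1 <= i < M.+1) w i = M`!%:R ^+ sigma * (p ^+ sigma / (2 * sigma`!%:R)) ^+ M.
    rewrite fact_prod natr_prod -prodrXl.
    rewrite -[X in _ ^+ X](subn1 M.+1) -prodr_const_nat -big_split /=.
    by apply: eq_bigr => i _; rewrite /w exprMn mulrA.
  apply: le_trans (_ : (M%:R ^+ M / expR M%:R) ^+ sigma * (p ^+ sigma / (2 * sigma`!%:R)) ^+ M <= _).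
    have -> : (M%:R ^+ M / expR M%:R) ^+ sigma * (p ^+ sigma / (2 * sigma`!%:R)) ^+ M =
        ((M%:R * p / expR 1) ^+ sigma / (2 * sigma`!%:R)) ^+ M.
      rewrite -[X in expR X]mulr1 expRM_natl -expr_div_n exprAC -exprMn; congr (_ ^+ M).
      by rewrite mulrA -exprMn mulrAC.
    apply: le_trans (lerXn2r M _ _ base_w); rewrite ?nnegrE ?expR_ge0 //; last first.
      by rewrite divr_ge0 ?exprn_ge0 ?divr_ge0 ?mulr_ge0 ?expR_ge0 // ltW.
    rewrite -expRM_natl ler_expR mulrN lerN2 mulrA ler_pdivrMr //.
    have -> : eps / p * d = d * eps / p by field; rewrite gt_eqF.
    by rewrite ler_pdivlMr // mulrAC ler_pM2r.
  apply: ler_wpM2r; first by rewrite exprn_ge0 // divr_ge0 ?exprn_ge0 ?mulr_ge0 // ltW.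
  apply: lerXn2r; rewrite ?nnegrE ?divr_ge0 ?exprn_ge0 ?expR_ge0 //.
  by rewrite ler_pdivrMr ?expR_gt0 // mulrC expn_le_fact.
have -> : 2 * eps / p = eps / p + eps / p by field; rewrite gt_eqF.
rewrite opprD expRD.
(* The first sigma - 1 vertices attach by single edges, at total cost at least p^sigma. *)
rewrite (@big_cat_nat _ _ _ sigma) //=; apply: ler_pM; rewrite ?expR_ge0 //.
  apply: le_trans small_p _.
  apply: le_trans (_ : p ^+ (sigma - 1) <= _).
    by rewrite ler_wiXn2l ?(ltW p0) ?(ltW p1) // leq_subr.
  rewrite -prodr_const_nat; apply: ler_prod => m _.
  by rewrite (ltW p0) le_max lexx.
apply: le_trans prod_w _.
apply: le_trans (_ : \prod_(1 <= i < (M - sigma).+1) w i <= _).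
  rewrite (@big_cat_nat _ _ _ (M - sigma).+1) //=; last by rewrite ltnS leq_subr.
  rewrite ler_piMr ?prodr_ge0 //.
  rewrite big_nat; apply: prodr_ile1 => i /andP[_ leM]; rewrite w0 w1 //.
rewrite big_add1 /= -[X in \prod_(X <= _ < _) attach_low _ _ _](add0n sigma) big_addn.
rewrite big_nat [X in _ <= X]big_nat; apply: ler_prod => i /andP[_ ltiM].
rewrite w0 -[i in w i.+1](addnK sigma) low_w //; clear -ltiM sM; lia.
Qed.

(** Here each block of M factors is bounded below by its first value, so that the Riemann sum again
    uses the points (j + 1) d and stays below lambda_sigma. *)
Lemma block_phase eps d p (M J : nat) : 0 < p -> M%:R * p <= d -> 0 < d ->
  (forall j : 'I_J, tail (j.+1%:R * d) * expR (- eps) <= binomial_tail p sigma (j.+1 * M)) ->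
  0 <= p <= 1 -> 0 <= eps ->
  expR (- ((d * \sum_(j < J) rate (j.+1%:R * d) + d * J%:R * eps) / p)) <=
  \prod_(M <= m < J.+1 * M) attach_low sigma p m.
Proof.
move=> p0 Mpd d0 near_tail p01 e0.
rewrite -[X in \prod_(X <= _ < _) _](add0n M) big_addn mulSn addKn big_mkord.
have tail_pos j : 0 < tail (j.+1%:R * d) by rewrite poisson_tail_gt0 // mulr_gt0.
apply: le_trans (@prod_blocks_ge _ (fun i => attach_low sigma p (i + M))
   (fun j => tail (j.+1%:R * d) * expR (- eps)) J M _ _) => [|j|j r ltj ltr]; first last.
- rewrite le_max; apply/orP; right; apply: le_trans (near_tail (Ordinal ltj)) _.
  by apply: binomial_tail_homo => //=; clear; lia.
- by rewrite mulr_ge0 ?expR_ge0 // ltW.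
have tailE j : tail (j.+1%:R * d) = expR (- rate (j.+1%:R * d)).
  by rewrite /nucleation_rate opprK lnK // posrE.
have -> : \prod_(j < J) (tail (j.+1%:R * d) * expR (- eps)) ^+ M =
    \prod_(j < J) expR (- (M%:R * (rate (j.+1%:R * d) + eps))).
  by apply: eq_bigr => j _; rewrite tailE -expRD -opprD -mulrN expRM_natl.
rewrite -expR_sum [X in _ <= expR X]sumrN ler_expR lerN2 -mulr_sumr big_split /= sumr_const card_ord -[eps *+ J]mulr_natl.
rewrite -mulrA -mulrDr mulrAC ler_wpM2r //.
  by rewrite addr_ge0 ?mulr_ge0 // sumr_ge0 // => j _; rewrite nucleation_rate_ge0 // mulr_gt0.
by rewrite ler_pdivlMr.
Qed.

(** The failure probabilities y decay like r^m with 1 - r >= p/4 and 1 - y >= exp(-2y) for y <= 1/2.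
    The geometric series costs at most 8 kap / p, uniformly in [L]. *)
Lemma tail_phase eps p (kap : R) (m0 L : nat) : 0 < p <= 1 -> kap <= 2^-1 -> 8 * kap <= eps ->
  2 ^+ sigma * expR (- (m0%:R * p / 2)) <= kap ->
  expR (- (eps / p)) <= \prod_(m0 <= m < L) attach_low sigma p m.
Proof.
move=> /andP[p0 p1] kap2 kap8 kapE.
have p01 : 0 <= p <= 1 by rewrite ltW.
pose r := expR (- (p / 2)).
have rE m : expR (- (m%:R * p / 2)) = r ^+ m by rewrite /r -expRM_natl; congr expR; field.
have r0 : 0 < r by apply: expR_gt0.
have r1 : r <= 1 - p / 4.
  rewrite /r expRN; apply: le_trans (_ : (1 + p / 2)^-1 <= _).
    by rewrite lef_pV2 ?posrE ?expR_gt0 ?expR_ge1Dx // addr_gt0 // divr_gt0.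
  by rewrite -[X in X <= _]mul1r ler_pdivrMr; nra.
have r1' : r <= 1 by move: r1; lra.
have y_le m : (m0 <= m)%N -> 2 ^+ sigma * r ^+ m <= kap.
  move=> lem; apply: le_trans kapE; rewrite rE ler_pM2l ?exprn_gt0 //.
  by rewrite ler_wiXn2l // ltW.
have term m : (m0 <= m)%N -> expR (- (2 * (2 ^+ sigma * r ^+ m))) <= attach_low sigma p m.
  move=> lem; rewrite le_max; apply/orP; right.
  apply: le_trans (binomial_tail_chernoff p01 sigma m); rewrite rE.
  set y := 2 ^+ sigma * r ^+ m.
  have y0 : 0 <= y by rewrite mulr_ge0 ?exprn_ge0 // ltW.
  have y3 : 0 < 1 + 2 * y by move: y0; lra.
  have y2 : y <= 2^-1 by apply: le_trans (y_le _ lem) kap2.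
  rewrite expRN; apply: le_trans (_ : (1 + 2 * y)^-1 <= _).
    by rewrite lef_pV2 ?posrE ?expR_gt0 ?expR_ge1Dx.
  by rewrite -[X in X <= _]mul1r ler_pdivrMr //; move: y0 y2; nra.
apply: le_trans (_ : \prod_(m0 <= m < L) expR (- (2 * (2 ^+ sigma * r ^+ m))) <= _); last first.
  rewrite big_nat [X in _ <= X]big_nat; apply: ler_prod => m /andP[lem _].
  by rewrite expR_ge0 term.
rewrite -expR_sum ler_expR sumrN lerN2 -mulr_sumr -mulr_sumr.
have geom : \sum_(m0 <= m < L) r ^+ m <= r ^+ m0 * (4 / p).
  have [leL|ltL] := leqP L m0.
    by rewrite big_geq // mulr_ge0 ?divr_ge0 ?exprn_ge0 ?(ltW p0) ?(ltW r0).
  have H k : (1 - r) * \sum_(m0 <= m < m0 + k) r ^+ m = r ^+ m0 - r ^+ (m0 + k).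
    elim: k => [|k IHk]; first by rewrite addn0 big_geq // mulr0 subrr.
    by rewrite addnS big_nat_recr ?leq_addr //= mulrDr IHk exprS; ring.
  have /= := H (L - m0)%N; rewrite subnKC ?(ltnW ltL) // => HL.
  rewrite mulrA ler_pdivlMr //.
  have s0 : 0 <= \sum_(m0 <= m < L) r ^+ m by apply: sumr_ge0 => m _; rewrite exprn_ge0 // ltW.
  have rL : 0 <= r ^+ L by rewrite exprn_ge0 // ltW.
  have : p / 4 * \sum_(m0 <= m < L) r ^+ m <= (1 - r) * \sum_(m0 <= m < L) r ^+ m.
    by apply: ler_wpM2r => //; move: r1; lra.
  by rewrite HL; lra.
have c0 : 0 <= 2 * 2 ^+ sigma :> R by rewrite mulr_ge0 ?exprn_ge0.
rewrite mulrA; apply: le_trans (ler_wpM2l c0 geom) _.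
rewrite ler_pdivlMr //; have := y_le m0 (leqnn _).
have -> : 2 * 2 ^+ sigma * (r ^+ m0 * (4 / p)) * p = 8 * (2 ^+ sigma * r ^+ m0).
  by field; rewrite gt_eqF.
by move: kap8; lra.
Qed.

Lemma nucleation_lower c : (0 < sigma)%N -> (lambda_ R sigma < c%:E)%E ->
  \forall p \near 0^'+, forall L, expR (- (c / p)) <= \prod_(1 <= m < L) attach_low sigma p m.
Proof.
move=> s0 ltc.
have l_ge d J : 0 < d -> ((d * \sum_(j < J) rate (j.+1%:R * d))%:E <= lambda_ R sigma)%E.
  exact: lambda_ge_riemann.
have l_fin := lambda_fin_num ltc.
rewrite -(fineK l_fin) lte_fin in ltc; set l := fine _ in ltc.
have {}l_ge d J : 0 < d -> d * \sum_(j < J) rate (j.+1%:R * d) <= l.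
  by move=> d0; rewrite -lee_fin fineK //; apply: l_ge.
(* The gap c - l is spent as 2 eps on the seed, eps on the Poisson approximation of the blocks, eps
   on the tail. *)
pose eps := (c - l) / 4; have e0 : 0 < eps by rewrite divr_gt0 // subr_gt0.
have f0 n : 0 < n`!%:R :> R by rewrite ltr0n fact_gt0.
have E0 : 0 < expR 1 :> R by apply: expR_gt0.
pose D := 2 * sigma`!%:R * sigma.+1`!%:R * (2 * expR 1) ^+ sigma : R.
have D0 : 0 < D by rewrite !mulr_gt0 ?exprn_gt0 ?mulr_gt0.
have es0 : 0 < eps ^+ sigma.+1 by rewrite exprn_gt0.
pose d := Num.min 2^-1 (eps ^+ sigma.+1 / D).
have d0 : 0 < d by rewrite lt_min invr_gt0 ltr0n /= divr_gt0.
have d2 : 0 < d <= 2^-1 by rewrite d0 ge_min lexx.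
have dD : D * d <= eps ^+ sigma.+1.
  by rewrite mulrC -ler_pdivlMr // ge_min lexx orbT.
pose kap := Num.min 2^-1 (eps / 8).
have k0 : 0 < kap by rewrite lt_min invr_gt0 ltr0n /= divr_gt0.
have k2 : kap <= 2^-1 by rewrite ge_min lexx.
have k8 : 8 * kap <= eps by rewrite mulrC -ler_pdivlMr // ge_min lexx orbT.
(* Enough blocks for the Chernoff error at m p = J d to be at most [kap], using exp(x) >= x. *)
pose J := (Num.truncn (2 * 2 ^+ sigma / (kap * d))).+1.
have J0 : 0 < J%:R :> R by rewrite ltr0n.
have Jbig : 2 ^+ sigma * expR (- (J%:R * d / 2)) <= kap.
  rewrite expRN ler_pdivrMr ?expR_gt0 // mulrC -ler_pdivrMr //.
  apply: le_trans (expR_ge1Dx _); apply: ler_wpDl => //.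
  have := ltW (truncnS_gt (2 * 2 ^+ sigma / (kap * d))); rewrite -/J.
  rewrite ler_pdivrMr ?mulr_gt0 // => H; rewrite ler_pdivrMr //; move: H; lra.
pose eps' := eps / (d * J%:R); have e'0 : 0 < eps' by rewrite divr_gt0 // mulr_gt0.
near=> p; have p0 : 0 < p by near: p; exact: nbhs_right_gt.
have p1 : p < 1 by near: p; exact: nbhs_right_lt.
have pJ : p <= d / J.+1%:R by near: p; apply: nbhs_right_le; rewrite divr_gt0.
have pd2 : p <= d / 2 by near: p; apply: nbhs_right_le; rewrite divr_gt0.
have ps : p <= d / (sigma.+1)%:R by near: p; apply: nbhs_right_le; rewrite divr_gt0.
have pf : p <= eps ^+ sigma.+1 / sigma.+1`!%:R.
  by near: p; apply: nbhs_right_le; rewrite divr_gt0.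
have ptail (j : 'I_J) : tail (j.+1%:R * d) * expR (- eps') <=
    binomial_tail p sigma (j.+1 * Num.truncn (d / p)).
  move: j; near: p; apply: filter_forall => j.
  have tj : 0 < tail (j.+1%:R * d) by rewrite poisson_tail_gt0 // mulr_gt0.
  have lim := @binomial_tail_block_cvg R sigma d j.+1 (ltW d0).
  apply: (cvgr_ge _ lim).
  by rewrite -[X in _ < X]mulr1 ltr_pM2l // expR_lt1 oppr_lt0.
move=> L; pose M := Num.truncn (d / p).
have dp0 : 0 <= d / p by rewrite divr_ge0 // ltW.
have /andP[leM ltM] : M%:R <= d / p < M.+1%:R := truncn_itv dp0.
have p01 : 0 <= p <= 1 by rewrite !ltW.
have Mpd : M%:R * p <= d by rewrite -ler_pdivlMr.
have dMp : d - p <= M%:R * p.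
  by rewrite lerBlDr -[X in _ + X]mul1r -mulrDl natr1 -ler_pdivrMr // ltW.
have sM : (0 < sigma <= M)%N.
  rewrite s0 -(ler_nat R) -(ler_pM2r p0); apply: le_trans dMp.
  move: ps; rewrite ler_pdivlMr // -natr1; lra.
have M1 : (0 < M)%N by case/andP: sM => /leq_trans; apply.
have [JM1 JM2] : (1 <= J.+1 * M /\ M <= J.+1 * M)%N by clear -M1; nia.
(* All factors are at most 1, so lengthening the product is harmless and makes the three phases
   present for every [L]. *)
apply: le_trans (_ : \prod_(1 <= m < J.+1 * M + L) attach_low sigma p m <= _); last first.
  have [L1|L1] := leqP 1 L; last first.
    rewrite [X in _ <= X]big_geq; last by clear -L1; lia.
    by apply: prodr_ile1 => m _; rewrite attach_low_le1 // ltW // attach_low_gt0.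
  rewrite (@big_cat_nat _ _ _ L) ?leq_addl //= ler_piMr //.
    by apply: prodr_ge0 => m _; rewrite ltW // attach_low_gt0.
  by apply: prodr_ile1 => m _; rewrite attach_low_le1 // ltW // attach_low_gt0.
rewrite (@big_cat_nat _ _ _ (J.+1 * M)) ?leq_addr //= (@big_cat_nat _ _ _ M) //=.
have ph1 : expR (- (2 * eps / p)) <= \prod_(1 <= m < M) attach_low sigma p m.
  apply: (@seed_phase eps d) => //; first by rewrite p0.
    by rewrite -ler_pdivlMr.
  by apply: le_trans dMp; move: pd2; lra.
have ph2 := block_phase p0 Mpd d0 ptail p01 (ltW e'0).
have ph3 : expR (- (eps / p)) <= \prod_(J.+1 * M <= m < J.+1 * M + L) attach_low sigma p m.
  apply: (@tail_phase eps p kap) => //; first by rewrite p0 ltW.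
  apply: le_trans Jbig; rewrite ler_pM2l ?exprn_gt0 // ler_expR lerN2.
  rewrite ler_pM2r ?invr_gt0 // natrM -mulrA.
  apply: le_trans (_ : J.+1%:R * (d - p) <= _); last by rewrite ler_pM2l.
  by move: pJ; rewrite ler_pdivlMr // -natr1; lra.
apply: le_trans (ler_pM _ _ (ler_pM _ _ ph1 ph2) ph3); rewrite ?mulr_ge0 ?expR_ge0 //.
rewrite -!expRD ler_expR -!opprD lerN2 -!mulrDl ler_pM2r ?invr_gt0 //.
have -> : d * J%:R * eps' = eps by rewrite mulrC divfK // gt_eqF // mulr_gt0.
by have := l_ge d J d0; rewrite /eps; lra.
Unshelve. all: by end_near. Qed.

End NucleationLower.

(** * The critical window p ~ lambda / log n *)

Section Asymptotics.
Variables (R : realType) (lambda : R) (p : nat -> R).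
Hypothesis lambda_gt0 : 0 < lambda.
Hypothesis p01 : forall n, 0 <= p n <= 1.
Hypothesis p_asymp : p ~_\oo (fun n : nat => lambda / ln n%:R).

Lemma near_ln_ge (A : R) : \forall n \near \oo, A <= ln n%:R.
Proof.
near=> n; have n1 : expR A <= n%:R.
  by near: n; have /cvgryPge := @cvgr_idn R; apply.
rewrite -[A]expRK ler_ln // posrE ?expR_gt0 //.
exact: lt_le_trans (expR_gt0 _) n1.
Unshelve. all: by end_near. Qed.

Lemma near_mul_ln (e : R) : 0 < e -> \forall n \near \oo, `|p n * ln n%:R - lambda| <= e.
Proof.
move=> e0; move/eqaddoP: p_asymp => /(_ (e / lambda)).
rewrite divr_gt0 // => /(_ isT) H; near=> n.
have x0 : 0 < ln n%:R :> R by apply: lt_le_trans ltr01 _; near: n; exact: near_ln_ge.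
have : `|p n - lambda / ln n%:R| <= e / lambda * `|lambda / ln n%:R| by near: n.
have q0 : 0 <= lambda / ln n%:R by rewrite divr_ge0 // ltW.
rewrite (ger0_norm q0) mulrA divfK ?gt_eqF // ler_pdivlMr //.
rewrite -{2}(ger0_norm (ltW x0)) -normrM mulrBl divfK //.
by rewrite gt_eqF.
Unshelve. all: by end_near. Qed.

Lemma near_mul_ln_lt u : lambda < u -> \forall n \near \oo, p n * ln n%:R <= u.
Proof.
move=> lu; have /near_mul_ln : 0 < u - lambda by rewrite subr_gt0.
by apply: filterS => n; rewrite ler_distl => /andP[_]; rewrite addrC subrK.
Qed.

Lemma near_mul_ln_gt v : v < lambda -> \forall n \near \oo, v <= p n * ln n%:R.
Proof.
move=> vl; have /near_mul_ln : 0 < lambda - v by rewrite subr_gt0.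
by apply: filterS => n; rewrite ler_distl => /andP[+ _]; rewrite opprB addrC subrK.
Qed.

(** Besides p(n) -> 0 this needs p(n) > 0 eventually; both come from p(n) log n -> lambda > 0. *)
Lemma near_right0 (Q : R -> Prop) : (\forall q \near 0^'+, Q q) -> \forall n \near \oo, Q (p n).
Proof.
move=> /nbhs_ballP[e /= e0 H]; near=> n.
have x1 : 1 <= ln n%:R :> R by near: n; exact: near_ln_ge.
have x0 : 0 < ln n%:R :> R by apply: lt_le_trans x1.
have xe : 4 * lambda / e <= ln n%:R :> R by near: n; exact: near_ln_ge.
have lo : lambda / 2 <= p n * ln n%:R.
  by near: n; apply: near_mul_ln_gt; rewrite ltr_pdivrMr // ltr_pMr // ltr1n.
have hi : p n * ln n%:R <= 2 * lambda.
  by near: n; apply: near_mul_ln_lt; rewrite ltr_pMl // ltr1n.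
have p0 : 0 < p n by rewrite -(pmulr_lgt0 _ x0); apply: lt_le_trans lo; rewrite divr_gt0.
apply: H => //; rewrite /ball /= sub0r normrN gtr0_norm //.
rewrite -(ltr_pM2r x0); apply: le_lt_trans hi _.
move: xe; rewrite ler_pdivrMr // => xe; rewrite [X in _ < X]mulrC; apply: lt_le_trans xe.
by rewrite ltr_pM2r // ltr_nat.
Unshelve. all: by end_near. Qed.

Lemma poly_exp_le (C : R) j (eta e y : R) : 0 < eta -> 0 < e -> 0 < y ->
  `|C| * j.+1`!%:R / (eta ^+ j.+1 * e) <= y -> C * y ^+ j * expR (- (eta * y)) <= e.
Proof.
move=> eta0 e0 y0 yC; have f0 : 0 < j.+1`!%:R :> R by rewrite ltr0n fact_gt0.
apply: le_trans (_ : `|C| * y ^+ j * expR (- (eta * y)) <= _).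
  by rewrite ler_wpM2r ?expR_ge0 // ler_wpM2r ?exprn_ge0 ?(ltW y0) // ler_norm.
rewrite expRN ler_pdivrMr ?expR_gt0 //.
have ey0 : 0 <= eta * y by rewrite mulr_ge0 // ltW.
apply: le_trans (ler_wpM2l (ltW e0) (expR_ge_pow j ey0)).
rewrite mulrA ler_pdivlMr // exprMn [y ^+ j.+1]exprSr.
move: yC; rewrite ler_pdivrMr ?mulr_gt0 ?exprn_gt0 // => yC.
have := ler_wpM2r (exprn_ge0 j (ltW y0)) yC.
by apply: etrans; congr (_ <= _); ring.
Qed.

Lemma near_poly_exp (C : R) j (eta e : R) : 0 < eta -> 0 < e ->
  \forall n \near \oo, C * ln n%:R ^+ j * expR (- (eta * ln n%:R)) <= e.
Proof.
move=> eta0 e0; near=> n; apply: poly_exp_le => //.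
  by apply: lt_le_trans ltr01 _; near: n; exact: near_ln_ge.
by near: n; exact: near_ln_ge.
Unshelve. all: by end_near. Qed.

Lemma near_n_gt0 : \forall n \near \oo, (0 < n)%N.
Proof. exact: nbhs_infty_gt. Qed.

Lemma near_expR_ln : \forall n \near \oo, expR (ln n%:R) = n%:R :> R.
Proof. by near=> n; rewrite lnK // posrE ltr0n; near: n; exact: near_n_gt0.
Unshelve. all: by end_near. Qed.

Variable sigma : nat.
Hypothesis sigma_gt0 : (0 < sigma)%N.

Notation P n := (pr (@edge_weight R (p n) n.-1)).
Notation x n := (ln n%:R : R).

(** exp(-c/p) <= n^-kappa as soon as p log n <= c/kappa, a number above lambda; and K = O(1/p) is
    O(log n). *)
Lemma near_spanned_rare c kappa : 0 <= c -> (c%:E < lambda_ R sigma)%E ->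
  0 < kappa -> kappa < c / lambda ->
  exists2 B, 0 < B & \forall n \near \oo, exists K : nat,
  [/\ (1 < K)%N, (2 * K <= n.-1)%N, K%:R <= B * x n &
   forall s k, (K <= k < 2 * K)%N ->
     P n (fun E => spanned sigma E s k) <= expR (- (kappa * x n))].
Proof.
move=> c0 ltc k0 kc; have [B [B0 /near_right0 H]] := span_upper sigma_gt0 c0 ltc.
have l2 : lambda / 2 < lambda by rewrite ltr_pdivrMr // ltr_pMr // ltr1n.
have lck : lambda < c / kappa by rewrite ltr_pdivlMr // mulrC -ltr_pdivlMr.
exists (2 * B / lambda); first by rewrite divr_gt0 // mulr_gt0.
near=> n; have [K [K1 KB Kn]] : exists K : nat, [/\ (1 < K)%N, K%:R <= B / p n &
   forall m s k, (2 * K <= m)%N -> (K <= k < 2 * K)%N ->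
     pr (@edge_weight R (p n) m) (fun E => spanned sigma E s k) <= expR (- (c / p n))].
  by near: n.
have x1 : 1 <= x n by near: n; exact: near_ln_ge.
have x0 : 0 < x n by apply: lt_le_trans x1.
have lo : lambda / 2 <= p n * x n by near: n; apply: near_mul_ln_gt.
have hi : p n * x n <= c / kappa by near: n; apply: near_mul_ln_lt.
have p0 : 0 < p n by rewrite -(pmulr_lgt0 _ x0); apply: lt_le_trans lo; rewrite divr_gt0.
have KB' : K%:R <= 2 * B / lambda * x n.
  apply: le_trans KB _; rewrite ler_pdivrMr //.
  have -> : 2 * B / lambda * x n * p n = B * (p n * x n / (lambda / 2)).
    by field; rewrite gt_eqF.
  by rewrite ler_peMr ?(ltW B0) // ler_pdivlMr ?mul1r // divr_gt0.
have en : expR (x n) = n%:R by near: n; exact: near_expR_ln.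
have big : (4 * B / lambda + 1) * x n ^+ 1 * expR (- (1 * x n)) <= 1.
  by near: n; apply: near_poly_exp.
have K2 : (2 * K <= n.-1)%N.
  rewrite mul1r expr1 expRN ler_pdivrMr ?expR_gt0 // mul1r en in big.
  have : (2 * K).+1%:R <= n%:R :> R.
    rewrite -natr1 natrM; apply: le_trans big.
    have -> : (4 * B / lambda + 1) * x n = 2 * (2 * B / lambda * x n) + x n by ring.
    by move: KB' x1; lra.
  by rewrite ler_nat; clear; lia.
exists K; split=> // s k lek; apply: le_trans (Kn _ s k K2 lek) _.
rewrite ler_expR lerN2 ler_pdivlMr //.
have -> : kappa * x n * p n = p n * x n * kappa by ring.
by rewrite -ler_pdivlMr.
Unshelve. all: by end_near. Qed.

Notation cluster := (fun n E => cluster (@ring_graph n.+1) (adj E) sigma 1 None).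

(** The exponents satisfy lambda_sigma / lambda < c2 / lambda < k2 < kappa: a nucleus has
    probability at least n^-k2, and the powers of log n are absorbed between [k2] and [kappa]. *)
Lemma near_solved kappa e : (lambda_ R sigma < (kappa * lambda)%:E)%E ->
  0 < kappa < 1 -> 0 < e -> \forall n \near \oo, exists D : nat,
  D%:R <= expR (kappa * x n) /\
  P n (fun E => ~ forall u v, v \in cluster n.-1 E D u) <= e.
Proof.
move=> ltl /andP[k0 k1] e0.
have l_fin := lambda_fin_num ltl.
have l0 : 0 <= fine (lambda_ R sigma) by rewrite fine_ge0 // lambda_ge0.
have kl0 : 0 < kappa * lambda by rewrite mulr_gt0.
rewrite -(fineK l_fin) lte_fin in ltl.
pose c2 := (fine (lambda_ R sigma) + kappa * lambda) / 2.
have c20 : 0 < c2 by rewrite divr_gt0 // ltr_wpDl.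
have ltl2 : (lambda_ R sigma < c2%:E)%E.
  by rewrite -(fineK l_fin) lte_fin /c2; move: ltl; lra.
have ltc2 : c2 < kappa * lambda by rewrite /c2; move: ltl; lra.
pose k2 := (c2 / lambda + kappa) / 2.
have ck : c2 / lambda < kappa by rewrite ltr_pdivrMr.
have k2c : c2 / lambda < k2 by rewrite /k2; move: ck; lra.
have k2k : k2 < kappa by rewrite /k2; move: ck; lra.
have cl0 : 0 < c2 / lambda by rewrite divr_gt0.
have k20 : 0 < k2 by apply: lt_trans k2c.
have lck : c2 / k2 < lambda by rewrite ltr_pdivrMr // mulrC -ltr_pdivrMr.
have l2 : lambda / 2 < lambda by rewrite ltr_pdivrMr // ltr_pMr // ltr1n.
have low := near_right0 (nucleation_lower sigma_gt0 ltl2).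
near=> n.
have x1 : 1 <= x n by near: n; exact: near_ln_ge.
have x0 : 0 < x n by apply: lt_le_trans x1.
have n2 : (1 < n)%N by near: n; exact: nbhs_infty_gt.
have en : expR (x n) = n%:R by near: n; exact: near_expR_ln.
have lo : lambda / 2 <= p n * x n by near: n; apply: near_mul_ln_gt.
have lo2 : c2 / k2 <= p n * x n by near: n; apply: near_mul_ln_gt.
have p0 : 0 < p n by rewrite -(pmulr_lgt0 _ x0); apply: lt_le_trans lo; rewrite divr_gt0.
have lowL L : expR (- (c2 / p n)) <= \prod_(1 <= m < L) attach_low sigma (p n) m.
  move: L; near: n; exact: low.
have small : 9 * (8 / lambda + 1) * x n ^+ 3 * expR (- ((kappa - k2) * x n)) <= 1.
  by near: n; apply: near_poly_exp => //; rewrite subr_gt0.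
have smallP : (2 ^+ sigma + 1) * x n ^+ 0 * expR (- (1 * x n)) <= e.
  by near: n; apply: near_poly_exp.
pose q := expR (- (c2 / p n)); have q0 : 0 < q by apply: expR_gt0.
(* With L p >= 4 log n and q J >= 2 log n, both error terms, after a union bound over n positions,
   are O(1/n). *)
pose L := (Num.truncn (4 * x n / p n)).+1; pose J := (Num.truncn (2 * x n / q)).+1.
have xp0 : 0 <= 4 * x n / p n by rewrite divr_ge0 ?mulr_ge0 ?(ltW x0) ?(ltW p0).
have xq0 : 0 <= 2 * x n / q by rewrite divr_ge0 ?mulr_ge0 ?(ltW x0) ?(ltW q0).
have L_ge : 4 * x n / p n <= L%:R by apply/ltW/truncnS_gt.
have J_ge : 2 * x n / q <= J%:R by apply/ltW/truncnS_gt.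
have L_le : L%:R <= (8 / lambda + 1) * x n ^+ 2.
  have -> : L%:R = (Num.truncn (4 * x n / p n))%:R + 1 :> R by rewrite natr1.
  apply: le_trans (_ : 4 * x n / p n + 1 <= _).
    by rewrite lerD2r; case/andP: (truncn_itv xp0).
  have -> : (8 / lambda + 1) * x n ^+ 2 = 8 / lambda * x n ^+ 2 + x n ^+ 2 by ring.
  apply: lerD; last by rewrite expr_ge1 // ltW.
  rewrite ler_pdivrMr // expr2.
  have -> : 8 / lambda * (x n * x n) * p n = 4 * x n * (p n * x n / (lambda / 2)).
    by field; rewrite gt_eqF.
  rewrite ler_peMr ?mulr_ge0 ?(ltW x0) // ler_pdivlMr ?mul1r // divr_gt0 //.
have cp : c2 / p n <= k2 * x n.
  rewrite ler_pdivrMr //; have -> : k2 * x n * p n = p n * x n * k2 by ring.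
  by rewrite -ler_pdivrMr.
have qe : q^-1 <= expR (k2 * x n) by rewrite /q expRN invrK ler_expR.
have J_le : J%:R <= 3 * x n * expR (k2 * x n).
  have -> : J%:R = (Num.truncn (2 * x n / q))%:R + 1 :> R by rewrite natr1.
  apply: le_trans (_ : 2 * x n / q + 1 <= _).
    by rewrite lerD2r; case/andP: (truncn_itv xq0).
  have -> : 3 * x n * expR (k2 * x n) = 2 * x n * expR (k2 * x n) + x n * expR (k2 * x n) by ring.
  apply: lerD; first by rewrite ler_pM2l // mulr_gt0.
  apply: mulr_ege1 => //; apply: le_trans (expR_ge1Dx _).
  by rewrite lerDl mulr_ge0 ?(ltW k20) ?(ltW x0).
have D_le : 3 * (J * L)%:R <= expR (kappa * x n).
  rewrite natrM; apply: le_trans (_ : 3 * ((3 * x n * expR (k2 * x n)) * ((8 / lambda + 1) * x n ^+ 2)) <= _).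
    rewrite ler_pM2l //; exact: (ler_pM (ler0n _ _) (ler0n _ _) J_le L_le).
  have -> : kappa * x n = k2 * x n + (kappa - k2) * x n by ring.
  rewrite expRD; move: small; rewrite expRN ler_pdivrMr ?expR_gt0 // mul1r => small'.
  apply: le_trans (ler_wpM2l (expR_ge0 _) small').
  by rewrite le_eqVlt; apply/orP; left; apply/eqP; ring.
exists (3 * (J * L))%N; split; first by rewrite natrM.
have JL : (J * L <= n.-1)%N.
  have kn : expR (kappa * x n) <= n%:R 
    by rewrite -[X in _ <= X]en ler_expR ler_piMl ?(ltW x0) ?(ltW k1).
  have : (3 * (J * L) <= n)%N by rewrite -(ler_nat R) natrM (le_trans D_le).
  by clear -n2; lia.
apply: le_trans (pr_unsolved (p01 n) sigma_gt0 _ _ JL (lowL L)) _ => //.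
rewrite prednK; last exact: ltnW.
apply: le_trans smallP; rewrite expr0 mulr1 mul1r mulrDl.
have nex : n%:R * expR (- (2 * x n)) = expR (- x n).
  by rewrite -[X in X * _]en -expRD; congr expR; ring.
apply: lerD.
  rewrite mulrCA ler_pM2l ?exprn_gt0 // -nex ler_pM2l ?ltr0n ?(ltnW n2) // ler_expR lerN2.
  by move: L_ge; rewrite ler_pdivrMr //; lra.
rewrite mul1r -nex ler_pM2l ?ltr0n ?(ltnW n2) //.
apply: le_trans (_ : expR (- q) ^+ J <= _).
  apply: lerXn2r; rewrite ?nnegrE ?expR_ge0 //; last exact: expR_ge1Dx.
  by rewrite subr_ge0 /q expR_le1 oppr_le0 divr_ge0 ?(ltW c20) ?(ltW p0).
rewrite -expRM_natl ler_expR mulrN lerN2.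
by move: J_ge; rewrite ler_pdivrMr.
Unshelve. all: by end_near. Qed.

(** For t about n^a a window of width about n^a log n is enough, and it contains a spanned arc of
    critical length with probability at most n^(a - k1) up to powers of log n. Solving at a later
    time comes from [near_solved] with an exponent below 1. *)
Lemma near_lower_time a e : (lambda_ R sigma < lambda%:E)%E ->
  ((a * lambda)%:E < lambda_ R sigma)%E -> 0 < a -> 0 < e ->
  \forall n \near \oo, P n (fun E => ~ (expR (a * x n) <= (ring_time sigma E)%:R)) <= e.
Proof.
move=> ltl lta a0 e0; have l_fin := lambda_fin_num ltl.
pose alpha := fine (lambda_ R sigma) / lambda.
have lE : lambda_ R sigma = (alpha * lambda)%:E by rewrite /alpha divfK ?gt_eqF // fineK.
have a_alpha : a < alpha by move: lta; rewrite lE lte_fin ltr_pM2r.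
have alpha1 : alpha < 1 by move: ltl; rewrite lE lte_fin gtr_pMl.
(* Equally spaced exponents: a < k1 < c1 / lambda < alpha. *)
pose c1 := (a + 2 * alpha) / 3 * lambda; pose k1 := (2 * a + alpha) / 3.
have [B B0 rare] : exists2 B, 0 < B & \forall n \near \oo, exists K : nat,
  [/\ (1 < K)%N, (2 * K <= n.-1)%N, K%:R <= B * x n &
   forall s k, (K <= k < 2 * K)%N ->
     P n (fun E => spanned sigma E s k) <= expR (- (k1 * x n))].
  apply: (@near_spanned_rare c1).
  - by rewrite mulr_ge0 ?(ltW lambda_gt0) // divr_ge0 // addr_ge0 ?(ltW a0) // mulr_ge0 // ltW // (lt_trans a0).
  - by rewrite lE lte_fin ltr_pM2r //; move: a_alpha; lra.
  - by rewrite /k1; move: a0 a_alpha; lra.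
  - by rewrite /c1 mulfK ?gt_eqF // /k1; move: a_alpha; lra.
have solved : \forall n \near \oo, exists D : nat, D%:R <= expR ((alpha + 1) / 2 * x n) /\
  P n (fun E => ~ forall u v, v \in cluster n.-1 E D u) <= e / 2.
  apply: near_solved; last by rewrite divr_gt0.
    by rewrite lE lte_fin ltr_pM2r //; move: alpha1; lra.
  by apply/andP; split; move: a0 a_alpha alpha1; lra.
near=> n; have [K [K1 Kn KB rareK]] : exists K : nat,
  [/\ (1 < K)%N, (2 * K <= n.-1)%N, K%:R <= B * x n &
   forall s k, (K <= k < 2 * K)%N ->
     P n (fun E => spanned sigma E s k) <= expR (- (k1 * x n))] by near: n.
have [D [_ solD]] : exists D : nat, D%:R <= expR ((alpha + 1) / 2 * x n) /\
  P n (fun E => ~ forall u v, v \in cluster n.-1 E D u) <= e / 2 by near: n.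
have x1 : 1 <= x n by near: n; exact: near_ln_ge.
have x0 : 0 < x n by apply: lt_le_trans x1.
have n2 : (1 < n)%N by near: n; exact: nbhs_infty_gt.
have en : expR (x n) = n%:R by near: n; exact: near_expR_ln.
have small1 : 16 * B * x n ^+ 1 * expR (- ((1 - a) * x n)) <= 1.
  by near: n; apply: near_poly_exp => //; rewrite subr_gt0 (lt_trans a_alpha).
have small2 : 16 * B ^+ 2 * x n ^+ 2 * expR (- ((k1 - a) * x n)) <= e / 2.
  near: n; apply: near_poly_exp; last by rewrite divr_gt0.
  by rewrite /k1; move: a_alpha; lra.
have ex1 : 1 <= expR (a * x n).
  by apply: le_trans (expR_ge1Dx _); rewrite lerDl mulr_ge0 ?(ltW a0) ?(ltW x0).
pose t := Num.truncn (expR (a * x n)); pose W := (4 * K * t.+1)%N.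
have /andP[t_le t_gt] := truncn_itv (expR_ge0 (a * x n)).
have W_le : W%:R <= 8 * (B * x n) * expR (a * x n).
  rewrite !natrM; have -> : t.+1%:R = t%:R + 1 :> R by rewrite natr1.
  have -> : 8 * (B * x n) * expR (a * x n) = 4 * (B * x n) * (expR (a * x n) + expR (a * x n)) by ring.
  by apply: ler_pM; rewrite ?mulr_ge0 ?addr_ge0 // ?ler_pM2l // lerD.
have ea : expR (a * x n) = expR (x n) * expR (- ((1 - a) * x n)).
  by rewrite -expRD; congr expR; ring.
have Wn : (W <= n.-1)%N.
  have : (2 * W)%:R <= n%:R :> R.
    rewrite natrM -[X in _ <= X]en; apply: le_trans (_ : 2 * (8 * (B * x n) * expR (a * x n)) <= _).
      by rewrite ler_pM2l.
    rewrite ea -[X in _ <= X]mulr1; apply: le_trans (ler_wpM2l (expR_ge0 _) small1).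
    by rewrite le_eqVlt; apply/orP; left; apply/eqP; ring.
  by rewrite ler_nat; clear -n2; lia.
have main : P n (fun E => ~ (t < ring_time sigma E)%N) <=
    W.+1%:R * K%:R * expR (- (k1 * x n)) + e / 2.
  have leW : (4 * K * t.+1 <= W)%N by [].
  exact: (pr_fast (p01 n) K1 leW Wn rareK solD).
apply: (@le_trans _ _ (P n (fun E => ~ (t < ring_time sigma E)%N))).
  apply: pr_le => [u|E]; first exact: edge_weight01.
  by apply: contra_not => ltT; apply: le_trans (ltW t_gt) _; rewrite ler_nat.
apply: le_trans main _.
rewrite [X in _ <= X](_ : e = e / 2 + e / 2); last by field.
  rewrite lerD2r; apply: le_trans small2.
  apply: le_trans (_ : 2 * (8 * (B * x n) * expR (a * x n)) * (B * x n) * expR (- (k1 * x n)) <= _).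
    rewrite ler_wpM2r ?expR_ge0 //; apply: ler_pM => //.
    apply: le_trans (_ : 2 * W%:R <= _); last by rewrite ler_pM2l.
    by rewrite -natrM ler_nat /W; clear -K1; nia.
  have -> : expR (- ((k1 - a) * x n)) = expR (a * x n) * expR (- (k1 * x n)).
    by rewrite -expRD; congr expR; ring.
  by rewrite le_eqVlt; apply/orP; left; apply/eqP; ring.
Unshelve. all: by end_near. Qed.

End Asymptotics.

(** * Assembling the theorem *)

Section RingTime.
Variables (R : realType) (p : nat -> R) (sigma : nat).
Notation P n := (pr (@edge_weight R (p n) n.-1)).

(** The estimates live on rings of n.-1.+1 vertices; for n > 0 a case analysis identifies the two
    types. *)
Lemma er_prob_ring_time n (Q : pred nat) : (0 < n)%N ->
  er_prob (p n) [pred E : {set {set 'I_n}} | Q (ring_time sigma E)] =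
  P n (fun E => Q (ring_time sigma E)).
Proof. by case: n => // n _; rewrite er_probE. Qed.

End RingTime.

Lemma ln_nat_ge0 (R : realType) (t : nat) : 0 <= ln t%:R :> R.
Proof. by case: t => [|t]; [rewrite ln0|rewrite ln_ge0 // ler1n]. Qed.

Unset Implicit Arguments.

Theorem theorem5 (R : realType) (sigma : nat) (lambda : R) (p : nat -> R)
    (hsigma : (1 <= sigma)%N) (hlambda : 0 < lambda)
    (hp01 : forall n : nat, 0 <= p n <= 1)
    (hp : p ~_\oo (fun n : nat => lambda / ln n%:R)) :
  ((lambda%:E < lambda_ R sigma)%E ->
    exists C : R,
      (fun n : nat => er_prob (p n)
         [pred E : {set {set 'I_n}} |
           (ring_time sigma E)%:R <= C * ln n%:R]) @ \oo --> (1 : R)) /\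
  ((lambda_ R sigma < lambda%:E)%E ->
    er_cvg_in_prob p
      (fun (n : nat) (E : {set {set 'I_n}}) =>
         ln (ring_time sigma E)%:R / ln n%:R)
      (fine (lambda_ R sigma) / lambda)).
Proof.
pose P n := pr (@edge_weight R (p n) n.-1).
have w01 n e : 0 <= @edge_weight R (p n) n.-1 e <= 1 by apply: edge_weight01.
split=> [ltl | ltl].
  have [c ltc ltc'] : exists2 c, lambda < c & (c%:E < lambda_ R sigma)%E.
    case: (lambda_ R sigma) ltl => [l| |] //; last by exists (lambda + 1); rewrite ?ltrDl ?ltry.
    by rewrite lte_fin => ltl; exists ((lambda + l) / 2); rewrite ?lte_fin; move: ltl; lra.
  (* An exponent above 1, so that n^-kappa survives the union bound over the n starting points. *)
  pose kappa := (1 + c / lambda) / 2.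
  have c1 : 1 < c / lambda by rewrite ltr_pdivlMr // mul1r.
  have k1 : 1 < kappa by rewrite /kappa; move: c1; lra.
  have [B B0 rare] : exists2 B : R, 0 < B & \forall n \near \oo, exists K : nat,
    [/\ (1 < K)%N, (2 * K <= n.-1)%N, K%:R <= B * ln n%:R &
     forall s k, (K <= k < 2 * K)%N ->
       P n (fun E => spanned sigma E s k) <= expR (- (kappa * ln n%:R))].
    apply: (near_spanned_rare hlambda hp hsigma (c := c)) => //.
    - by rewrite ltW // (lt_trans hlambda).
    - by rewrite (lt_trans ltr01).
    - by rewrite /kappa; move: c1; lra.
  exists B; apply/cvgrPdist_le => e e0; near=> n.
  have [K [K1 Kn KB rareK]] : exists K : nat,
    [/\ (1 < K)%N, (2 * K <= n.-1)%N, K%:R <= B * ln n%:R &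
     forall s k, (K <= k < 2 * K)%N ->
       P n (fun E => spanned sigma E s k) <= expR (- (kappa * ln n%:R))] by near: n.
  have n0 : (0 < n)%N by near: n; exact: nbhs_infty_gt.
  have en : expR (ln n%:R) = n%:R :> R by near: n; exact: near_expR_ln.
  have small : B * ln n%:R ^+ 1 * expR (- ((kappa - 1) * ln n%:R)) <= e.
    by near: n; apply: near_poly_exp => //; rewrite subr_gt0.
  rewrite (er_prob_ring_time _ _ (fun t => t%:R <= B * ln n%:R)) // -pr_not ger0_norm ?pr_ge0 //.
  have main : P n (fun E => ~ (ring_time sigma E < K)%N) <=
      n.-1.+1%:R * K%:R * expR (- (kappa * ln n%:R)).
    exact: (pr_late (hp01 n) K1 rareK).
  apply: (@le_trans _ _ (P n (fun E => ~ (ring_time sigma E < K)%N))).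
    apply: pr_le => // E; apply: contra_not => ltK.
    by apply: le_trans KB; rewrite ler_nat ltnW.
  apply: le_trans main _; rewrite prednK //; apply: le_trans small; rewrite expr1.
  have -> : expR (- ((kappa - 1) * ln n%:R)) = n%:R * expR (- (kappa * ln n%:R)).
    by rewrite -[X in _ = X * _]en -expRD; congr expR; ring.
  by rewrite mulrA ler_wpM2r ?expR_ge0 // mulrC ler_wpM2r.
move=> eps eps0; have l_fin := lambda_fin_num ltl.
set alpha := fine _ / lambda.
have lE : lambda_ R sigma = (alpha * lambda)%:E by rewrite /alpha divfK ?gt_eqF // fineK.
have alpha0 : 0 <= alpha by rewrite divr_ge0 ?(ltW hlambda) // fine_ge0 // lambda_ge0.
have alpha1 : alpha < 1 by move: ltl; rewrite lE lte_fin gtr_pMl.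
apply/cvgrPdist_le => e e0.
have e2 : 0 < e / 2 by rewrite divr_gt0.
(* Below alpha + eps for the conclusion and below 1 for [near_solved]. *)
pose kappa := Num.min (alpha + eps) ((alpha + 1) / 2).
have ak : alpha < kappa by rewrite lt_min; apply/andP; split; move: alpha1 eps0; lra.
have kap : kappa <= alpha + eps by rewrite ge_min lexx.
have k1 : kappa < 1 by rewrite gt_min; apply/orP; right; move: alpha1; lra.
have upper : \forall n \near \oo, exists D : nat, D%:R <= expR (kappa * ln n%:R) /\
    P n (fun E => ~ (ring_time sigma E <= D)%N) <= e / 2.
  have := near_solved hlambda hp01 hp hsigma (kappa := kappa) (e := e / 2) _ _ e2.
  rewrite lE lte_fin ltr_pM2r // => /(_ ak); rewrite k1 (le_lt_trans alpha0 ak) => /(_ isT).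
  by apply: filterS => n [D [leD sol]]; exists D; split=> //; apply: pr_slow sol.
have lower : \forall n \near \oo,
    P n (fun E => ~ ((alpha - eps) * ln n%:R <= ln (ring_time sigma E)%:R)) <= e / 2.
  (* For a nonpositive exponent the bound is trivial, since log T_f >= 0, also for T_f = 0 by the
     convention ln 0 = 0. *)
  have [le0|gt0] := leP (alpha - eps) 0.
    near=> n; have x0 : 0 <= ln n%:R :> R by exact: ln_nat_ge0.
    rewrite [X in X <= _](_ : _ = 0) ?(ltW e2) // /P /pr big1 // => E _.
    rewrite asboolF ?mulr0 // => /negP; rewrite (le_trans _ (ln_nat_ge0 _ _)) //.
    by rewrite mulr_le0_ge0.
  have lta : (((alpha - eps) * lambda)%:E < lambda_ R sigma)%E.
    by rewrite lE lte_fin ltr_pM2r //; move: eps0; lra.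
  have := near_lower_time hlambda hp01 hp hsigma ltl lta gt0 e2.
  apply: filterS => n; apply: le_trans; apply: pr_le => // E; apply: contra_not => leT.
  rewrite -[X in X <= _]expRK ler_ln ?posrE ?expR_gt0 //.
  exact: lt_le_trans (expR_gt0 _) leT.
near=> n.
have n0 : (0 < n)%N by near: n; exact: nbhs_infty_gt.
have x1 : 1 <= ln n%:R :> R by near: n; exact: near_ln_ge.
have x0 : 0 < ln n%:R :> R by apply: lt_le_trans x1.
have [D [leD fast]] : exists D : nat, D%:R <= expR (kappa * ln n%:R) /\
    P n (fun E => ~ (ring_time sigma E <= D)%N) <= e / 2 by near: n.
have slow : P n (fun E => ~ ((alpha - eps) * ln n%:R <= ln (ring_time sigma E)%:R)) <= e / 2.
  by near: n.
rewrite (er_prob_ring_time _ _ (fun t => eps < `|ln t%:R / ln n%:R - alpha|)) //.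
rewrite sub0r normrN ger0_norm ?pr_ge0 //.
rewrite [X in _ <= X](_ : e = e / 2 + e / 2); last by field.
apply: le_trans (lerD fast slow); apply: le_trans (pr_or (w01 n) _ _).
apply: pr_le => // E; apply: contraPP => /not_orP[/contrapT leT /contrapT geT].
apply/negP; rewrite -leNgt ler_distl; apply/andP; split; first by rewrite ler_pdivlMr.
rewrite ler_pdivrMr //; apply: le_trans (_ : kappa * ln n%:R <= _); last by rewrite ler_pM2r.
have [->|T0] := eqVneq (ring_time sigma E) 0%N.
  by rewrite ln0 // mulr_ge0 ?(ltW x0) // (le_trans alpha0) // ltW.
rewrite -[X in _ <= X]expRK ler_ln ?posrE ?expR_gt0 ?ltr0n ?lt0n //.
by apply: le_trans leD; rewrite ler_nat.
Unshelve. all: by end_near. Qed.
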